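(* Let $k>4$, let $u_0=(u_0^1,u_0^2)\in H^k(\mathbb{T}^2;\mathbb{R}^2)$, and let $u$ be the corresponding local solution of the periodic Euler-Poincaré equations on $\mathbb{T}^2$ with initial velocity $u_0$. Let $\theta\in\mathbb{R}$ be a constant, let $n=(\cos\theta,\sin\theta)$, and suppose that $\frac{\partial u_0^i}{\partial n}=\cos\theta\,\partial_x u_0^i+\sin\theta\,\partial_y u_0^i=0$ on $\mathbb{T}^2$ for $i=1,2$. If there is a point $(x_0,y_0)\in\mathbb{T}^2$ such that, at $(x_0,y_0)$, $$\sin^2\theta\,\partial_x u_0^1-\sin\theta\cos\theta\,\partial_y u_0^1-\sin\theta\cos\theta\,\partial_x u_0^2+\cos^2\theta\,\partial_y u_0^2<-\sqrt{2}\,\|u_0\|_{H^1},$$ then the solution $u$ blows up in finite time.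
   Context: $\mathbb{T}^2=\mathbb{R}^2/\mathbb{Z}^2$ (functions of $(x,y)$ of period $1$ in each coordinate). The periodic Euler-Poincaré equations in dimension $d$ for the velocity $u=(u^1,\dots,u^d)$ with momentum $m=(1-\Delta)u$ are $$\partial_t m^i+\sum_{j=1}^d u^j\partial_j m^i+\sum_{j=1}^d m^j\partial_i u^j+m^i\sum_{j=1}^d\partial_j u^j=0,\quad i=1,\dots,d,\qquad m|_{t=0}=m_0=(1-\Delta)u_0,$$ here with $d=2$. For $u_0\in H^k(\mathbb{T}^d)$ with $k>\frac d2+3$ there is a time $T>0$ and a unique solution $u\in C([0,T];H^k(\mathbb{T}^d))$; this is the ''corresponding local solution'', extended to its maximal existence time (lifespan) $T^*\in(0,\infty]$ in $H^k$. ''Blows up in finite time'' means $T^*<\infty$ (in which case $\limsup_{t\to T^*}\|u(t)\|_{H^k}=\infty$). The $H^1$ norm is $\|u\|_{H^1}^2=\int_{\mathbb{T}^d}\left(|u|^2+|\nabla u|^2\right)dx$. *)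

(* Defs.v *)
From mathcomp Require Import all_boot all_order all_algebra.
From mathcomp Require Import all_classical all_reals all_analysis.

Set Implicit Arguments.
Unset Strict Implicit.
Unset Printing Implicit Defensive.

Import Order.TTheory GRing.Theory Num.Theory numFieldNormedType.Exports.

Local Open Scope classical_set_scope.
Local Open Scope ring_scope.

(* A function on the torus R^2 / Z^2 is a function on R^2 of period 1 in each
   coordinate; the integral over the torus is the one over the unit square. *)
Definition periodic2 (R : realType) (f : R * R -> R) : Prop :=
  forall p : R * R, f (p.1 + 1, p.2) = f p /\ f (p.1, p.2 + 1) = f p.

Definition torus_integral (R : realType) (f : R * R -> R) : R :=
  \int[(@lebesgue_measure R \x @lebesgue_measure R)%E]_(p in
    `[0, 1]%classic `*` `[0, 1]%classic) f p.

Definition basis2 (R : realType) (j : 'I_2) : R * R :=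
  if j == 0 then (1, 0) else (0, 1).

Definition partial (R : realType) (j : 'I_2) (f : R * R -> R) : R * R -> R :=
  fun p => 'D_(basis2 R j) f p.

(* Squared modulus of the Fourier coefficient
   \int f(p) exp(- 2 i pi xi . p) dp of a real-valued f. *)
Definition fourier_sq (R : realType) (f : R * R -> R) (xi : int * int) : R :=
  let phase (p : R * R) := 2 * pi * (xi.1%:~R * p.1 + xi.2%:~R * p.2) in
  torus_integral (fun p => f p * cos (phase p)) ^+ 2 +
  torus_integral (fun p => f p * sin (phase p)) ^+ 2.

(* The weight (1 + |2 pi xi|^2)^k is the symbol of (1 - Delta)^k. *)
Definition sobolev_norm_sq (R : realType) (k : R) (f : R * R -> R) : \bar R :=
  (\esum_(xi in [set: int * int])
    (((1 + (2 * pi) ^+ 2 * (xi.1%:~R ^+ 2 + xi.2%:~R ^+ 2)) `^ k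
      * fourier_sq f xi)%:E))%E.

(* Membership in H^k of the torus, only meant for k > 1: every class in H^k then
   has exactly one continuous representative, with which it is identified. For
   k > 3 this representative is of class C^2, and (1 - Delta) f is of class C^1
   if k > 4, so that the pointwise derivatives used below exist. *)
Definition sobolev (R : realType) (k : R) (f : R * R -> R) : Prop :=
  [/\ periodic2 f, continuous f & (sobolev_norm_sq k f < +oo)%E].

Definition H1_norm (R : realType) (u : 'I_2 -> R * R -> R) : R :=
  Num.sqrt (torus_integral (fun p =>
    \sum_(i < 2) (u i p) ^+ 2 +
    \sum_(i < 2) \sum_(j < 2) (partial j (u i) p) ^+ 2)).

Definition momentum (R : realType) (u : 'I_2 -> R * R -> R) :
    'I_2 -> R * R -> R :=
  fun i p => u i p - \sum_(j < 2) partial j (partial j (u i)) p.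

(* u belongs to C([0, T]; H^k), componentwise. *)
Definition continuous_sobolev (R : realType) (k T : R)
    (u : R -> 'I_2 -> R * R -> R) : Prop :=
  forall t : R, t \in `[0, T] -> forall i : 'I_2,
    sobolev k (u t i) /\
    sobolev_norm_sq k (fun p => u s i p - u t i p)
      @[s --> within `[0, T]%classic (nbhs t)] --> 0%E.

(* u solves the Euler-Poincare equations on [0, T] with initial velocity u0.
   For k > 4 all terms but the time derivative are continuous in (t, p), so that
   the equation for 0 < t < T and the continuity of u on [0, T] give the
   equation with one-sided time derivatives at t = 0 and t = T. *)
Definition EP_solution (R : realType) (k : R) (u0 : 'I_2 -> R * R -> R) (T : R)
    (u : R -> 'I_2 -> R * R -> R) : Prop :=
  [/\ continuous_sobolev k T u,
      forall i p, u 0 i p = u0 i p &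
      forall t : R, 0 < t < T -> forall (i : 'I_2) (p : R * R),
        let m s := momentum (u s) in
        derivable (fun s => m s i p) t 1 /\
        derive1 (fun s => m s i p) t
        + \sum_(j < 2) u t j p * partial j (m t i) p
        + \sum_(j < 2) m t j p * partial i (u t j) p
        + m t i p * \sum_(j < 2) partial j (u t j) p = 0].

(* u is the solution with initial velocity u0 on its maximal interval of
   existence [0, Tmax), where Tmax is the lifespan in H^k, possibly +oo. *)
Definition maximal_EP_solution (R : realType) (k : R)
    (u0 : 'I_2 -> R * R -> R) (Tmax : \bar R)
    (u : R -> 'I_2 -> R * R -> R) : Prop :=
  [/\ (0 < Tmax)%E,
      forall T : R, 0 < T -> (T%:E < Tmax)%E -> EP_solution k u0 T u &
      forall (T : R) (v : R -> 'I_2 -> R * R -> R),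
        0 < T -> EP_solution k u0 T v -> (T%:E <= Tmax)%E].

Definition blows_up_in_finite_time (R : realType) (Tmax : \bar R) : Prop :=
  (Tmax < +oo)%E.

(* Main.v *)
Require Import Defs.
From mathcomp Require Import all_boot all_order all_algebra.
From mathcomp Require Import all_classical all_reals all_analysis.
From mathcomp Require Import measurable_realfun.
From mathcomp Require Import ring lra zify.

(* Suppose that the solution is global. Functions in H^k with k > 4 are sums of Fourier
   series which can be differentiated three times, so that u is of class C^3 in space,
   uniformly continuously in time. The H^1 energy of u is conserved, and the difference of
   u with its translate in a direction satisfies a Gronwall inequality for the same energy,
   so that u stays constant along n = (cos theta, sin theta) and only depends on the
   coordinate along w = (- sin theta, cos theta). Put V = w . u and U = n . u, and let
   D = V_w be the strain, where _w is the derivative along w. Then w . m = V - V_ww, and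
   writing D as the convolution of w . m with the derivative of the periodic Green
   function K of 1 - d^2/dw^2 gives
     D_t = - D^2 - V D_w + F - K * F,  F = V^2 + (V_w^2 + U^2 - U_w^2) / 2.
   At a point where D is minimal in space D_w = 0, and the bounds 1/2 <= K <= 3/2 on a
   period give D_t <= - D^2 / 2 + |u|_{H^1}^2 = - D^2 / 2 + |u_0|_{H^1}^2. As the minimum of
   D is initially below - sqrt 2 |u_0|_{H^1}, this Riccati inequality drives it to
   - oo in finite time. *)

Set Implicit Arguments.
Unset Strict Implicit.
Unset Printing Implicit Defensive.

Import Order.TTheory GRing.Theory Num.Theory numFieldNormedType.Exports.

Local Open Scope classical_set_scope.
Local Open Scope ring_scope.

(** * Integrals over the interval and the torus *)

Section Integrals.
Context {R : realType}.
Implicit Types (f g h : R * R -> R) (F G : R -> R).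
Notation mu := (@lebesgue_measure R).

(** The equation provides a time derivative of the momentum only, never of u. Energy and strain are
    therefore differentiated through the momentum: the energy by the symmetry of 1 - Delta, the
    strain by its representation with the Green function. Lines along w need not close up on the
    torus. The one-dimensional analysis runs on a coordinate line of direction e_j with w_j <> 0,
    which closes after length 1; there d/dw is w_j^-1 d/dy, and K is the Green function of 1 -
    w_j^-2 d^2/dy^2. The two bounds on K serve terms of opposite sign in F: the lower one controls
    V^2 and the upper one U_w^2. The pointwise values of V^2 and U^2 in F are absorbed in the energy
    by a Sobolev inequality on the line. The minimum of D over space need not be differentiable in
    time. Instead, the existence of a point with l(t) D <= -1, for an affine weight l, is propagated
    in time, and only the derivative at a fixed minimum point is used. *)

Definition int01 G : R := \int[mu]_(x in `[0, 1]) G x.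

(** The plane is second countable: an open set is a countable union of squares with rational centres
    and radii. This places the Borel sets in the product sigma-algebra, where the product measure
    lives. *)
Lemma open_measurable_prod (O : set (R * R)) : open O -> measurable O.
Proof.
move=> oO.
pose B (a b r : rat) : set (R * R) := ball (ratr a : R) (ratr r) `*` ball (ratr b : R) (ratr r).
have -> : O = \bigcup_a \bigcup_b \bigcup_r
    (if pselect (B a b r `<=` O) then B a b r else set0).
  apply/seteqP; split=> [p Op|p [a _ [b _ [r _]]]]; last first.
    by case: pselect => // BO; exact: BO.
  have /nbhs_ballP[e /= e0 peO] := open_nbhs_nbhs (conj oO Op).
  have /rat_in_itvoo[r] : 0 < e / 2 by rewrite divr_gt0.
  rewrite in_itv /= => /andP[r0 re].
  have /rat_in_itvoo[a] : p.1 - ratr r < p.1 + ratr r by lra.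
  rewrite in_itv /= => /andP[a1 a2].
  have /rat_in_itvoo[b] : p.2 - ratr r < p.2 + ratr r by lra.
  rewrite in_itv /= => /andP[b1 b2].
  exists a => //; exists b => //; exists r => //.
  have Bp : B a b r p.
    by split; rewrite /ball /= ltr_norml; apply/andP; split; lra.
  case: pselect => // nB; exfalso; apply: nB => q [].
  rewrite /ball /= !ltr_norml => /andP[? ?] /andP[? ?].
  by apply: peO; split; rewrite /ball /= ltr_norml; apply/andP; split; lra.
apply: bigcupT_measurable_rat => a; apply: bigcupT_measurable_rat => b.
apply: bigcupT_measurable_rat => r; case: pselect => BO; last exact: measurable0.
by apply: measurableX; rewrite ball_itv.
Qed.

Lemma continuous_measurable_prod f : continuous f -> measurable_fun setT f.
Proof.
move=> cf; apply: (measurability _ (RGenOInfty.measurableE R)).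
move=> _ [_ [a ->] <-]; rewrite setTI; apply: open_measurable_prod.
by apply: open_comp => // p _; exact: cf.
Qed.

Let sq : set (R * R) := `[0, 1]%classic `*` `[0, 1]%classic.

Lemma compact_square : compact sq.
Proof. by apply: compact_setX; exact: segment_compact. Qed.

Lemma integrable01 G : continuous G -> mu.-integrable `[0, 1] (EFin \o G).
Proof.
move=> cG; apply: continuous_compact_integrable; first exact: segment_compact.
exact: continuous_subspaceT.
Qed.

Lemma continuous_bounded_square f : continuous f -> [bounded f x | x in sq].
Proof.
move=> cf; have /compact_bounded[M [_ mrt]] :
    compact (f @` sq).
  apply: continuous_compact; [exact: continuous_subspaceT|exact: compact_square].
by exists M; split; rewrite ?num_real // => ? ? ? ?; exact: mrt.
Qed.

Lemma measure_square : (mu \x mu)%E sq = 1%E.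
Proof.
rewrite product_measure1E //= lebesgue_measure_itv /= lte_fin ltr01.
by rewrite oppr0 adde0 mul1e.
Qed.

Lemma integrable_square f :
  continuous f -> (mu \x mu)%E.-integrable sq (EFin \o f).
Proof.
move=> cf; apply: measurable_bounded_integrable.
- exact: measurableX.
- by rewrite [X in (X < _)%E]measure_square ltry.
- by apply: measurable_funTS; exact: continuous_measurable_prod.
- exact: continuous_bounded_square.
Qed.

Lemma torus_integralD f g : continuous f -> continuous g ->
  torus_integral (fun p => f p + g p) = torus_integral f + torus_integral g.
Proof.
move=> cf cg; apply: RintegralD; [exact: measurableX|exact: integrable_square..].
Qed.

Lemma torus_integralZ (a : R) f : continuous f ->
  torus_integral (fun p => a * f p) = a * torus_integral f.
Proof.
move=> cf; apply: RintegralZl; [exact: measurableX|exact: integrable_square].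
Qed.

Lemma torus_integral_cst (a : R) : torus_integral (fun=> a) = a.
Proof.
rewrite /torus_integral Rintegral_cst ?[X in fine X]measure_square ?mulr1//.
exact: measurableX.
Qed.

Lemma le_torus_integral f g : continuous f -> continuous g ->
  (forall p, f p <= g p) -> torus_integral f <= torus_integral g.
Proof.
move=> cf cg fg; apply: le_Rintegral => //;
  [exact: measurableX|exact: integrable_square..].
Qed.

Lemma int01D F G : continuous F -> continuous G ->
  int01 (fun x => F x + G x) = int01 F + int01 G.
Proof. by move=> cF cG; apply: RintegralD => //; exact: integrable01. Qed.

Lemma int01Z (a : R) F : continuous F -> int01 (fun x => a * F x) = a * int01 F.
Proof. by move=> cF; apply: RintegralZl => //; exact: integrable01. Qed.

Lemma int01_cst (a : R) : int01 (fun=> a) = a.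
Proof.
rewrite /int01 Rintegral_cst //= lebesgue_measure_itv /= lte_fin ltr01.
by rewrite oppr0 adde0 mulr1.
Qed.

Lemma le_int01 F G : continuous F -> continuous G ->
  (forall x, 0 <= x <= 1 -> F x <= G x) -> int01 F <= int01 G.
Proof.
move=> cF cG FG; apply: le_Rintegral => [//|||x /=].
- exact: integrable01.
- exact: integrable01.
- by rewrite in_itv /=; exact: FG.
Qed.

Lemma int01_derive F G : continuous G ->
  (forall x : R, 0 <= x <= 1 -> is_derive x 1 F (G x)) -> int01 G = F 1 - F 0.
Proof.
move=> cG dF; have cF x : 0 <= x <= 1 -> {for x, continuous F}.
  by move=> /dF[dFx _]; apply: differentiable_continuous; apply/derivable1_diffP.
rewrite /int01 /Rintegral (@continuous_FTC2 _ _ F)//.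
- exact: continuous_subspaceT.
- split=> [x||].
  + by rewrite in_itv /= => /andP[/ltW x0 /ltW x1]; have [] := dF x (introT andP (conj x0 x1)).
  + by apply: cvg_at_right_filter; apply: cF; rewrite lexx ler01.
  + by apply: cvg_at_left_filter; apply: cF; rewrite lexx ler01.
- move=> x; rewrite in_itv /= => /andP[/ltW x0 /ltW x1].
  by rewrite derive1E; have [_ ->] := dF x (introT andP (conj x0 x1)).
Qed.

Let integrable_square_patch f : continuous f ->
  (mu \x mu)%E.-integrable setT ((EFin \o f) \_ sq).
Proof.
move=> cf; have := integrable_square cf.
by rewrite integrable_mkcond//; exact: measurableX.
Qed.

Lemma continuous_slice1 f x : continuous f -> continuous (fun y => f (x, y)).
Proof.
move=> cf y; apply: (@continuous_comp _ _ _ (fun y => (x, y)) f); last exact: cf.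
by apply: (cvg_pair (G := nbhs x) (H := nbhs y)); [exact: cvg_cst|exact: cvg_id].
Qed.

Lemma continuous_slice2 f y : continuous f -> continuous (fun x => f (x, y)).
Proof.
move=> cf x; apply: (@continuous_comp _ _ _ (fun x => (x, y)) f); last exact: cf.
by apply: (cvg_pair (G := nbhs x) (H := nbhs y)); [exact: cvg_id|exact: cvg_cst].
Qed.

Lemma torus_integral_iter f : continuous f ->
  torus_integral f = int01 (fun x => int01 (fun y => f (x, y))).
Proof.
move=> cf; rewrite /torus_integral /Rintegral integral_mkcond.
rewrite -(integral12_prod_meas1 (integrable_square_patch cf)).
rewrite /int01 {1}/Rintegral [in RHS]integral_mkcond; congr fine.
apply: eq_integral => x _; rewrite patchE; case: ifPn => xI; last first.
  by apply: integral0_eq => y _; rewrite patchE in_setX /= (negbTE xI).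
rewrite /Rintegral fineK; last first.
  apply: integrable_fin_num => //.
  by apply: integrable01; exact: continuous_slice1.
rewrite [RHS]integral_mkcond; apply: eq_integral => y _.
by rewrite !patchE in_setX /= xI.
Qed.

Lemma torus_integral_iterC f : continuous f ->
  torus_integral f = int01 (fun y => int01 (fun x => f (x, y))).
Proof.
move=> cf; rewrite /torus_integral /Rintegral integral_mkcond.
rewrite -(integral21_prod_meas1 (integrable_square_patch cf)).
rewrite /int01 {1}/Rintegral [in RHS]integral_mkcond; congr fine.
apply: eq_integral => y _; rewrite patchE; case: ifPn => yI; last first.
  by apply: integral0_eq => x _; rewrite patchE in_setX /= (negbTE yI) andbF.
rewrite /Rintegral fineK; last first.
  apply: integrable_fin_num => //.
  by apply: integrable01; exact: continuous_slice2.
rewrite [RHS]integral_mkcond; apply: eq_integral => x _.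
by rewrite !patchE in_setX /= yI andbT.
Qed.

Lemma torus_integral_eq0 f (x y : R) : continuous f -> (forall p, 0 <= f p) ->
  torus_integral f = 0 -> 0 <= x <= 1 -> 0 <= y <= 1 -> f (x, y) = 0.
Proof.
move=> cf f0 If0 x01 y01; apply/eqP; rewrite eq_le f0 andbT leNgt; apply/negP => fp.
have /nbhs_ballP[e /= e0 he] : nbhs (x, y) (fun q => f (x, y) / 2 < f q).
  by apply: (cvgr_gt _ (cf (x, y))); lra.
pose r := Num.min e 1 / 2.
have r0 : 0 < r by rewrite divr_gt0// lt_min e0 ltr01.
have re : r < e by rewrite /r; have := ge_min e e 1; rewrite lexx /= => ?; lra.
have r1 : r <= 1 / 2 by rewrite /r; have := ge_min 1 e 1; rewrite lexx orbT => ?; lra.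
(* The point may lie on the boundary of the unit square, so the small interval extends to its right
   in the left half and to its left otherwise; r <= 1/2 keeps it inside. *)
have side (z : R) : 0 <= z <= 1 -> exists a : R, [/\ 0 <= a, a + r <= 1, a <= z & z <= a + r].
  move=> /andP[z0 z1]; case: (lerP z (1/2)) => hz.
    by exists z; split; lra.
  by exists (z - r); split; lra.
have [a [a0 a1 ax xa]] := side _ x01; have [b [b0 b1 by_ yb]] := side _ y01.
pose D : set (R * R) := `[a, a + r]%classic `*` `[b, b + r]%classic.
have Dsq : D `<=` sq.
  move=> p; rewrite /D /sq /= !in_itv /= => -[/andP[? ?] /andP[? ?]].
  by split; apply/andP; split; lra.
have DB p : D p -> f (x, y) / 2 <= f p.
  case: p => u v []; rewrite /= !in_itv /= => /andP[? ?] /andP[? ?].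
  rewrite ltW//; apply: (he (u, v)); split; rewrite /ball /= ltr_norml;
    by apply/andP; split; lra.
have muD : (mu \x mu)%E D = (r * r)%:E.
  rewrite /D product_measure1E //= !lebesgue_measure_itv /= !lte_fin.
  by rewrite !ltrDl r0 -!EFinD -EFinM; congr EFin; ring.
have : (0 < \int[(mu \x mu)%E]_(p in sq) (f p)%:E)%E.
  apply: (@lt_le_trans _ _ (\int[(mu \x mu)%E]_(p in D) (f p)%:E)%E); last first.
    apply: ge0_subset_integral; [exact: measurableX|exact: measurableX|..].
    - apply: measurable_funTS; apply: measurableT_comp => //.
      exact: continuous_measurable_prod.
    - by move=> p _; rewrite lee_fin.
    - by [].
  apply: (@lt_le_trans _ _ (\int[(mu \x mu)%E]_(p in D) (f (x, y) / 2)%:E)%E).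
    rewrite integral_cst; last exact: measurableX.
    rewrite [X in (_ * X)%E]muD -EFinM lte_fin; apply: mulr_gt0; last exact: mulr_gt0.
    by apply: divr_gt0.
  apply: ge0_le_integral; first exact: measurableX.
  - by move=> p _; rewrite lee_fin divr_ge0// ltW.
  - by [].
  - apply: measurable_funTS; apply: measurableT_comp => //.
    exact: continuous_measurable_prod.
  - by move=> p Dp; rewrite lee_fin DB.
have fin : (\int[(mu \x mu)%E]_(p in sq) (f p)%:E)%E \is a fin_num.
  by apply: integrable_fin_num (integrable_square cf); exact: measurableX.
by rewrite -(fineK fin) [fine _]If0 ltxx.
Qed.

End Integrals.

(** * Periodic functions of class C^n *)

Section Calculus.
Context {R : realType}.
Implicit Types (f g h : R * R -> R) (p v : R * R) (n : nat) (j : 'I_2).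

Lemma is_derive_line f p v (s d : R) :
  is_derive (p + s *: v) v f d -> is_derive s (1 : R) (fun r : R => f (p + r *: v)) d.
Proof.
move=> [df <-].
have E : (fun h : R => h^-1 *: (((fun r : R => f (p + r *: v)) \o shift s) (h *: (1 : R))
     - f (p + s *: v))) =
   (fun h : R => h^-1 *: ((f \o shift (p + s *: v)) (h *: v) - f (p + s *: v))).
  apply/funext => h /=; congr (_ *: (f _ - _)).
  by rewrite [h%:A]mulr1 scalerDl addrCA addrA.
by split; rewrite /derivable /derive E.
Qed.

Lemma is_derive_pt f p v d :
  is_derive (0 : R) (1 : R) (fun r : R => f (p + r *: v)) d -> is_derive p v f d.
Proof.
move=> [df <-].
have E : (fun h : R => h^-1 *: (((fun r : R => f (p + r *: v)) \o shift 0) (h *: (1 : R))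
     - f (p + 0 *: v))) =
   (fun h : R => h^-1 *: ((f \o shift p) (h *: v) - f p)).
  apply/funext => h /=; rewrite scale0r addr0 [h%:A]mulr1 addr0; congr (_ *: (f _ - _)).
  by rewrite addrC.
by split; rewrite /derivable /derive -E.
Qed.

(** [partial] is a total function, meaningful only where the limit exists; derivability is therefore
    recorded at every level, together with the periodicity that makes these functions live on the
    torus. *)
Fixpoint Cn n f : Prop :=
  [/\ periodic2 f, continuous f &
      if n is m.+1 then
        forall j, (forall p, derivable f p (basis2 R j)) /\ Cn m (partial j f)
      else True].

Lemma Cn_periodic n f : Cn n f -> periodic2 f. Proof. by case: n => [|n] []. Qed.
Lemma Cn_continuous n f : Cn n f -> continuous f. Proof. by case: n => [|n] []. Qed.

Lemma Cn_partial n f j : Cn n.+1 f -> Cn n (partial j f).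
Proof. by case=> _ _ /(_ j)[]. Qed.

Lemma Cn_derive n f j p : Cn n.+1 f -> is_derive p (basis2 R j) f (partial j f p).
Proof. by case=> _ _ /(_ j)[+ _] => /(_ p) ?; apply: DeriveDef. Qed.

Lemma CnS n f : Cn n.+1 f -> Cn n f.
Proof.
elim: n f => [|n IH] f; first by case.
by move=> [pf cf df]; split=> // j; have [? /IH] := df j.
Qed.

Lemma Cn_le m n f : (m <= n)%N -> Cn n f -> Cn m f.
Proof. by elim: n => [|n IH]; rewrite leq_eqVlt => /predU1P[->//|] // /IH h /CnS/h. Qed.

Lemma CnP n f (df : 'I_2 -> R * R -> R) : periodic2 f -> continuous f ->
  (forall j p, is_derive p (basis2 R j) f (df j p)) -> (forall j, Cn n (df j)) ->
  Cn n.+1 f /\ forall j, partial j f = df j.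
Proof.
move=> pf cf dfE Cdf.
have E j : partial j f = df j by apply/funext => p; have [_ <-] := dfE j p.
by split=> //; split=> // j; split; [move=> p; case: (dfE j p)|rewrite E].
Qed.

Lemma Cn_cst n (a : R) : Cn n (fun=> a) /\ forall j, partial j (fun=> a) = fun=> 0.
Proof.
have E (b : R) j : partial j (fun=> b) = fun=> 0.
  by apply/funext => p; exact: derive_cst.
split=> //; elim: n a => [|n IH] a; first by split=> // p; exact: cvg_cst.
split=> // [p|j]; first exact: cvg_cst.
by split=> [p|]; [exact: derivable_cst|rewrite E].
Qed.

Lemma CnD n f g : Cn n f -> Cn n g -> Cn n (fun p => f p + g p).
Proof.
elim: n f g => [|n IH] f g Cf Cg.
  split=> // p; first by case: Cf => /(_ p)[? ?] _ _; case: Cg => /(_ p)[? ?] _ _; split; congruence.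
  by apply: cvgD; [case: Cf => _ + _; apply|case: Cg => _ + _; apply].
apply: (proj1 (@CnP n _ (fun j p => partial j f p + partial j g p) _ _ _ _)).
- by move=> p; case: Cf => /(_ p)[? ?] _ _; case: Cg => /(_ p)[? ?] _ _; split; congruence.
- by move=> p; apply: cvgD; [case: Cf => _ + _; apply|case: Cg => _ + _; apply].
- by move=> j p; apply: is_deriveD; apply: Cn_derive; eassumption.
- by move=> j; apply: IH; apply: Cn_partial.
Qed.

Lemma partialD n f g j : Cn n.+1 f -> Cn n.+1 g ->
  partial j (fun p => f p + g p) = fun p => partial j f p + partial j g p.
Proof.
move=> Cf Cg; apply/funext => p.
by have [_ <-] := is_deriveD (Cn_derive j p Cf) (Cn_derive j p Cg).
Qed.

Lemma CnM n f g : Cn n f -> Cn n g -> Cn n (fun p => f p * g p).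
Proof.
elim: n f g => [|n IH] f g Cf Cg.
  split=> // p; first by case: Cf => /(_ p)[? ?] _ _; case: Cg => /(_ p)[? ?] _ _; split; congruence.
  by apply: cvgM; [case: Cf => _ + _; apply|case: Cg => _ + _; apply].
apply: (proj1 (@CnP n _ (fun j p => f p * partial j g p + g p * partial j f p) _ _ _ _)).
- by move=> p; case: Cf => /(_ p)[? ?] _ _; case: Cg => /(_ p)[? ?] _ _; split; congruence.
- by move=> p; apply: cvgM; [case: Cf => _ + _; apply|case: Cg => _ + _; apply].
- by move=> j p; apply: is_deriveM; apply: Cn_derive; eassumption.
- by move=> j; apply: CnD; apply: IH; rewrite //; try exact: Cn_partial; exact: CnS.
Qed.

Lemma partialM n f g j : Cn n.+1 f -> Cn n.+1 g ->
  partial j (fun p => f p * g p) = fun p => f p * partial j g p + g p * partial j f p.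
Proof.
move=> Cf Cg; apply/funext => p.
by have [_ <-] := is_deriveM (Cn_derive j p Cf) (Cn_derive j p Cg).
Qed.

Lemma CnZ n (a : R) f : Cn n f -> Cn n (fun p => a * f p).
Proof. by move=> Cf; apply: CnM => //; exact: (proj1 (Cn_cst n a)). Qed.

Lemma partialZ n (a : R) f j : Cn n.+1 f ->
  partial j (fun p => a * f p) = fun p => a * partial j f p.
Proof.
move=> Cf; rewrite (partialM j (proj1 (Cn_cst n.+1 a)) Cf).
by apply/funext => p; rewrite (proj2 (Cn_cst n.+1 a)) mulr0 addr0.
Qed.

Lemma CnN n f : Cn n f -> Cn n (fun p => - f p).
Proof. by move=> /(CnZ (-1)); under eq_fun do rewrite mulN1r. Qed.

Lemma partialN n f j : Cn n.+1 f -> partial j (fun p => - f p) = fun p => - partial j f p.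
Proof.
move=> Cf; under eq_fun do rewrite -mulN1r.
by rewrite (partialZ _ _ Cf); apply/funext => p; rewrite mulN1r.
Qed.

Lemma CnB n f g : Cn n f -> Cn n g -> Cn n (fun p => f p - g p).
Proof. by move=> Cf Cg; apply: CnD => //; exact: CnN. Qed.

Lemma partialB n f g j : Cn n.+1 f -> Cn n.+1 g ->
  partial j (fun p => f p - g p) = fun p => partial j f p - partial j g p.
Proof. by move=> Cf Cg; rewrite (partialD j Cf (CnN Cg)) (partialN j Cg). Qed.

Lemma Cn_sum n (I : Type) (r : seq I) (F : I -> R * R -> R) :
  (forall i, Cn n (F i)) -> Cn n (fun p => \sum_(i <- r) F i p).
Proof.
move=> CF; elim: r => [|i r IH].
  by under eq_fun do rewrite big_nil; exact: (proj1 (Cn_cst n 0)).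
by under eq_fun do rewrite big_cons; exact: CnD.
Qed.

Lemma partial_shift n q f j : Cn n.+1 f ->
  partial j (fun p => f (p + q)) = fun p => partial j f (p + q).
Proof.
move=> Cf; apply/funext => p.
suff [_ <-] : is_derive p (basis2 R j) (fun p => f (p + q)) (partial j f (p + q)) by [].
apply: is_derive_pt.
have := @is_derive_line f (p + q) (basis2 R j) 0 (partial j f (p + q)).
rewrite scale0r addr0 => /(_ (Cn_derive _ _ Cf)).
by under eq_fun do rewrite addrAC.
Qed.

Lemma periodic_shift q f : periodic2 f -> periodic2 (fun p => f (p + q)).
Proof.
move=> pf p.
have -> : (p.1 + 1, p.2) + q = ((p + q).1 + 1, (p + q).2) by congr pair; rewrite /= addrAC.
have -> : (p.1, p.2 + 1) + q = ((p + q).1, (p + q).2 + 1) by congr pair; rewrite /= addrAC.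
exact: pf.
Qed.

Lemma continuous_shift_pair q f : continuous f -> continuous (fun p => f (p + q)).
Proof.
move=> cf p; apply: (@continuous_comp _ _ _ (fun p => p + q) f); last exact: cf.
by apply: cvgD; [exact: cvg_id|exact: cvg_cst].
Qed.

Lemma Cn_shift n q f : Cn n f -> Cn n (fun p => f (p + q)).
Proof.
elim: n f => [|n IH] f Cf.
  by split=> //; [exact/periodic_shift/(Cn_periodic Cf)|
    exact/continuous_shift_pair/(Cn_continuous Cf)].
apply: (proj1 (@CnP n _ (fun j p => partial j f (p + q)) _ _ _ _)).
- exact/periodic_shift/(Cn_periodic Cf).
- exact/continuous_shift_pair/(Cn_continuous Cf).
- move=> j p; apply: is_derive_pt.
  have := @is_derive_line f (p + q) (basis2 R j) 0 (partial j f (p + q)).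
  rewrite scale0r addr0 => /(_ (Cn_derive _ _ Cf)).
  by under eq_fun do rewrite addrAC.
- by move=> j; apply: IH; exact: Cn_partial.
Qed.

Lemma periodic_nat f (m n : nat) (x y : R) : periodic2 f -> f (x + m%:R, y + n%:R) = f (x, y).
Proof.
move=> pf; elim: m => [|m <-]; last first.
  by rewrite -(proj1 (pf (x + m%:R, y + n%:R))) /= -natr1 addrA.
rewrite addr0; elim: n => [|n <-]; first by rewrite addr0.
by rewrite -(proj2 (pf (x, y + n%:R))) /= -natr1 addrA.
Qed.

Lemma periodic_int f (m n : int) (x y : R) :
  periodic2 f -> f (x + m%:~R, y + n%:~R) = f (x, y).
Proof.
move=> pf.
pose a := `|m|%N; pose b := `|n|%N.
(* Further shifts by [a] and [b] periods make all shifts natural numbers. *)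
rewrite -(periodic_nat a b (x + m%:~R)) // -[RHS](periodic_nat (`|(m + a)%R|%N) (`|(n + b)%R|%N)) //.
have E (z : int) : z%:~R + (`|z|%N)%:R = (`|(z + `|z|%N)%R|%N)%:R :> R.
  case: z => l; first by rewrite -natrD.
  by rewrite NegzE abszN absz_nat addNr [X in `|X|%N](addNr (l.+1 : int)).
by rewrite -!addrA !E.
Qed.

Lemma periodic_square f p : exists x y : R,
  [/\ 0 <= x < 1, 0 <= y < 1, (exists m n : int, p = (x + m%:~R, y + n%:~R)) &
    (periodic2 f -> f p = f (x, y))].
Proof.
exists (p.1 - (Num.floor p.1)%:~R), (p.2 - (Num.floor p.2)%:~R).
have fl (z : R) : 0 <= z - (Num.floor z)%:~R < 1.
  by have := floor_itv z; rewrite intrD mulr1z => /andP[? ?]; apply/andP; split; lra.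
split=> //; first by exists (Num.floor p.1), (Num.floor p.2); rewrite !subrK; case: p.
by move=> pf; rewrite -(periodic_int (Num.floor p.1) (Num.floor p.2)) // !subrK; case: p.
Qed.

Lemma periodic_min f : periodic2 f -> continuous f -> exists q, forall p, f q <= f p.
Proof.
move=> pf cf.
have sq0 : (`[0 : R, 1]%classic `*` `[0 : R, 1]%classic) !=set0.
  by exists (0, 0); split; rewrite /= in_itv /= lexx ler01.
have [q _ qmin] := compact_EVT_min sq0 (@compact_square R) (continuous_subspaceT cf).
exists q => p; have [x [y [/andP[x0 x1] /andP[y0 y1] _ ->//]]] := periodic_square f p.
by apply: qmin; rewrite inE; split; rewrite /= in_itv /=; apply/andP; split; rewrite // ltW.
Qed.

Lemma periodic_bounded f : periodic2 f -> continuous f ->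
  exists2 M, 0 <= M & forall p, `|f p| <= M.
Proof.
move=> pf cf; have [q qmin] := periodic_min pf cf.
have pNf : periodic2 (fun p => - f p) by move=> p; rewrite !(pf p).1 (pf p).2.
have [r rmax] := periodic_min pNf (fun p => cvgN (cf p)).
exists (`|f q| + `|f r|); first by rewrite addr_ge0.
move=> p; have := qmin p; have := rmax p.
have := ler_norm (- f q); rewrite normrN; have := ler_norm (f r).
have := normr_ge0 (f r); have := normr_ge0 (f q).
by rewrite ler_norml => *; apply/andP; split; lra.
Qed.

Lemma slice1_derive n f (x y : R) : Cn n.+1 f ->
  is_derive y (1 : R) (fun y => f (x, y)) (partial 1 f (x, y)).
Proof.
move=> Cf.
have E (r : R) : (x, 0) + r *: basis2 R 1 = (x, r).
  by rewrite /basis2 /=; congr pair; rewrite /= ?scaler0 ?[_%:A]mulr1 ?addr0 ?add0r.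
have := @is_derive_line f (x, 0) (basis2 R 1) y (partial 1 f (x, y)).
rewrite E => /(_ (Cn_derive _ _ Cf)).
by under eq_fun do rewrite E.
Qed.

Lemma slice2_derive n f (x y : R) : Cn n.+1 f ->
  is_derive x (1 : R) (fun x => f (x, y)) (partial 0 f (x, y)).
Proof.
move=> Cf.
have E (r : R) : (0, y) + r *: basis2 R 0 = (r, y).
  by rewrite /basis2 /=; congr pair; rewrite /= ?scaler0 ?[_%:A]mulr1 ?addr0 ?add0r.
have := @is_derive_line f (0, y) (basis2 R 0) x (partial 0 f (x, y)).
rewrite E => /(_ (Cn_derive _ _ Cf)).
by under eq_fun do rewrite E.
Qed.

Lemma torus_integral_partial f j : Cn 1 f -> torus_integral (partial j f) = 0.
Proof.
move=> Cf; have cdf := Cn_continuous (Cn_partial j Cf).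
have [->|->] : j = 0 \/ j = 1.
  by case: j {cdf} => [[|[|//]]] ?; [left|right]; apply/val_inj.
- rewrite torus_integral_iterC; last exact: Cn_continuous (Cn_partial _ Cf).
  rewrite -[RHS](int01_cst (0 : R)); congr int01; apply/funext => y.
  rewrite (int01_derive (@continuous_slice2 _ _ y (Cn_continuous (Cn_partial 0 Cf)))
    (fun x _ => slice2_derive x y Cf)).
  by rewrite -[in X in X - _](add0r 1) ((Cn_periodic Cf) (0, y)).1 subrr.
- rewrite torus_integral_iter; last exact: Cn_continuous (Cn_partial _ Cf).
  rewrite -[RHS](int01_cst (0 : R)); congr int01; apply/funext => x.
  rewrite (int01_derive (@continuous_slice1 _ _ x (Cn_continuous (Cn_partial 1 Cf)))
    (fun y _ => slice1_derive x y Cf)).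
  by rewrite -[in X in X - _](add0r 1) ((Cn_periodic Cf) (x, 0)).2 subrr.
Qed.

End Calculus.

(** * Derivatives of functions of one real variable *)

Section OneVariable.
Context {R : realType}.
Implicit Types (F G : R -> R) (x y d e : R).

(** A form without quotients that also allows h = 0; it serves whenever a derivative is established
    by hand. *)
Lemma is_derive_epsP F x d : is_derive x (1 : R) F d <->
  forall e, 0 < e -> exists2 r, 0 < r &
    forall h, `|h| < r -> `|F (x + h) - F x - h * d| <= e * `|h|.
Proof.
split=> [[dF dE] e e0|H].
  have /cvgrPdist_le /(_ _ e0) : (fun h : R => h^-1 *: ((F \o shift x) (h *: (1 : R)) - F x)) @ 0^' --> d.
    by rewrite -dE.
  rewrite near_withinE => /nbhs_ballP[r /= r0 Hr]; exists r => // h hr.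
  have [->|h0] := eqVneq h 0; first by rewrite addr0 subrr mul0r subr0 normr0 mulr0.
  have := Hr h; rewrite /ball /= sub0r normrN => /(_ hr h0).
  rewrite [h%:A]mulr1 [h + x]addrC [_ *: _]mulrC => hle.
  have -> : F (x + h) - F x - h * d = - (h * (d - (F (x + h) - F x) / h)).
    by field.
  by rewrite normrN normrM mulrC ler_wpM2r.
have L : (fun h : R => h^-1 *: ((F \o shift x) (h *: (1 : R)) - F x)) @ 0^' --> d.
  apply/cvgrPdist_le => e e0; have [r r0 Hr] := H e e0.
  rewrite near_withinE; apply/nbhs_ballP; exists r => // h /=.
  rewrite /ball /= sub0r normrN => hr h0.
  rewrite [h%:A]mulr1 [h + x]addrC [_ *: _]mulrC.
  have -> : d - (F (x + h) - F x) / h = - (F (x + h) - F x - h * d) / h by field.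
  by rewrite normrM normrN normfV ler_pdivrMr ?normr_gt0 //; exact: Hr.
by split; [apply/cvg_ex; exists d|exact/cvg_lim].
Qed.

Lemma is_derive_continuous F x d : is_derive x (1 : R) F d -> {for x, continuous F}.
Proof.
by move=> [dF _]; apply: differentiable_continuous; apply/derivable1_diffP.
Qed.

Lemma mean_value F G a b : a < b -> (forall x, a < x < b -> is_derive x (1 : R) F (G x)) ->
  {within `[a, b], continuous F} ->
  exists2 c, a < c < b & F b - F a = G c * (b - a).
Proof.
move=> ab dF cF; have dF' x : x \in `]a, b[ -> is_derive x (1 : R) F (G x).
  by rewrite in_itv /=; exact: dF.
by have [c] := MVT ab dF' cF; rewrite in_itv /=; exists c.
Qed.

Lemma derive_lipschitz F G M : (forall x, is_derive x (1 : R) F (G x)) ->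
  (forall x, `|G x| <= M) -> forall x y, `|F x - F y| <= M * `|x - y|.
Proof.
move=> dF GM x y; wlog xy : x y / y < x => [H|].
  case: (ltgtP x y) => [/H| /H//|->]; last by rewrite !subrr normr0 mulr0.
  by rewrite distrC [`|y - x|]distrC.
have cF : {within `[y, x], continuous F}.
  by apply: continuous_subspaceT => z; exact: is_derive_continuous (dF z).
have [c _ ->] := mean_value xy (fun z _ => dF z) cF.
by rewrite normrM ler_wpM2r.
Qed.

(** Uniform convergence of the derivatives makes g n - g N Lipschitz with a small constant,
    uniformly in n; F - g N inherits this in the limit, and g N is differentiable. *)
Lemma is_derive_limit (g dg : nat -> R -> R) F G :
  (forall n x, is_derive x (1 : R) (g n) (dg n x)) ->
  (forall x, g n x @[n --> \oo] --> F x) ->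
  (forall e, 0 < e -> exists N, forall n x, (N <= n)%N -> `|dg n x - G x| <= e) ->
  forall x, is_derive x (1 : R) F (G x).
Proof.
move=> dgE gF dgG x; apply/is_derive_epsP => e e0.
have e4 : 0 < e / 4 by rewrite divr_gt0.
have [N HN] := dgG _ e4.
have /is_derive_epsP/(_ _ e4)[r r0 Hr] := dgE N x.
exists r => // h /Hr {}Hr.
have key : `|(F (x + h) - g N (x + h)) - (F x - g N x)| <= e / 2 * `|h|.
  have cv : (fun n => `|(g n (x + h) - g N (x + h)) - (g n x - g N x)|) @ \oo -->
     `|(F (x + h) - g N (x + h)) - (F x - g N x)|.
    apply: cvg_norm; apply: cvgB; apply: cvgB; [exact: gF|exact: cvg_cst|exact: gF|exact: cvg_cst].
  rewrite -(cvg_lim _ cv) //; apply: limr_le; first by apply/cvg_ex; eexists; exact: cv.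
  near=> n.
  have := @derive_lipschitz (fun y => g n y - g N y) (fun y => dg n y - dg N y) (e / 2) _ _ (x + h) x.
  rewrite [x + h - x]addrAC subrr add0r; apply.
  move=> y; have Nn : (N <= n)%N by near: n; exists N.
  have := HN n y Nn; have := HN N y (leqnn N); rewrite distrC => h1 h2.
  have -> : dg n y - dg N y = (dg n y - G y) + (G y - dg N y) by ring.
  by rewrite (le_trans (ler_normD _ _)) //; lra.
have dN := HN N x (leqnn N).
have -> : F (x + h) - F x - h * G x =
  ((F (x + h) - g N (x + h)) - (F x - g N x)) + (g N (x + h) - g N x - h * dg N x)
  + h * (dg N x - G x) by ring.
apply: (le_trans (ler_normD _ _)); rewrite normrM.
have := ler_normD ((F (x + h) - g N (x + h)) - (F x - g N x)) (g N (x + h) - g N x - h * dg N x).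
have : `|h| * `|dg N x - G x| <= `|h| * (e / 4) by rewrite ler_wpM2l.
move: key Hr; have := normr_ge0 h; nra.
Unshelve. all: by end_near. Qed.

End OneVariable.

(** * Fourier series *)

Section Trigonometric.
Context {R : realType}.
Implicit Types (xi : int * int) (p v : R * R) (a b : R).

Definition dot xi p : R := 2 * pi * (xi.1%:~R * p.1 + xi.2%:~R * p.2).

(** Cosine and sine are kept together, so that a derivative is again a harmonic of the same
    frequency with new coefficients. *)
Definition harmonic a b xi p : R := a * cos (dot xi p) + b * sin (dot xi p).

Lemma dotD xi p v : dot xi (p + v) = dot xi p + dot xi v.
Proof. by rewrite /dot /=; ring. Qed.

Lemma dotB xi p v : dot xi (p - v) = dot xi p - dot xi v.
Proof. by rewrite /dot /=; ring. Qed.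

Lemma dotZ xi (r : R) v : dot xi (r *: v) = r * dot xi v.
Proof. by rewrite /dot /= /GRing.scale /=; ring. Qed.

Lemma dot_sub (xi eta : int * int) p : dot (xi - eta) p = dot xi p - dot eta p.
Proof. by rewrite /dot /= !rmorphB /=; ring. Qed.

Lemma is_derive_harmonic a b xi p v :
  is_derive p v (harmonic a b xi) (harmonic (b * dot xi v) (- (a * dot xi v)) xi p).
Proof.
apply: is_derive_pt.
have -> : (fun r : R => harmonic a b xi (p + r *: v)) =
   (fun r : R => a * cos (dot xi p + r * dot xi v) + b * sin (dot xi p + r * dot xi v)).
  by apply/funext => r; rewrite /harmonic dotD dotZ.
apply: is_derive_eq.
by rewrite /harmonic /GRing.scale /= mul0r addr0; ring.
Qed.

Lemma cos_int (n : int) (t : R) : cos (t + 2 * pi * n%:~R) = cos t.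
Proof.
have E (k : nat) (s : R) : cos (s + 2 * pi * k%:R) = cos s.
  by rewrite mulr_natr [2 * pi]mulr_natl (periodicn (@cosD2pi R)).
case: n => k; first exact: E.
by rewrite NegzE mulrNz mulrN -[RHS](E k.+1) -(E k.+1 (t - _)) subrK (E k.+1).
Qed.

Lemma sin_int (n : int) (t : R) : sin (t + 2 * pi * n%:~R) = sin t.
Proof.
have E (k : nat) (s : R) : sin (s + 2 * pi * k%:R) = sin s.
  by rewrite mulr_natr [2 * pi]mulr_natl (periodicn (@sinD2pi R)).
case: n => k; first exact: E.
by rewrite NegzE mulrNz mulrN -[RHS](E k.+1) -(E k.+1 (t - _)) subrK (E k.+1).
Qed.

Lemma harmonic_periodic a b xi : periodic2 (harmonic a b xi).
Proof.
move=> p; rewrite /harmonic.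
have -> : dot xi (p.1 + 1, p.2) = dot xi p + 2 * pi * xi.1%:~R by rewrite /dot /=; ring.
have -> : dot xi (p.1, p.2 + 1) = dot xi p + 2 * pi * xi.2%:~R by rewrite /dot /=; ring.
by rewrite !cos_int !sin_int.
Qed.

Lemma dot_continuous xi : continuous (dot xi).
Proof.
move=> p; apply: cvgM; first exact: cvg_cst.
by apply: cvgD; apply: cvgM; [exact: cvg_cst|exact: cvg_fst|exact: cvg_cst|exact: cvg_snd].
Qed.

Lemma harmonic_continuous a b xi : continuous (harmonic a b xi).
Proof.
move=> p; apply: cvgD; apply: cvgM; try exact: cvg_cst.
  by apply: continuous_comp; [exact: dot_continuous|exact: continuous_cos].
by apply: continuous_comp; [exact: dot_continuous|exact: continuous_sin].
Qed.

Lemma harmonic_Cn n a b xi : Cn n (harmonic a b xi).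
Proof.
elim: n a b => [|n IH] a b.
  by split=> //; [exact: harmonic_periodic|exact: harmonic_continuous].
apply: (proj1 (@CnP _ n _ (fun j => harmonic (b * dot xi (basis2 R j))
    (- (a * dot xi (basis2 R j))) xi) _ _ _ _)) => [|||j].
- exact: harmonic_periodic.
- exact: harmonic_continuous.
- by move=> j p; exact: is_derive_harmonic.
- exact: IH.
Qed.

Lemma partial_harmonic a b xi (j : 'I_2) : partial j (harmonic a b xi) =
  harmonic (b * dot xi (basis2 R j)) (- (a * dot xi (basis2 R j))) xi.
Proof. by apply/funext => p; have [_ <-] := is_derive_harmonic a b xi p (basis2 R j). Qed.

Lemma dot_basis0 xi : dot xi (basis2 R 0) = 2 * pi * xi.1%:~R.
Proof. by rewrite /dot /basis2 /=; ring. Qed.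

Lemma dot_basis1 xi : dot xi (basis2 R 1) = 2 * pi * xi.2%:~R.
Proof. by rewrite /dot /basis2 /=; ring. Qed.

Lemma harmonic_norm_le a b xi p : `|harmonic a b xi p| <= `|a| + `|b|.
Proof.
have h (x y : R) : `|y| <= 1 -> `|x * y| <= `|x|.
  by move=> y1; rewrite normrM -[leRHS]mulr1 ler_wpM2l.
rewrite (le_trans (ler_normD _ _)) // lerD //; apply: h;
  by rewrite ler_norml; apply/andP; split;
     rewrite ?cos_geN1 ?cos_le1 ?sin_geN1 ?sin_le1.
Qed.

(** A harmonic of nonzero frequency is a partial derivative of another one, along an axis where the
    frequency does not vanish. *)
Lemma torus_integral_harmonic a b xi : xi != (0, 0) ->
  torus_integral (harmonic a b xi) = 0.
Proof.
move=> xi0.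
have [j dj] : exists j, dot xi (basis2 R j) != 0.
  have pi0 : 2 * pi != 0 :> R by rewrite mulf_neq0 // gt_eqF // pi_gt0.
  have [x0|x0] := eqVneq xi.1 0; last first.
    by exists 0; rewrite dot_basis0 mulf_neq0 // intr_eq0.
  exists 1; rewrite dot_basis1 mulf_neq0 // intr_eq0.
  by move: xi0; case: xi x0 => m n /= ->; rewrite xpair_eqE eqxx.
rewrite -[RHS](@torus_integral_partial _
  (harmonic (- (b / dot xi (basis2 R j))) (a / dot xi (basis2 R j)) xi) j).
  by rewrite partial_harmonic mulNr opprK !divfK.
exact: harmonic_Cn.
Qed.

End Trigonometric.

(** * Square boxes of integer frequencies *)

Section Lattice.
Implicit Types (r : seq (int * int)) (xi : int * int) (n : nat).

Definition zrange n : seq int := [seq i%:Z - n%:Z | i <- iota 0 (2 * n).+1].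

Lemma mem_zrange n (i : int) : (i \in zrange n) = (`|i| <= n)%N.
Proof.
apply/mapP/idP => [[k]|h].
  by rewrite mem_iota => hk ->; lia.
by exists (absz (i + n%:Z)%R); [rewrite mem_iota|]; lia.
Qed.

Lemma zrange_uniq n : uniq (zrange n).
Proof. by rewrite map_inj_uniq ?iota_uniq // => i j; lia. Qed.

Definition box n : seq (int * int) := [seq (i, j) | i <- zrange n, j <- zrange n].

Lemma mem_box n xi : (xi \in box n) = (`|xi.1| <= n)%N && (`|xi.2| <= n)%N.
Proof.
rewrite -!mem_zrange; apply/allpairsP/andP => [[[i j] [/= hi hj ->]]//|[h1 h2]].
by exists xi; case: xi h1 h2.
Qed.

Lemma box_uniq n : uniq (box n).
Proof. by apply: allpairs_uniq; rewrite ?zrange_uniq // => -[? ?] [? ?]. Qed.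

Lemma seq_sub_box r : exists n, {subset r <= box n}.
Proof.
elim: r => [|xi r [n IH]]; first by exists 0%N.
exists (n + `|xi.1| + `|xi.2|)%N => eta; rewrite inE => /predU1P[->|/IH].
  by rewrite mem_box; lia.
by rewrite !mem_box; lia.
Qed.

Lemma box_sub m n : (m <= n)%N -> {subset box m <= box n}.
Proof. by move=> mn xi; rewrite !mem_box; lia. Qed.

End Lattice.

(** * Absolutely convergent trigonometric series *)

Section TrigonometricSeries.
Context {R : realType}.
Implicit Types (A B : int * int -> R) (r : seq (int * int)) (xi : int * int)
  (p v : R * R) (s C : R) (n : nat).

(* The symbol of 1 - Delta. *)
Definition symbol xi : R := 1 + (2 * pi) ^+ 2 * (xi.1%:~R ^+ 2 + xi.2%:~R ^+ 2).

Definition weighted_le s A B C := forall r, uniq r ->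
  \sum_(xi <- r) symbol xi `^ s * (`|A xi| + `|B xi|) <= C.

Definition trig_sum A B r p := \sum_(xi <- r) harmonic (A xi) (B xi) xi p.

Definition trig_series A B p := lim (trig_sum A B (box n) p @[n --> \oo]).

Lemma symbol_ge1 xi : 1 <= symbol xi.
Proof. by rewrite /symbol lerDl mulr_ge0 ?addr_ge0 ?sqr_ge0. Qed.

Lemma symbol_gt0 xi : 0 < symbol xi.
Proof. exact: lt_le_trans ltr01 (symbol_ge1 xi). Qed.

Lemma two_pi_ge1 : 1 <= 2 * pi :> R.
Proof. by have := pi_ge2 R; lra. Qed.

Lemma symbol_outside n xi : xi \notin box n -> n.+1%:R <= symbol xi.
Proof.
rewrite mem_box negb_and -!ltnNge => h.
have sq (i : int) : (n < `|i|)%N -> n.+1%:R <= i%:~R ^+ 2 :> R.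
  move=> ni; have : n.+1%:R <= `|i%:~R| :> R by rewrite -intr_norm -natr_absz ler_nat.
  rewrite -[_ ^+ 2]real_normK ?num_real // => h1.
  have : 1 <= n.+1%:R :> R by rewrite ler1n.
  by nra.
have pi2 : 1 <= (2 * pi) ^+ 2 :> R by have := two_pi_ge1; nra.
have x1 := sqr_ge0 (xi.1%:~R : R); have x2 := sqr_ge0 (xi.2%:~R : R).
have : n.+1%:R <= xi.1%:~R ^+ 2 + xi.2%:~R ^+ 2 :> R.
  by case/orP: h => /sq; lra.
by rewrite /symbol; nra.
Qed.

Lemma weighted_le_ge0 s A B C : weighted_le s A B C -> 0 <= C.
Proof. by move=> /(_ [::] isT); rewrite big_nil. Qed.

Lemma powR_ge1 (x s : R) : 1 <= x -> 0 <= s -> 1 <= x `^ s.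
Proof. by move=> x1 s0; rewrite -(powRr0 x) ler_powR. Qed.

(** Outside [box n] the symbol is at least n + 1, so the weight is traded for a factor (n +
    1)^-s. *)
Lemma tail_le s A B C r n : 0 <= s -> weighted_le s A B C -> uniq r ->
  (forall xi, xi \in r -> xi \notin box n) ->
  \sum_(xi <- r) (`|A xi| + `|B xi|) <= C / n.+1%:R `^ s.
Proof.
move=> s0 H ur rn; have n0 : 0 < n.+1%:R `^ s :> R by rewrite powR_gt0.
rewrite ler_pdivlMr // mulr_suml; apply: le_trans (H r ur).
rewrite !big_seq; apply: ler_sum => xi /rn xin.
rewrite mulrC ler_wpM2r ?addr_ge0 // ge0_ler_powR ?nnegrE //.
  by rewrite ltW // symbol_gt0.
exact: symbol_outside.
Qed.

Lemma trig_sum_norm_le A B r p :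
  `|trig_sum A B r p| <= \sum_(xi <- r) (`|A xi| + `|B xi|).
Proof.
apply: (le_trans (ler_norm_sum _ _ _)); apply: ler_sum => xi _.
exact: harmonic_norm_le.
Qed.

Lemma trig_sum_box s A B C r p n : 0 <= s -> weighted_le s A B C -> uniq r ->
  {subset box n <= r} ->
  `|trig_sum A B r p - trig_sum A B (box n) p| <= C / n.+1%:R `^ s.
Proof.
move=> s0 H ur nr; rewrite /trig_sum (bigID (fun xi => xi \in box n)) /=.
rewrite -[X in X + _ - _]big_filter -[X in _ + X - _]big_filter.
rewrite (perm_big (box n)) /=; last first.
  apply: uniq_perm; rewrite ?filter_uniq ?box_uniq // => xi.
  by rewrite mem_filter; case: (boolP (xi \in box n)) => // /nr ->.
rewrite addrAC subrr add0r.
apply: (le_trans (trig_sum_norm_le _ _ _ _)); apply: (tail_le s0 H).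
  exact: filter_uniq.
by move=> xi; rewrite mem_filter => /andP[].
Qed.

Lemma powR_small s C : 0 < s -> 0 <= C ->
  (fun n : nat => C / n.+1%:R `^ s) @ \oo --> (0 : R).
Proof.
move=> s0 C0; apply/cvgrPdist_le => e e0.
near=> n; rewrite sub0r normrN ger0_norm ?divr_ge0 ?powR_ge0 //.
rewrite ler_pdivrMr ?powR_gt0 // -ler_pdivrMl // mulrC.
have Ce : 0 <= C / e by rewrite divr_ge0 // ltW.
(* C / e is written as ((C / e)^(1/s))^s, so that n + 1 only has to exceed (C / e)^(1/s). *)
rewrite -[leLHS](powRr1 Ce) -[X in _ `^ X <= _](mulVf (lt0r_neq0 s0)) powRrM ge0_ler_powR ?nnegrE ?powR_ge0 //.
  exact: ltW.
rewrite (le_trans (ltW (truncnS_gt _))) // ler_nat ltnS.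
by near: n; exact: nbhs_infty_ge.
Unshelve. all: by end_near. Qed.

Lemma trig_series_cvg s A B C p : 0 < s -> weighted_le s A B C ->
  trig_sum A B (box n) p @[n --> \oo] --> trig_series A B p.
Proof.
move=> s0 H; apply/cauchy_cvgP; apply/cauchy_ballP => e e0; near_simpl.
have C0 := weighted_le_ge0 H.
have [N _ HN] : \forall n \near \oo, C / n.+1%:R `^ s < e / 2.
  by apply: (cvgr_lt _ (powR_small s0 C0)); rewrite divr_gt0.
have D n : (N <= n)%N -> `|trig_sum A B (box n) p - trig_sum A B (box N) p| < e / 2.
  move=> Nn; apply: le_lt_trans (HN N (leqnn N)).
  exact: (trig_sum_box p (ltW s0) H (box_uniq n) (box_sub Nn)).
near=> m n => /=; rewrite /ball /=.
have Nm : (N <= m)%N by near: m; exists N.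
have Nn : (N <= n)%N by near: n; exists N.
have := D m Nm; have := D n Nn; rewrite !ltr_norml => /andP[? ?] /andP[? ?].
by apply/andP; split; lra.
Unshelve. all: by end_near. Qed.

(** The finite set r is any superset of a box, because the translated grids met with Fejer sums are
    not boxes. The factor 2 comes from the passage through [box n]. *)
Lemma trig_series_tail s A B C r p n : 0 < s -> weighted_le s A B C -> uniq r ->
  {subset box n <= r} ->
  `|trig_sum A B r p - trig_series A B p| <= 2 * (C / n.+1%:R `^ s).
Proof.
move=> s0 H ur nr; have cv := trig_series_cvg (p := p) s0 H.
have cv' : (fun m => `|trig_sum A B r p - trig_sum A B (box m) p|) @ \oo -->
  `|trig_sum A B r p - trig_series A B p|.
  by apply: cvg_norm; apply: cvgB; [exact: cvg_cst|exact: cv].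
rewrite -(cvg_lim _ cv') //; apply: limr_le; first by apply/cvg_ex; eexists; exact: cv'.
near=> m; have nm : (n <= m)%N by near: m; exists n.
have h1 := trig_sum_box p (ltW s0) H ur nr.
have h2 := trig_sum_box p (ltW s0) H (box_uniq m) (box_sub nm).
rewrite distrC in h2.
have -> : trig_sum A B r p - trig_sum A B (box m) p =
  (trig_sum A B r p - trig_sum A B (box n) p) + (trig_sum A B (box n) p - trig_sum A B (box m) p) by ring.
by rewrite (le_trans (ler_normD _ _)) // mulr_natl mulr2n lerD.
Unshelve. all: by end_near. Qed.

Lemma trig_series_norm_le s A B C p : 0 < s -> weighted_le s A B C ->
  `|trig_series A B p| <= C.
Proof.
move=> s0 H; have cv : `|trig_sum A B (box m) p| @[m --> \oo] --> `|trig_series A B p|.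
  by apply: cvg_norm; exact: trig_series_cvg s0 H.
have C0 := weighted_le_ge0 H.
rewrite -(cvg_lim _ cv) //; apply: limr_le; first by apply/cvg_ex; eexists; exact: cv.
near=> m; apply: (le_trans (trig_sum_norm_le _ _ _ _)).
apply: le_trans (H _ (box_uniq m)); apply: ler_sum => xi _.
by rewrite ler_peMl ?addr_ge0 // powR_ge1 ?symbol_ge1 // ltW.
Unshelve. all: by end_near. Qed.

Lemma trig_sum_Cn m A B r : Cn m (trig_sum A B r).
Proof. by apply: Cn_sum => xi; exact: harmonic_Cn. Qed.

Lemma is_derive_trig_sum A B r p v : is_derive p v (trig_sum A B r)
  (trig_sum (fun xi => B xi * dot xi v) (fun xi => - (A xi * dot xi v)) r p).
Proof.
elim: r => [|xi r IH].
  rewrite /trig_sum big_nil; under eq_fun do rewrite big_nil; exact: is_derive_cst.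
rewrite /trig_sum big_cons; under eq_fun do rewrite big_cons.
exact: (is_deriveD (is_derive_harmonic (A xi) (B xi) xi p v) IH).
Qed.

Lemma trig_series_periodic s A B C : 0 < s -> weighted_le s A B C ->
  periodic2 (trig_series A B).
Proof.
move=> s0 H p; split; rewrite /trig_series; congr (lim (_ @ \oo)); apply/funext => n.
  exact: ((Cn_periodic (trig_sum_Cn 0 A B (box n))) p).1.
exact: ((Cn_periodic (trig_sum_Cn 0 A B (box n))) p).2.
Qed.

Lemma trig_series_continuous s A B C : 0 < s -> weighted_le s A B C ->
  continuous (trig_series A B).
Proof.
move=> s0 H p; apply/cvgrPdist_le => e e0.
have C0 := weighted_le_ge0 H.
have [N _ HN] : \forall n \near \oo, C / n.+1%:R `^ s < e / 8.
  by apply: (cvgr_lt _ (powR_small s0 C0)); rewrite divr_gt0.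
have T q : `|trig_sum A B (box N) q - trig_series A B q| <= e / 4.
  rewrite (le_trans (trig_series_tail q s0 H (box_uniq N) (fun _ h => h))) //.
  by have := HN N (leqnn N); lra.
have e2 : 0 < e / 2 by rewrite divr_gt0.
have /cvgrPdist_le/(_ _ e2) := Cn_continuous (trig_sum_Cn 0 A B (box N)) (x := p).
apply: filterS => q; have := T p; have := T q; rewrite !ler_norml.
by move=> /andP[? ?] /andP[? ?] /andP[? ?]; apply/andP; split; lra.
Qed.

(** Each |2 pi xi_i| is at most the square root of the symbol: a derivative costs 1/2 in the
    exponent of the weight. *)
Lemma dot_norm_le xi v : `|dot xi v| <= (`|v.1| + `|v.2|) * symbol xi `^ (1 / 2).
Proof.
have -> : (1 / 2 : R) = 2^-1 by rewrite mul1r.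
rewrite powR12_sqrt ?(ltW (symbol_gt0 xi)) //.
set x : R := xi.1%:~R; set y : R := xi.2%:~R.
have key (z : R) : z ^+ 2 <= x ^+ 2 + y ^+ 2 -> `|2 * pi * z| <= Num.sqrt (symbol xi).
  move=> h; rewrite -sqrtr_sqr ler_wsqrtr // exprMn /symbol.
  have := ler_wpM2l (sqr_ge0 (2 * pi : R)) h; rewrite -/x -/y; lra.
have hx := key x; have hy := key y.
have {}hx : `|2 * pi * x| <= Num.sqrt (symbol xi) by apply: hx; rewrite lerDl sqr_ge0.
have {}hy : `|2 * pi * y| <= Num.sqrt (symbol xi) by apply: hy; rewrite lerDr sqr_ge0.
have -> : dot xi v = (2 * pi * x) * v.1 + (2 * pi * y) * v.2 by rewrite /dot -/x -/y; ring.
apply: (le_trans (ler_normD _ _)); rewrite [in leRHS]mulrDl.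
by apply: lerD; rewrite normrM mulrC ler_wpM2l.
Qed.

Lemma weighted_le_derive s A B C v : weighted_le s A B C ->
  weighted_le (s - 1 / 2) (fun xi => B xi * dot xi v) (fun xi => - (A xi * dot xi v))
    ((`|v.1| + `|v.2|) * C).
Proof.
move=> H r ur; apply: le_trans (ler_wpM2l _ (H r ur)); last by rewrite addr_ge0.
rewrite mulr_sumr; apply: ler_sum => xi _.
rewrite normrN (normrM (A xi)) (normrM (B xi)) -mulrDl [`|B xi| + _]addrC.
have -> : symbol xi `^ s = symbol xi `^ (s - 1 / 2) * symbol xi `^ (1 / 2).
  by rewrite -powRD ?subrK // (gt_eqF (symbol_gt0 xi)) implybT.
have := dot_norm_le xi v; have := powR_ge0 (symbol xi) (s - 1 / 2).
set d := `|dot _ _|; set w := _ `^ (s - _); set w' := _ `^ (1 / 2); set V := _ + _ => w0 h.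
set a := _ + _; have a0 : 0 <= a by rewrite addr_ge0.
have -> : V * (w * w' * a) = w * (a * (V * w')) by ring.
by rewrite ler_wpM2l // ler_wpM2l.
Qed.

Lemma is_derive_trig_series s A B C p v : 1 / 2 < s -> weighted_le s A B C ->
  is_derive p v (trig_series A B)
   (trig_series (fun xi => B xi * dot xi v) (fun xi => - (A xi * dot xi v)) p).
Proof.
move=> s12 H; have s0 : 0 < s by lra.
have H' := weighted_le_derive v H.
have s0' : 0 < s - 1 / 2 by lra.
apply: is_derive_pt.
set B' := fun xi => B xi * _; set A' := fun xi => - _.
have := @is_derive_limit _ (fun n (y : R) => trig_sum A B (box n) (p + y *: v))
  (fun n (y : R) => trig_sum B' A' (box n) (p + y *: v))
  (fun y : R => trig_series A B (p + y *: v))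
  (fun y : R => trig_series B' A' (p + y *: v)).
move=> /(_ _ _ _ 0); rewrite scale0r addr0; apply.
- by move=> n y; apply: is_derive_line; exact: is_derive_trig_sum.
- by move=> y; exact: trig_series_cvg s0 H.
move=> e e0; have C0 := weighted_le_ge0 H'.
have [N _ HN] : \forall n \near \oo, (`|v.1| + `|v.2|) * C / n.+1%:R `^ (s - 1 / 2) < e / 2.
  by apply: (cvgr_lt _ (powR_small s0' C0)); rewrite divr_gt0.
exists N => n y Nn; apply: (le_trans (trig_series_tail _ s0' H' (box_uniq n) (fun _ h => h))).
by have := HN n Nn; lra.
Qed.

Lemma trig_series_Cn m s A B C : m%:R / 2 < s -> weighted_le s A B C ->
  Cn m (trig_series A B).
Proof.
elim: m s A B C => [|m IH] s A B C sm H.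
  have s0 : 0 < s by lra.
  by split=> //; [exact: trig_series_periodic s0 H|exact: trig_series_continuous s0 H].
have sm' : m%:R / 2 < s - 1 / 2 by move: sm; rewrite -natr1; lra.
have s12 : 1 / 2 < s by have := ler0n R m; lra.
apply: (proj1 (@CnP _ m _ (fun j => trig_series (fun xi => B xi * dot xi (basis2 R j))
  (fun xi => - (A xi * dot xi (basis2 R j)))) _ _ _ _)) => [|||j].
- by apply: (@trig_series_periodic s _ _ C) => //; lra.
- by apply: (@trig_series_continuous s _ _ C) => //; lra.
- by move=> j p; exact: is_derive_trig_series s12 H.
- exact: IH sm' (weighted_le_derive _ H).
Qed.

End TrigonometricSeries.

(** * Fourier inversion by Fejer means *)

Section FourierInversion.
Context {R : realType}.
Implicit Types (f : R * R -> R) (p q z : R * R) (N n : nat) (xi eta : int * int).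

(** No factor 2 appears in front of the coefficients, because the series runs over the whole
    lattice, where xi and - xi contribute the same term. *)
Definition cos_coef f xi := torus_integral (fun q => f q * cos (dot xi q)).
Definition sin_coef f xi := torus_integral (fun q => f q * sin (dot xi q)).

Lemma continuous_sum_seq (I : Type) (r : seq I) (F : I -> R * R -> R) :
  (forall i, continuous (F i)) -> continuous (fun q => \sum_(i <- r) F i q).
Proof.
move=> cF q; elim: r => [|j r IH].
  by under eq_fun do rewrite big_nil; exact: cvg_cst.
by under eq_fun do rewrite big_cons; apply: cvgD; [exact: cF|exact: IH].
Qed.

Lemma torus_integral_sum (I : Type) (r : seq I) (F : I -> R * R -> R) :
  (forall i, continuous (F i)) ->
  torus_integral (fun q => \sum_(i <- r) F i q) = \sum_(i <- r) torus_integral (F i).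
Proof.
move=> cF; elim: r => [|i r IH].
  by rewrite big_nil; under eq_fun do rewrite big_nil; exact: torus_integral_cst.
rewrite big_cons -IH; under eq_fun do rewrite big_cons.
by apply: torus_integralD => //; exact: continuous_sum_seq.
Qed.

Lemma cos_dot_continuous xi : continuous (fun q => cos (dot xi q) : R).
Proof.
by move=> q; apply: continuous_comp; [exact: dot_continuous|exact: continuous_cos].
Qed.

Lemma sin_dot_continuous xi : continuous (fun q => sin (dot xi q) : R).
Proof.
by move=> q; apply: continuous_comp; [exact: dot_continuous|exact: continuous_sin].
Qed.

Lemma continuous_mul f g : continuous f -> continuous g -> continuous (fun q => f q * g q).
Proof. by move=> cf cg q; apply: cvgM; [exact: cf|exact: cg]. Qed.

Lemma cos_dotB_continuous xi p : continuous (fun q => cos (dot xi (p - q)) : R).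
Proof.
have -> : (fun q => cos (dot xi (p - q)) : R) = (fun q => cos (dot xi p - dot xi q)).
  by apply/funext => q; rewrite dotB.
move=> q; apply: (@continuous_comp _ _ _ (fun q => dot xi p - dot xi q) cos);
  last exact: continuous_cos.
by apply: cvgB; [exact: cvg_cst|exact: dot_continuous].
Qed.

Lemma torus_integral_cos_dotB f xi p : continuous f ->
  torus_integral (fun q => f q * cos (dot xi (p - q))) =
  harmonic (cos_coef f xi) (sin_coef f xi) xi p.
Proof.
move=> cf.
under eq_fun => q do rewrite dotB cosB mulrDr mulrCA [f q * (sin _ * _)]mulrCA.
have c1 := continuous_mul cf (@cos_dot_continuous xi).
have c2 := continuous_mul cf (@sin_dot_continuous xi).
rewrite torus_integralD.
- by rewrite !torus_integralZ // /harmonic mulrC [sin _ * _]mulrC.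
- by apply: continuous_mul => // q; exact: cvg_cst.
- by apply: continuous_mul => // q; exact: cvg_cst.
Qed.

Lemma torus_integral_cos1 xi p :
  torus_integral (fun q => cos (dot xi (p - q))) = (xi == 0)%:R :> R.
Proof.
have [->|xi0] := eqVneq xi 0.
  under eq_fun do rewrite /dot /= !mul0r addr0 mulr0 cos0.
  exact: torus_integral_cst.
under eq_fun => q do rewrite dotB cosB.
by rewrite mulr0n -(torus_integral_harmonic (cos (dot xi p)) (sin (dot xi p)) xi0).
Qed.

Definition grid N : seq (int * int) := [seq (i%:Z, j%:Z) | i <- iota 0 N, j <- iota 0 N].

(** The Fejer kernel without normalisation: the squared modulus of the sum of exp (2 i pi eta . z)
    over the grid, in real and imaginary parts. *)
Definition fejer N z : R :=
  (\sum_(eta <- grid N) cos (dot eta z)) ^+ 2 + (\sum_(eta <- grid N) sin (dot eta z)) ^+ 2.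

Definition fejer1 N (x : R) : R :=
  (\sum_(i <- iota 0 N) cos (2 * pi * (i%:R * x))) ^+ 2
  + (\sum_(i <- iota 0 N) sin (2 * pi * (i%:R * x))) ^+ 2.

Lemma sum_square_cos (I : Type) (r : seq I) (F : I -> R) :
  (\sum_(i <- r) cos (F i)) ^+ 2 + (\sum_(i <- r) sin (F i)) ^+ 2 =
  \sum_(i <- r) \sum_(j <- r) cos (F i - F j).
Proof.
rewrite !expr2 !big_distrlr /= -big_split /=; apply: eq_bigr => i _.
by rewrite -big_split /=; apply: eq_bigr => j _; rewrite cosB.
Qed.

Lemma fejerE N z : fejer N z =
  \sum_(eta <- grid N) \sum_(xi <- grid N) cos (dot (eta - xi) z).
Proof.
rewrite /fejer sum_square_cos; apply: eq_bigr => eta _; apply: eq_bigr => xi _.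
by rewrite dot_sub.
Qed.

(** The exponential sum over a square grid is a product of two one-dimensional sums, and moduli are
    multiplicative. *)
Lemma fejer_prod N z : fejer N z = fejer1 N z.1 * fejer1 N z.2.
Proof.
rewrite /fejer /grid !big_allpairs_dep /= /fejer1.
set c1 := \sum_(i <- _) cos (2 * pi * (_ * z.1)).
set s1 := \sum_(i <- _) sin (2 * pi * (_ * z.1)).
set c2 := \sum_(i <- _) cos (2 * pi * (_ * z.2)).
set s2 := \sum_(i <- _) sin (2 * pi * (_ * z.2)).
have -> : \sum_(i <- iota 0 N) \sum_(j <- iota 0 N) cos (dot (i%:Z, j%:Z) z) =
    c1 * c2 - s1 * s2.
  rewrite !big_distrlr /= -sumrB; apply: eq_bigr => i _.
  by rewrite -sumrB; apply: eq_bigr => j _; rewrite /dot /= mulrDr cosD.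
have -> : \sum_(i <- iota 0 N) \sum_(j <- iota 0 N) sin (dot (i%:Z, j%:Z) z) =
    s1 * c2 + c1 * s2.
  rewrite !big_distrlr /= -big_split /=; apply: eq_bigr => i _.
  by rewrite -big_split; apply: eq_bigr => j _; rewrite /dot /= mulrDr sinD.
by ring.
Qed.

Lemma fejer1_ge0 N (x : R) : 0 <= fejer1 N x.
Proof. by rewrite addr_ge0 ?sqr_ge0. Qed.

(* Multiplying the geometric sum of [exp (2 i pi k x)] by [2 sin (pi x)] telescopes. *)
Lemma fejer1_sin N (x : R) : sin (pi * x) ^+ 2 * fejer1 N x <= 1.
Proof.
(* [a] is (2 N - 1) pi x, the phase left at the upper end of the telescoping sums. *)
set s := sin (pi * x); pose a := 2 * pi * (N%:R * x) - pi * x.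
have hc : 2 * s * \sum_(i <- iota 0 N) cos (2 * pi * (i%:R * x)) = sin a + s.
  rewrite {}/a; elim: N => [|N IH].
    by rewrite big_nil !mul0r !mulr0 sub0r sinN addNr.
  rewrite -(addn1 N) iotaD big_cat big_seq1 /= mulrDr IH add0n.
  set b := 2 * pi * (N%:R * x).
  have -> : 2 * pi * ((N + 1)%:R * x) - pi * x = b + pi * x.
    by rewrite /b natrD; ring.
  by rewrite sinB sinD -/s; ring.
have hs : 2 * s * \sum_(i <- iota 0 N) sin (2 * pi * (i%:R * x)) = cos (pi * x) - cos a.
  rewrite {hc}/a; elim: N => [|N IH].
    by rewrite big_nil !mul0r !mulr0 sub0r cosN subrr.
  rewrite -(addn1 N) iotaD big_cat big_seq1 /= mulrDr IH add0n.
  set b := 2 * pi * (N%:R * x).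
  have -> : 2 * pi * ((N + 1)%:R * x) - pi * x = b + pi * x.
    by rewrite /b natrD; ring.
  by rewrite cosB cosD -/s; ring.
rewrite /fejer1 mulrDr -!exprMn.
set C := s * _; set S := s * _.
have {}hc : 2 * C = sin a + s by rewrite -hc /C; ring.
have {}hs : 2 * S = cos (pi * x) - cos a by rewrite -hs /S; ring.
have e1 : cos a ^+ 2 + sin a ^+ 2 = 1 by exact: cos2Dsin2.
have e2 : cos (pi * x) ^+ 2 + s ^+ 2 = 1 by exact: cos2Dsin2.
have -> : C = (sin a + s) / 2 by lra.
have -> : S = (cos (pi * x) - cos a) / 2 by lra.
by have := sqr_ge0 (sin a - s); have := sqr_ge0 (cos (pi * x) + cos a); nra.
Qed.

Lemma fejer_continuous N p : continuous (fun q => fejer N (p - q)).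
Proof.
have -> : (fun q => fejer N (p - q)) = (fun q =>
    \sum_(eta <- grid N) \sum_(xi <- grid N) cos (dot (eta - xi) (p - q))).
  by apply/funext => q; rewrite fejerE.
apply: continuous_sum_seq => eta; apply: continuous_sum_seq => xi.
exact: cos_dotB_continuous.
Qed.

Lemma torus_integral_fejer f N p : continuous f ->
  torus_integral (fun q => f q * fejer N (p - q)) =
  \sum_(eta <- grid N) \sum_(xi <- grid N)
    harmonic (cos_coef f (eta - xi)) (sin_coef f (eta - xi)) (eta - xi) p.
Proof.
move=> cf; under eq_fun => q do rewrite fejerE mulr_sumr.
have cfc (eta xi : int * int) : continuous (fun q => f q * cos (dot (eta - xi) (p - q))).
  by apply: continuous_mul => //; exact: cos_dotB_continuous.
rewrite torus_integral_sum; last first.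
  move=> eta; have -> : (fun q => f q * \sum_(xi <- grid N) cos (dot (eta - xi) (p - q))) =
      (fun q => \sum_(xi <- grid N) f q * cos (dot (eta - xi) (p - q))).
    by apply/funext => q; rewrite mulr_sumr.
  exact: continuous_sum_seq.
apply: eq_bigr => eta _; under eq_fun => q do rewrite mulr_sumr.
rewrite torus_integral_sum //; apply: eq_bigr => xi _.
exact: torus_integral_cos_dotB.
Qed.

Lemma grid_uniq N : uniq (grid N).
Proof. by apply: allpairs_uniq; rewrite ?iota_uniq // => -[? ?] [? ?] _ _ [-> ->]. Qed.

Lemma sum_delta (T : eqType) (r : seq T) : uniq r ->
  \sum_(x <- r) \sum_(y <- r) (x == y)%:R = (size r)%:R :> R.
Proof.
move=> ur; rewrite -[size r]sum1_size natr_sum [LHS]big_seq [RHS]big_seq.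
apply: eq_bigr => x xr; rewrite (bigD1_seq x) //= eqxx big1 ?addr0 // => y.
by rewrite eq_sym => /negbTE ->.
Qed.

Lemma torus_integral_fejer1 N p :
  torus_integral (fun q => fejer N (p - q)) = N%:R ^+ 2 :> R.
Proof.
under eq_fun => q do rewrite fejerE.
rewrite torus_integral_sum; last first.
  by move=> eta; apply: continuous_sum_seq => xi; exact: cos_dotB_continuous.
transitivity (\sum_(eta <- grid N) \sum_(xi <- grid N) (eta == xi)%:R : R).
  apply: eq_bigr => eta _; rewrite torus_integral_sum; last first.
    by move=> xi; exact: cos_dotB_continuous.
  by apply: eq_bigr => xi _; rewrite torus_integral_cos1 subr_eq0.
by rewrite sum_delta ?grid_uniq // size_allpairs !size_iota natrM expr2.
Qed.

(** Treats both coordinates at once: [e] embeds the integers as the frequencies of one axis and [c]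
    is the matching coordinate. Only the N diagonal pairs have a nonzero mean. *)
Lemma torus_integral_fejer1D N (e : int -> int * int) (c : R * R -> R) p :
  injective e -> {morph e : i j / i - j} ->
  (forall i z, 2 * pi * (i%:R * c z) = dot (e i%:Z) z) ->
  torus_integral (fun q => fejer1 N (c (p - q))) = N%:R /\
  continuous (fun q => fejer1 N (c (p - q))).
Proof.
move=> einj eB ce.
have E q : fejer1 N (c (p - q)) = \sum_(i <- iota 0 N) \sum_(j <- iota 0 N)
    cos (dot (e i%:Z - e j%:Z) (p - q)).
  rewrite /fejer1 sum_square_cos; apply: eq_bigr => i _; apply: eq_bigr => j _.
  by rewrite !ce dot_sub.
have -> : (fun q => fejer1 N (c (p - q))) = (fun q => \sum_(i <- iota 0 N)
    \sum_(j <- iota 0 N) cos (dot (e i%:Z - e j%:Z) (p - q))) by apply/funext.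
have cc (i j : nat) := @cos_dotB_continuous (e i%:Z - e j%:Z) p.
split; last by do 2 apply: continuous_sum_seq => ?.
rewrite torus_integral_sum; last by move=> i; apply: continuous_sum_seq.
transitivity (\sum_(i <- iota 0 N) \sum_(j <- iota 0 N) (i == j)%:R : R).
  apply: eq_bigr => i _; rewrite torus_integral_sum //.
  by apply: eq_bigr => j _; rewrite torus_integral_cos1 subr_eq0 (inj_eq einj).
by rewrite sum_delta ?iota_uniq // size_iota.
Qed.

(* A modulus of continuity at [p] which is itself a trigonometric polynomial. *)
Lemma periodic_modulus f p (e : R) : periodic2 f -> continuous f -> 0 < e ->
  exists2 C, 0 <= C & forall q, `|f q - f p| <=
    e + C * (sin (pi * (p.1 - q.1)) ^+ 2 + sin (pi * (p.2 - q.2)) ^+ 2).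
Proof.
move=> pf cf e0; have [M M0 fM] := periodic_bounded pf cf.
have /cvgrPdist_le/(_ _ e0)/nbhs_ballP[d /= d0 Hd] := cf p.
pose d' := Num.min d (1 / 2).
have d'0 : 0 < d' by rewrite lt_min d0 divr_gt0.
have d'd : d' <= d by rewrite ge_min lexx.
have d'2 : d' <= 1 / 2 by rewrite ge_min lexx orbT.
pose s : R := sin (pi * d').
have pi0 := pi_gt0 R.
have s0 : 0 < s by apply: sin_gt0_pi; apply/andP; split; nra.
(* f varies by at most 2 M, and away from p one of the two squared sines is at least [s ^+ 2]. *)
exists (2 * M / s ^+ 2); first by rewrite divr_ge0 ?sqr_ge0 // mulr_ge0.
move=> q; pose k (x : R) := Num.floor (x + 1 / 2).
(* [z] is p - q with each coordinate moved into [-1/2, 1/2[ by an integer shift. *)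
pose z : R * R := (p.1 - q.1 - (k (p.1 - q.1))%:~R, p.2 - q.2 - (k (p.2 - q.2))%:~R).
have kz (x : R) : - (1 / 2) <= x - (k x)%:~R < 1 / 2.
  have := floor_itv (x + 1 / 2); rewrite intrD mulr1z -/(k x) => /andP[? ?].
  by apply/andP; split; lra.
have fq : f q = f (p - z).
  rewrite -(periodic_int (- k (p.1 - q.1)) (- k (p.2 - q.2)) (p - z).1 (p - z).2 pf).
  by rewrite !mulrNz /z /=; case: (q) => a b /=; congr (f (_, _)); ring.
have sin2 (x : R) (n : int) : sin (pi * (x - n%:~R)) ^+ 2 = sin (pi * x) ^+ 2.
  have D (y : R) : sin y ^+ 2 = (1 - cos (2 * y)) / 2.
    have -> : 2 * y = y + y by ring.
    by rewrite cosD -!expr2; have := cos2Dsin2 y; lra.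
  rewrite !D; congr ((1 - _) / 2); rewrite -[RHS](cos_int (- n)); congr cos.
  by rewrite mulrNz; ring.
have sz1 : sin (pi * (p.1 - q.1)) ^+ 2 = sin (pi * z.1) ^+ 2 by rewrite sin2.
have sz2 : sin (pi * (p.2 - q.2)) ^+ 2 = sin (pi * z.2) ^+ 2 by rewrite sin2.
have big (x : R) : - (1 / 2) <= x < 1 / 2 -> d' <= `|x| -> s ^+ 2 <= sin (pi * x) ^+ 2.
  move=> /andP[x1 x2] dx.
  have mono (y : R) : d' <= y -> y <= 1 / 2 -> s <= sin (pi * y).
    move=> y1 y2; rewrite /s; have [->//|yd] := eqVneq y d'.
    have mem (t : R) : 0 <= t -> t <= 1 / 2 -> pi * t \in `[- (pi / 2), pi / 2].
      by move=> t0 t1; rewrite in_itv /=; apply/andP; split; nra.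
    apply/ltW; rewrite ltr_sin ?mem //; last 2 first.
    - exact: ltW.
    - by rewrite (le_trans (ltW d'0)).
    by rewrite ltr_pM2l // lt_neqAle eq_sym yd.
  have h : s <= sin (pi * `|x|).
    by apply: mono => //; rewrite ler_norml; apply/andP; split; lra.
  have : s ^+ 2 <= sin (pi * `|x|) ^+ 2 by nra.
  by case: (ger0P x) => // _; rewrite mulrN sinN sqrrN.
rewrite sz1 sz2; have := sqr_ge0 (sin (pi * z.1)); have := sqr_ge0 (sin (pi * z.2)).
set a := _ ^+ 2; set b := sin (pi * z.1) ^+ 2 => a0 b0.
have c0 : 0 <= 2 * M / s ^+ 2 by rewrite divr_ge0 ?sqr_ge0 // mulr_ge0.
have [near|far] := boolP ((`|z.1| < d') && (`|z.2| < d')).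
  have : `|f p - f (p - z)| <= e.
    case/andP: near => n1 n2; apply: (Hd (p - z)); split; rewrite /ball /= opprB addrC subrK;
      exact: lt_le_trans d'd.
  by rewrite -fq distrC => h; rewrite (le_trans h) // lerDl mulr_ge0 // addr_ge0.
have sab : s ^+ 2 <= b + a.
  move: far; rewrite negb_and -!leNgt => /orP[/(big _ (kz _))|/(big _ (kz _))]; rewrite -/a -/b; lra.
have : `|f q - f p| <= 2 * M.
  by rewrite (le_trans (ler_normB _ _)) //; have := fM p; have := fM q; lra.
move=> h; apply: (le_trans h); apply: (@le_trans _ _ (2 * M / s ^+ 2 * (b + a))); last lra.
rewrite -mulrA ler_peMr ?mulr_ge0 // mulrC ler_pdivlMr ?mul1r // exprn_gt0 //.
Qed.

(** The modulus of continuity is integrated against the kernel. A squared sine times its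
    one-dimensional kernel is at most 1, so each term with factor C leaves one one-dimensional
    kernel, of integral N, which is negligible against N^2. *)
Lemma fejer_approx f p (e : R) : periodic2 f -> continuous f -> 0 < e ->
  exists2 C, 0 <= C & forall N, (0 < N)%N ->
  `|\sum_(eta <- grid N) \sum_(xi <- grid N)
      harmonic (cos_coef f (eta - xi)) (sin_coef f (eta - xi)) (eta - xi) p
    - N%:R ^+ 2 * f p| <= N%:R ^+ 2 * e + C * N%:R.
Proof.
move=> pf cf e0; have [C C0 HC] := periodic_modulus p pf cf e0.
exists (2 * C) => [|N N0]; first by rewrite mulr_ge0.
rewrite -torus_integral_fejer // -[N%:R ^+ 2](torus_integral_fejer1 N p).
have cK := @fejer_continuous N p.
have [i1 c1] : torus_integral (fun q => fejer1 N (p - q).1) = N%:R :> R /\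
    continuous (fun q => fejer1 N (p - q).1 : R).
  apply: (@torus_integral_fejer1D N (fun i => (i, 0)) fst) => [i j [] //|i j|i z].
    by congr pair; rewrite subr0.
  by rewrite /dot /=; ring.
have [i2 c2] : torus_integral (fun q => fejer1 N (p - q).2) = N%:R :> R /\
    continuous (fun q => fejer1 N (p - q).2 : R).
  apply: (@torus_integral_fejer1D N (fun i => (0, i)) snd) => [i j [] //|i j|i z].
    by congr pair; rewrite subr0.
  by rewrite /dot /=; ring.
pose g q := e * fejer N (p - q) + (C * fejer1 N (p - q).1 + C * fejer1 N (p - q).2).
have cC (h : R * R -> R) (a : R) : continuous h -> continuous (fun q => a * h q).
  by move=> ch; apply: continuous_mul => // q; exact: cvg_cst.
have cD (h k : R * R -> R) : continuous h -> continuous k -> continuous (fun q => h q + k q).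
  by move=> ch ck q; apply: cvgD; [exact: ch|exact: ck].
have c12 : continuous (fun q => C * fejer1 N (p - q).1 + C * fejer1 N (p - q).2).
  by apply: cD; apply: cC.
have cg : continuous g by apply: cD => //; exact: cC.
have Ig : torus_integral g = N%:R ^+ 2 * e + 2 * C * N%:R.
  rewrite /g torus_integralD //; last exact: cC.
  rewrite torus_integralD; [|exact: cC|exact: cC].
  by rewrite !torus_integralZ // i1 i2 torus_integral_fejer1; ring.
rewrite torus_integral_fejer1 -Ig.
have cfK : continuous (fun q => f q * fejer N (p - q)) by exact: continuous_mul.
have -> : torus_integral (fun q => f q * fejer N (p - q)) - N%:R ^+ 2 * f p =
   torus_integral (fun q => f q * fejer N (p - q) + - f p * fejer N (p - q)).
  rewrite torus_integralD //; last exact: cC.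
  by rewrite torus_integralZ // torus_integral_fejer1; ring.
have cd : continuous (fun q => f q * fejer N (p - q) + - f p * fejer N (p - q)).
  by apply: cD => //; exact: cC.
have bound q : `|f q * fejer N (p - q) + - f p * fejer N (p - q)| <= g q.
  rewrite -mulrDl normrM /g fejer_prod.
  have F1 := fejer1_ge0 N (p - q).1; have F2 := fejer1_ge0 N (p - q).2.
  have S1 := fejer1_sin N (p - q).1; have S2 := fejer1_sin N (p - q).2.
  rewrite [`|_ * fejer1 _ _|]ger0_norm ?mulr_ge0 //.
  apply: (le_trans (ler_wpM2r (mulr_ge0 F1 F2) (HC q))).
  move: F1 F2 S1 S2; rewrite -[(p - q).1]/(p.1 - q.1) -[(p - q).2]/(p.2 - q.2).
  set A := fejer1 _ _; set B := fejer1 _ _; set a := _ ^+ 2; set b := sin _ ^+ 2.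
  move=> F1 F2 S1 S2.
  have h1 : C * ((a * A) * B) <= C * B.
    by rewrite ler_wpM2l // -[leRHS]mul1r ler_wpM2r.
  have h2 : C * ((b * B) * A) <= C * A.
    by rewrite ler_wpM2l // -[leRHS]mul1r ler_wpM2r.
  by nra.
rewrite ler_norml -[- _]mulN1r -torus_integralZ //.
apply/andP; split; apply: le_torus_integral => //; first exact: cC.
  by move=> q; have := bound q; rewrite ler_norml mulN1r => /andP[].
by move=> q; have := bound q; rewrite ler_norml => /andP[].
Qed.

Lemma grid_shift_box N n (i j : nat) : (n <= i)%N -> (n <= j)%N ->
  (i + n < N)%N -> (j + n < N)%N ->
  {subset box n <= [seq eta - (i%:Z, j%:Z) | eta <- grid N]}.
Proof.
move=> ni nj iN jN [x y]; rewrite mem_box /= => /andP[xn yn].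
apply/mapP; exists (x + i%:Z, y + j%:Z); last by congr pair; rewrite /= addrK.
apply/allpairsP; exists (absz (x + i%:Z), absz (y + j%:Z)); split => /=.
- by rewrite mem_iota; lia.
- by rewrite mem_iota; lia.
- by congr pair; lia.
Qed.

(** The double sum is a sum over xi of partial sums on the grid translated by - xi. Such a translate
    contains a box whose size is the distance from xi to the edge of the grid, and the four sides of
    the grid give the factor 4. *)
Lemma trig_series_fejer (s : R) A B C p N : 0 < s -> weighted_le s A B C -> (0 < N)%N ->
  `|\sum_(eta <- grid N) \sum_(xi <- grid N)
      harmonic (A (eta - xi)) (B (eta - xi)) (eta - xi) p
    - N%:R ^+ 2 * trig_series A B p| <=
  4 * N%:R * \sum_(0 <= i < N) (2 * (C / i.+1%:R `^ s)).
Proof.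
move=> s0 H N0; pose e i : R := 2 * (C / i.+1%:R `^ s).
have C0 := weighted_le_ge0 H.
have e0 i : 0 <= e i by rewrite mulr_ge0 // divr_ge0 ?powR_ge0.
rewrite exchange_big /=.
have -> : N%:R ^+ 2 * trig_series A B p = \sum_(xi <- grid N) trig_series A B p.
  by rewrite big_const_seq count_predT iter_addr_0 size_allpairs !size_iota -[RHS]mulr_natl natrM expr2.
rewrite -sumrB (le_trans (ler_norm_sum _ _ _)) //.
rewrite {1}/grid big_allpairs_dep /=.
have iN : iota 0 N = index_iota 0 N by rewrite /index_iota subn0.
rewrite iN.
apply: (@le_trans _ _ (\sum_(0 <= i < N) \sum_(0 <= j < N)
    (e i + e (N - i.+1)%N + (e j + e (N - j.+1)%N)))).
  rewrite !big_nat; apply: ler_sum => i /= iN'; rewrite !big_nat; apply: ler_sum => j /= jN'.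
  (* The distance from (i, j) to the nearest side of the grid: [e n] is one of the four terms of the
     bound, and the other three are nonnegative. *)
  pose n := minn (minn i (N - i.+1)) (minn j (N - j.+1)).
  have ur : uniq [seq eta - (i%:Z, j%:Z) | eta <- grid N].
    by rewrite map_inj_uniq ?grid_uniq // => x y /addIr.
  have sub : {subset box n <= [seq eta - (i%:Z, j%:Z) | eta <- grid N]}.
    by apply: grid_shift_box; rewrite /n; lia.
  have := trig_series_tail p s0 H ur sub; rewrite /trig_sum big_map => h.
  apply: (le_trans h); rewrite -/(e n).
  have : n = i \/ n = (N - i.+1)%N \/ n = j \/ n = (N - j.+1)%N by rewrite /n; lia.
  have := e0 i; have := e0 (N - i.+1)%N; have := e0 j; have := e0 (N - j.+1)%N.
  by move=> ? ? ? ? [->|[->|[->|->]]]; lra.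
have rev : \sum_(0 <= i < N) e (N - i.+1)%N = \sum_(0 <= i < N) e i.
  by rewrite big_nat_rev /= add0n; apply: eq_big_nat => i /andP[_ iN']; congr e; lia.
rewrite (eq_bigr (fun i => (e i + e (N - i.+1)%N) *+ N + (\sum_(0 <= j < N) e j) *+ 2)).
  rewrite big_split /= sumr_const_nat subn0 sumrMnl big_split /= rev.
  rewrite -(mulr_natr (_ + _) N) ?mulr2n le_eqVlt; apply/orP; left.
  by apply/eqP; rewrite -/e; ring.
move=> i _; rewrite big_split /= sumr_const_nat subn0 big_split /= rev.
by rewrite mulr2n.
Qed.

(** The Fejer means at p tend to f p, since the kernel concentrates, and also to the sum of the
    series, since it converges absolutely and Cesaro means of its tail bounds vanish. *)
Theorem fourier_inversion (s : R) f C : periodic2 f -> continuous f -> 0 < s ->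
  weighted_le s (cos_coef f) (sin_coef f) C ->
  f = trig_series (cos_coef f) (sin_coef f).
Proof.
move=> pf cf s0 H; apply/funext => p; apply/eqP; rewrite -subr_eq0 -normr_le0.
apply/ler_addgt0Pl => e e0; rewrite addr0.
have e3 : 0 < e / 3 by rewrite divr_gt0.
have [C1 C10 H1] := fejer_approx p pf cf e3.
pose u i : R := 2 * (C / i.+1%:R `^ s).
have C0 := weighted_le_ge0 H.
have u0 : u @ \oo --> (0 : R).
  by rewrite -[0 in X in _ --> X](mulr0 2); apply: cvgM; [exact: cvg_cst|exact: powR_small].
have cm := cesaro u0.
near \oo => n.
have n0 : 0 < n.+1%:R :> R by rewrite ltr0n.
(* The error is split into thirds: the modulus of continuity, the term C1 / N, and four times the
   mean of the tail bounds, whence e / 12. *)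
have small : arithmetic_mean u n <= e / 12.
  near: n; apply: (cvgr_le _ cm); rewrite divr_gt0 //.
have big : 3 * C1 <= e * n.+1%:R.
  rewrite -ler_pdivrMl // (le_trans (ltW (truncnS_gt _))) // ler_nat ltnS.
  by near: n; exact: nbhs_infty_ge.
have := H1 n.+1 isT; have := @trig_series_fejer s _ _ C p n.+1 s0 H isT.
rewrite -/u; set S := \sum_(eta <- _) _; set V := trig_series _ _ _.
have -> : \sum_(0 <= i < n.+1) u i = n.+1%:R * arithmetic_mean u n.
  by rewrite /arithmetic_mean /series /= mulrA divff ?mul1r // gt_eqF.
move: small big n0; set N : R := n.+1%:R; set mean := arithmetic_mean u n => h1 h2 N0.
rewrite !ler_norml => /andP[a1 a2] /andP[b1 b2].
have NN : 0 < N ^+ 2 by rewrite exprn_gt0.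
have k1 : C1 * N <= N ^+ 2 * (e / 3) by nra.
have k2 : 4 * N * (N * mean) <= N ^+ 2 * (e / 3) by nra.
apply/andP; split.
  by rewrite -(ler_pM2l NN); nra.
by rewrite -(ler_pM2l NN); nra.
Unshelve. all: by end_near. Qed.

End FourierInversion.

(** * Sobolev regularity *)

Section SobolevEmbedding.
Context {R : realType}.
Implicit Types (f : R * R -> R) (p v : R * R) (xi : int * int) (r : seq (int * int))
  (k s : R).

Lemma ler_sum_sub (T : eqType) (r1 r2 : seq T) (F : T -> R) : uniq r1 -> uniq r2 ->
  {subset r1 <= r2} -> (forall x, 0 <= F x) ->
  \sum_(x <- r1) F x <= \sum_(x <- r2) F x.
Proof.
move=> u1 u2 sub F0; rewrite [leRHS](bigID (fun x => x \in r1)) /=.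
rewrite -[X in _ <= X + _]big_filter.
rewrite [X in _ <= X + _](perm_big r1) /=; first by rewrite lerDl sumr_ge0.
apply: uniq_perm; rewrite ?filter_uniq // => x.
by rewrite mem_filter; case: (boolP (x \in r1)) => // /sub ->.
Qed.

(** The comparison of a series with the integral of x^(-1-t). It reduces to 1 + t / x <= (y /
    x)^(-t), which follows from 1 + z <= exp z and ln (1 - 1 / x) <= - 1 / x. *)
Lemma powR_telescope (t : R) (m : nat) : 0 < t ->
  m.+2%:R `^ (- 1 - t) <= t^-1 * (m.+1%:R `^ (- t) - m.+2%:R `^ (- t)).
Proof.
move=> t0; set x : R := m.+2%:R; set y : R := m.+1%:R.
have xy : x = y + 1 by rewrite /x -natr1.
have y0 : 0 < y by rewrite ltr0n.
have x0 : 0 < x by rewrite ltr0n.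
have xn0 : x != 0 by rewrite gt_eqF.
rewrite ler_pdivlMl // powRD ?xn0 ?implybT // powR_inv1 ?(ltW x0) //.
have X0 : 0 < x `^ (- t) by rewrite powR_gt0.
suff : 1 + t / x <= (y / x) `^ (- t).
  move=> h; have := ler_wpM2l (ltW X0) h.
  rewrite -powRM ?(ltW x0) ?divr_ge0 ?(ltW y0) ?(ltW x0) // [x * (y / x)]mulrC divfK //.
  have -> : t * (x^-1 * x `^ (- t)) = x `^ (- t) * (t / x) by ring.
  by rewrite mulrDr mulr1 lerBrDl.
have yx0 : 0 < y / x by rewrite divr_gt0.
rewrite /powR gt_eqF //; apply: le_trans (expR_ge1Dx _).
rewrite lerD2l mulNr -mulrN ler_pM2l //.
have -> : y / x = 1 + (- x^-1) by rewrite (_ : y = x - 1) ?xy ?addrK //; field.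
have : - 1 < - x^-1.
  by rewrite ltrN2 invf_lt1 // /x ltr1n.
by move=> /le_ln1Dx; rewrite lerNr.
Qed.

Lemma sum_powR_le (t : R) (n : nat) : 0 < t ->
  \sum_(0 <= m < n.+1) m.+1%:R `^ (- 1 - t) <= 1 + t^-1.
Proof.
move=> t0; rewrite big_nat_recl //= powR1 lerD2l.
apply: (@le_trans _ _ (\sum_(0 <= m < n) t^-1 * (m.+1%:R `^ (- t) - m.+2%:R `^ (- t)))).
  by apply: ler_sum => m _; exact: powR_telescope.
rewrite -mulr_sumr ler_piMr ?invr_ge0 ?(ltW t0) //.
under eq_bigr do rewrite -opprB; rewrite sumrN telescope_sumr // opprB powR1.
by rewrite lerBlDr lerDl powR_ge0.
Qed.

Lemma sum_zrange (F : nat -> R) (n : nat) : (forall m, 0 <= F m) ->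
  \sum_(i <- zrange n) F `|i|%N <= 2 * \sum_(0 <= m < n.+1) F m.
Proof.
move=> F0; elim: n => [|n IH].
  by rewrite /zrange /= big_seq1 big_nat1 /=; have := F0 0%N; lra.
rewrite (perm_big [:: - n.+1%:Z, n.+1%:Z & zrange n]); last first.
  apply: uniq_perm; rewrite ?zrange_uniq //.
    by rewrite 2!cons_uniq zrange_uniq !(mem_zrange, in_cons); lia.
  by move=> i; rewrite !(mem_zrange, in_cons); lia.
by rewrite 2!big_cons [in leRHS]big_nat_recr //= ?abszN ?absz_nat; lra.
Qed.

Lemma symbol_ge xi : (1 + `|xi.1|%N%:R) * (1 + `|xi.2|%N%:R) <= symbol xi :> R.
Proof.
have sq (i : int) : i%:~R ^+ 2 = `|i|%N%:R ^+ 2 :> R.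
  by rewrite natr_absz intr_norm real_normK ?num_real.
rewrite /symbol !sq; set a := _%:R; set b := `|xi.2|%N%:R.
have nat_sq (m : nat) : m%:R <= m%:R ^+ 2 :> R by rewrite -natrX ler_nat; nia.
have ha : a <= a ^+ 2 by exact: nat_sq.
have hb : b <= b ^+ 2 by exact: nat_sq.
have pi2 : 2 <= (2 * pi) ^+ 2 :> R by have := pi_ge2 R; nra.
by have := sqr_ge0 (a - b); have := sqr_ge0 a; have := sqr_ge0 b; nra.
Qed.

Lemma sum_symbol_le (t : R) r : 0 < t -> uniq r ->
  \sum_(xi <- r) symbol xi `^ (- 1 - t) <= (2 * (1 + t^-1)) ^+ 2.
Proof.
move=> t0 ur; have [n rn] := seq_sub_box r.
pose F m : R := m.+1%:R `^ (- 1 - t).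
have F0 m : 0 <= F m by exact: powR_ge0.
apply: (@le_trans _ _ (\sum_(xi <- box n) F `|xi.1|%N * F `|xi.2|%N)).
  apply: (@le_trans _ _ (\sum_(xi <- r) F `|xi.1|%N * F `|xi.2|%N)); last first.
    by apply: ler_sum_sub; rewrite ?box_uniq // => xi; rewrite mulr_ge0.
  apply: ler_sum => xi _; rewrite /F -powRM //.
  have p0 : 0 < `|xi.1|.+1%:R * `|xi.2|.+1%:R :> R by rewrite mulr_gt0 ?ltr0n.
  have -> : - 1 - t = - (1 + t) by ring.
  rewrite !powRN lef_pV2 ?posrE ?powR_gt0 ?symbol_gt0 //.
  rewrite ge0_ler_powR ?nnegrE ?(ltW p0) ?(ltW (symbol_gt0 _)) //; first by lra.
  by have := symbol_ge xi; rewrite -!nat1r.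
rewrite /box big_allpairs_dep /= expr2.
under eq_bigr do rewrite -mulr_sumr; rewrite -mulr_suml.
have h : \sum_(i <- zrange n) F `|i|%N <= 2 * (1 + t^-1).
  by rewrite (le_trans (sum_zrange n F0)) // ler_wpM2l // sum_powR_le.
by apply: ler_pM => //; rewrite sumr_ge0.
Qed.

Lemma sobolev_sum_le k f r (q : R) : (sobolev_norm_sq k f <= q%:E)%E -> uniq r ->
  \sum_(xi <- r) symbol xi `^ k * (cos_coef f xi ^+ 2 + sin_coef f xi ^+ 2) <= q.
Proof.
move=> fq ur; rewrite -lee_fin; apply: le_trans fq.
apply: esum_ge; exists [set` r].
  by split=> //; exact: finite_seq.
by rewrite -fsbig_seq // -sumEFin.
Qed.

(** Cauchy-Schwarz in additive form, with [symbol] to the power s split as its powers k / 2 and (- 1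
    - t) / 2. The exponent exceeds 3/2, which leaves room for three derivatives. The parameter e
    stays free, so that a small Sobolev norm can give a small bound. *)
Lemma sobolev_weighted_le k f (q e : R) : 4 < k -> 0 < e ->
  (sobolev_norm_sq k f <= q%:E)%E ->
  weighted_le (3 / 2 + (k - 4) / 4) (cos_coef f) (sin_coef f)
    (q / e + e * (2 * (1 + ((k - 4) / 2)^-1)) ^+ 2).
Proof.
move=> k4 e0 fq r ur; set t : R := (k - 4) / 2; set s := 3 / 2 + _.
have t0 : 0 < t by rewrite divr_gt0 // subr_gt0.
have h1 := sobolev_sum_le fq ur; have h2 := sum_symbol_le t0 ur.
apply: (@le_trans _ _ (\sum_(xi <- r) ((symbol xi `^ k *
    (cos_coef f xi ^+ 2 + sin_coef f xi ^+ 2)) / e + e * symbol xi `^ (- 1 - t)))).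
  apply: ler_sum => xi _; set A := cos_coef _ _; set B := sin_coef _ _.
  set w := symbol xi; have w0 : 0 < w by exact: symbol_gt0.
  have wn0 : w != 0 by rewrite gt_eqF.
  set a := w `^ (k / 2); set b := w `^ ((- 1 - t) / 2).
  have -> : w `^ s = a * b.
    by rewrite -powRD ?wn0 ?implybT //; congr (_ `^ _); rewrite /s /t; field.
  have -> : w `^ k = a ^+ 2.
    by rewrite expr2 -powRD ?wn0 ?implybT //; congr (_ `^ _); field.
  have -> : w `^ (- 1 - t) = b ^+ 2.
    by rewrite expr2 -powRD ?wn0 ?implybT //; congr (_ `^ _); field.
  have a0 : 0 <= a by exact: powR_ge0.
  have b0 : 0 <= b by exact: powR_ge0.
  rewrite -(real_normK (num_real A)) -(real_normK (num_real B)).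
  have A0 := normr_ge0 A; have B0 := normr_ge0 B.
  move: A0 B0; set x := `|A|; set y := `|B| => x0 y0.
  rewrite -subr_ge0.
  have -> : a ^+ 2 * (x ^+ 2 + y ^+ 2) / e + e * b ^+ 2 - a * b * (x + y) =
     ((a * x - e * b / 2) ^+ 2 + (a * y - e * b / 2) ^+ 2 + e ^+ 2 * b ^+ 2 / 2) / e.
    by field; rewrite gt_eqF.
  by rewrite divr_ge0 ?(ltW e0) // !addr_ge0 ?sqr_ge0 // divr_ge0 // mulr_ge0 ?sqr_ge0.
rewrite big_split /= -mulr_suml -mulr_sumr lerD //.
  by rewrite ler_pM2r ?invr_gt0.
by rewrite ler_pM2l.
Qed.

Lemma sobolev_norm_ge0 k f : (0 <= sobolev_norm_sq k f)%E.
Proof.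
apply: esum_ge0 => xi _; rewrite lee_fin mulr_ge0 ?powR_ge0 //.
by rewrite addr_ge0 ?sqr_ge0.
Qed.

Lemma sobolev_trig_series k f : 4 < k -> sobolev k f ->
  f = trig_series (cos_coef f) (sin_coef f) /\
  exists C, weighted_le (3 / 2 + (k - 4) / 4) (cos_coef f) (sin_coef f) C.
Proof.
move=> k4 [pf cf fk].
have fin : sobolev_norm_sq k f \is a fin_num by rewrite ge0_fin_numE ?sobolev_norm_ge0.
have fq : (sobolev_norm_sq k f <= (fine (sobolev_norm_sq k f))%:E)%E by rewrite fineK.
have H := sobolev_weighted_le k4 ltr01 fq.
split; last by eexists; exact: H.
apply: (fourier_inversion pf cf _ H).
by rewrite addr_gt0 ?divr_gt0 // subr_gt0.
Qed.

Lemma sobolev_C3 k f : 4 < k -> sobolev k f -> Cn 3 f.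
Proof.
move=> k4 fk; have [E [C H]] := sobolev_trig_series k4 fk; rewrite E.
by apply: (trig_series_Cn _ H); lra.
Qed.

Lemma partial_trig_series s A B C (j : 'I_2) : 1 / 2 < s -> weighted_le s A B C ->
  partial j (trig_series A B) = trig_series (fun xi => B xi * dot xi (basis2 R j))
    (fun xi => - (A xi * dot xi (basis2 R j))).
Proof.
by move=> s2 H; apply/funext => p; have [_ <-] := is_derive_trig_series p (basis2 R j) s2 H.
Qed.

Lemma sobolev_partialC k f (i j : 'I_2) : 4 < k -> sobolev k f ->
  partial i (partial j f) = partial j (partial i f).
Proof.
move=> k4 fk; have [E [C H]] := sobolev_trig_series k4 fk; rewrite E.
have s2 : 1 / 2 < 3 / 2 + (k - 4) / 4 by lra.
have s2' : 1 / 2 < 3 / 2 + (k - 4) / 4 - 1 / 2 by lra.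
rewrite !(partial_trig_series _ s2 H) !(partial_trig_series _ s2' (weighted_le_derive _ H)).
by congr trig_series; apply/funext => xi; rewrite ?mulNr mulrAC.
Qed.

Fixpoint Cn_bound (n : nat) (e : R) f : Prop :=
  (forall p, `|f p| <= e) /\
  if n is m.+1 then forall j, Cn_bound m e (partial j f) else True.

Lemma trig_series_bound m s A B C : m%:R / 2 < s -> weighted_le s A B C ->
  Cn_bound m C (trig_series A B).
Proof.
elim: m s A B => [|m IH] s A B sm H.
  by split=> // p; apply: (trig_series_norm_le p _ H); lra.
have m0 := ler0n R m; have s0 : 1 / 2 < s by move: sm; rewrite -natr1; lra.
split=> [p|j]; first by apply: (trig_series_norm_le p _ H); lra.
rewrite (partial_trig_series _ s0 H); apply: IH (_ : m%:R / 2 < s - 1 / 2) _.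
  by move: sm; rewrite -natr1; lra.
have := weighted_le_derive (basis2 R j) H.
have -> : `|(basis2 R j).1| + `|(basis2 R j).2| = 1.
  by rewrite /basis2; case: ifP => _ /=; rewrite normr0 normr1 ?addr0 ?add0r.
by rewrite (mul1r C).
Qed.

(** Applied to differences of u at two times, it turns continuity in H^k into continuity in time of
    all derivatives up to order 3, uniformly in space. *)
Lemma sobolev_small k (e : R) : 4 < k -> 0 < e -> exists2 d, 0 < d &
  forall f, sobolev k f -> (sobolev_norm_sq k f <= d%:E)%E -> Cn_bound 3 e f.
Proof.
move=> k4 e0; pose L : R := (2 * (1 + ((k - 4) / 2)^-1)) ^+ 2.
have L0 : 0 < L.
  by rewrite exprn_gt0 // mulr_gt0 // ltr_wpDr // invr_ge0 divr_ge0 // subr_ge0 ltW.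
(* [h] is the free parameter of [sobolev_weighted_le]: h * L is e / 2, and the choice of d makes the
   other term e / 2 as well. *)
pose h := e / (2 * L); have h0 : 0 < h by rewrite divr_gt0 // mulr_gt0.
exists (e * h / 2); first by rewrite divr_gt0 // mulr_gt0.
move=> f fk fd; have [E _] := sobolev_trig_series k4 fk.
have := sobolev_weighted_le k4 h0 fd; rewrite -/L.
have -> : e * h / 2 / h + h * L = e by rewrite /h; field; rewrite !gt_eqF.
by move=> H; rewrite E; apply: (trig_series_bound _ H); lra.
Qed.

(** Continuity of the partial derivatives is what makes this work: the step h v is split into a
    vertical and a horizontal segment, with the mean value theorem on each. *)
Lemma is_derive_dir f p v : Cn 1 f ->
  is_derive p v f (v.1 * partial 0 f p + v.2 * partial 1 f p).
Proof.
move=> Cf; apply: is_derive_pt; apply/is_derive_epsP => e e0.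
set M := `|v.1| + `|v.2| + 1; have M0 : 0 < M by rewrite ltr_wpDl ?addr_ge0.
have eM : 0 < e / M by rewrite divr_gt0.
have cont j := Cn_continuous (Cn_partial j Cf).
have /cvgrPdist_le/(_ _ eM)/nbhs_ballP[d0 /= d00 H0] := cont 0 p.
have /cvgrPdist_le/(_ _ eM)/nbhs_ballP[d1 /= d10 H1] := cont 1 p.
exists (Num.min d0 d1 / M); first by rewrite divr_gt0 // lt_min d00.
move=> h; rewrite ltr_pdivlMr // => hd.
have near_p a b : `|a| <= `|h * v.1| -> `|b| <= `|h * v.2| ->
    `|partial 0 f p - partial 0 f (p.1 + a, p.2 + b)| <= e / M /\
    `|partial 1 f p - partial 1 f (p.1 + a, p.2 + b)| <= e / M.
  rewrite !normrM => ha hb.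
  have v1 := normr_ge0 v.1; have v2 := normr_ge0 v.2; have hh := normr_ge0 h.
  have a1 : `|a| < Num.min d0 d1 by apply: le_lt_trans hd; rewrite /M; nra.
  have b1 : `|b| < Num.min d0 d1 by apply: le_lt_trans hd; rewrite /M; nra.
  have := a1; have := b1; rewrite !lt_min => /andP[b2 b3] /andP[a2 a3].
  by split; [apply: H0|apply: H1]; split; rewrite /ball /= opprD addNKr normrN.
have seg (g dg : R -> R) (a : R) : (forall x, is_derive x (1 : R) g (dg x)) ->
    exists2 c, `|c| <= `|a| & g a - g 0 = dg c * a.
  move=> dgE; case: (ltrgt0P a) => [a0|a0|->].
  - have cg : {within `[0, a], continuous g}.
      by apply: continuous_subspaceT => z; exact: is_derive_continuous (dgE z).
    have [c /andP[c0 ca] ->] := mean_value a0 (fun z _ => dgE z) cg.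
    by exists c; rewrite ?subr0 // !ger0_norm ?ltW.
  - have cg : {within `[a, 0], continuous g}.
      by apply: continuous_subspaceT => z; exact: is_derive_continuous (dgE z).
    have [c /andP[c0 ca] E] := mean_value a0 (fun z _ => dgE z) cg.
    exists c; first by rewrite !ltr0_norm // lerN2 ltW.
    by rewrite -opprB E; ring.
  - by exists 0; rewrite ?normr0 ?lexx ?mulr0 ?subrr.
have line q (j : 'I_2) (x : R) : is_derive x (1 : R) (fun x : R => f (q + x *: basis2 R j))
    (partial j f (q + x *: basis2 R j)).
  by apply: is_derive_line; exact: Cn_derive Cf.
have E (a b : R) : p + b *: basis2 R 1 + a *: basis2 R 0 = (p.1 + a, p.2 + b).
  rewrite /basis2 /=; congr pair; rewrite /= ?scaler0 ?[_%:A]mulr1 ?addr0 //.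
have [c1 c1h] := seg _ _ (h * v.1) (line (p + (h * v.2) *: basis2 R 1) 0).
rewrite !E !addr0 => E1.
have [c2 c2h] := seg _ _ (h * v.2) (line p 1).
have E' (b : R) : p + b *: basis2 R 1 = (p.1, p.2 + b).
  by have := E 0 b; rewrite scale0r !addr0.
rewrite !E' addr0 -surjective_pairing => E2.
have [k1 _] := near_p c1 (h * v.2) c1h (lexx _).
have z0 : `|0 : R| <= `|h * v.1| by rewrite normr0.
have [_ k2] := near_p 0 c2 z0 c2h; rewrite addr0 in k2.
rewrite add0r scale0r addr0.
have -> : p + h *: v = (p.1 + h * v.1, p.2 + h * v.2) by [].
have -> : f (p.1 + h * v.1, p.2 + h * v.2) - f p -
    h * (v.1 * partial 0 f p + v.2 * partial 1 f p) =
  - (partial 0 f p - partial 0 f (p.1 + c1, p.2 + h * v.2)) * (h * v.1)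
  - (partial 1 f p - partial 1 f (p.1, p.2 + c2)) * (h * v.2).
  by rewrite -[f _ - f p](subrKA (f (p.1, p.2 + h * v.2))) E1 E2; ring.
apply: (le_trans (ler_normB _ _)); rewrite !normrM normrN.
move: k1 k2; set A := `|_ - _|; set B := `|partial 1 f p - _| => k1 k2.
have -> : e * `|h| = e / M * (`|h| * M) by field; rewrite gt_eqF.
have hh := normr_ge0 h.
apply: (@le_trans _ _ (e / M * (`|h| * `|v.1|) + e / M * (`|h| * `|v.2|))).
  by rewrite lerD // ler_wpM2r // mulr_ge0.
by rewrite -mulrDr ler_wpM2l ?(ltW eM) // -mulrDr ler_wpM2l // /M lerDl.
Qed.

End SobolevEmbedding.

(** * Families of functions depending on time *)

Section TimeDependent.
Context {R : realType}.
Implicit Types (f g : R -> R * R -> R) (p q : R * R) (t : R) (n : nat).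

(** Continuity in time for the supremum norm in space. Only nonnegative times are compared, so that
    it is one-sided at t = 0, where the solution starts. *)
Definition time_continuous g := forall t e, 0 <= t -> 0 < e -> exists2 d, 0 < d &
  forall s, 0 <= s -> `|s - t| < d -> forall p, `|g s p - g t p| <= e.

Definition admissible g := (forall t, 0 <= t -> Cn 0 (g t)) /\ time_continuous g.

Fixpoint Cn_time n g : Prop := admissible g /\
  if n is m.+1 then forall j, Cn_time m (fun t => partial j (g t)) else True.

Lemma admissible_periodic g t : admissible g -> 0 <= t -> periodic2 (g t).
Proof. by move=> [H _] /H /Cn_periodic. Qed.

Lemma admissible_continuous g t : admissible g -> 0 <= t -> continuous (g t).
Proof. by move=> [H _] /H /Cn_continuous. Qed.

Lemma admissible_bounded g t : admissible g -> 0 <= t ->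
  exists2 M, 0 <= M & forall p, `|g t p| <= M.
Proof.
move=> ag t0; apply: periodic_bounded.
  exact: admissible_periodic.
exact: admissible_continuous.
Qed.

Lemma eq_admissible f g : (forall t, 0 <= t -> f t = g t) -> admissible f -> admissible g.
Proof.
move=> E [C U]; split=> [t t0|t e t0 e0]; first by rewrite -E //; exact: C.
have [d d0 H] := U t e t0 e0; exists d => // s s0 st p.
by rewrite -!E //; exact: H.
Qed.

Lemma admissibleD f g : admissible f -> admissible g ->
  admissible (fun t p => f t p + g t p).
Proof.
move=> [Cf Uf] [Cg Ug]; split=> [t t0|t e t0 e0].
  by apply: CnD; [exact: Cf|exact: Cg].
have e2 : 0 < e / 2 by rewrite divr_gt0.
have [d d0 H] := Uf t _ t0 e2; have [d' d'0 H'] := Ug t _ t0 e2.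
exists (Num.min d d'); first by rewrite lt_min d0.
move=> s s0; rewrite lt_min => /andP[/(H s s0) {}H /(H' s s0) {}H'] p.
have -> : f s p + g s p - (f t p + g t p) = (f s p - f t p) + (g s p - g t p) by ring.
by rewrite (le_trans (ler_normD _ _)) //; have := H p; have := H' p; lra.
Qed.

Lemma admissibleM f g : admissible f -> admissible g ->
  admissible (fun t p => f t p * g t p).
Proof.
move=> af ag; have [Cf Uf] := af; have [Cg Ug] := ag; split=> [t t0|t e t0 e0].
  by apply: CnM; [exact: Cf|exact: Cg].
have [Mf Mf0 HMf] := admissible_bounded af t0.
have [Mg Mg0 HMg] := admissible_bounded ag t0.
have e1 : 0 < e / (2 * (Mg + 1)) by rewrite divr_gt0 // mulr_gt0 // ltr_wpDl.
(* The minimum with 1 bounds g s by Mg + 1 for s near t. *)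
have e2 : 0 < Num.min 1 (e / (2 * (Mf + 1))).
  by rewrite lt_min ltr01 divr_gt0 // mulr_gt0 // ltr_wpDl.
have [d d0 H] := Uf t _ t0 e1; have [d' d'0 H'] := Ug t _ t0 e2.
exists (Num.min d d'); first by rewrite lt_min d0.
move=> s s0; rewrite lt_min => /andP[/(H s s0) {}H /(H' s s0) {}H'] p.
have := H' p; rewrite le_min => /andP[h1 h2].
have gs : `|g s p| <= Mg + 1.
  have -> : g s p = g t p + (g s p - g t p) by ring.
  by rewrite (le_trans (ler_normD _ _)) // lerD.
have -> : f s p * g s p - f t p * g t p =
  (f s p - f t p) * g s p + f t p * (g s p - g t p) by ring.
rewrite (le_trans (ler_normD _ _)) // !normrM.
have k1 : `|f s p - f t p| * `|g s p| <= e / (2 * (Mg + 1)) * (Mg + 1) by exact: ler_pM.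
have k2 : `|f t p| * `|g s p - g t p| <= (Mf + 1) * (e / (2 * (Mf + 1))).
  by apply: ler_pM => //; rewrite (le_trans (HMf p)) // lerDl.
have E1 : e / (2 * (Mg + 1)) * (Mg + 1) = e / 2 by field; lra.
have E2 : (Mf + 1) * (e / (2 * (Mf + 1))) = e / 2 by field; lra.
by move: k1 k2; rewrite E1 E2; lra.
Qed.

Lemma admissible_stationary (f : R * R -> R) : Cn 0 f -> admissible (fun=> f).
Proof.
by move=> Cf; split=> // t e t0 e0; exists 1 => // s _ _ p; rewrite subrr normr0 ltW.
Qed.

Lemma admissibleZ (a : R) g : admissible g -> admissible (fun t p => a * g t p).
Proof.
apply: (@admissibleM (fun _ _ => a)).
exact: (admissible_stationary (proj1 (Cn_cst 0 a))).
Qed.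

Lemma admissibleN g : admissible g -> admissible (fun t p => - g t p).
Proof.
move=> /(admissibleZ (-1)); apply: eq_admissible => t _.
by apply/funext => p; rewrite mulN1r.
Qed.

Lemma admissibleB f g : admissible f -> admissible g ->
  admissible (fun t p => f t p - g t p).
Proof. by move=> af ag; apply: admissibleD => //; exact: admissibleN. Qed.

Lemma admissible_shift q g : admissible g -> admissible (fun t p => g t (p + q)).
Proof.
move=> [C U]; split=> [t t0|t e t0 e0]; first exact/Cn_shift/C.
by have [d d0 H] := U t e t0 e0; exists d => // s s0 st p; exact: H.
Qed.

Lemma admissible_sum (I : Type) (r : seq I) (F : I -> R -> R * R -> R) :
  (forall i, admissible (F i)) -> admissible (fun t p => \sum_(i <- r) F i t p).
Proof.
move=> aF; elim: r => [|i r IH].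
  apply: eq_admissible (admissible_stationary (proj1 (Cn_cst 0 0))) => t _.
  by apply/funext => p; rewrite big_nil.
apply: eq_admissible (admissibleD (aF i) IH) => t _.
by apply/funext => p; rewrite big_cons.
Qed.

(** The supremum of the t such that P holds on [a, t] belongs to this set by the left-limit
    hypothesis, and by the other one it cannot be smaller than b. *)
Lemma real_induction (P : R -> Prop) (a b : R) : a <= b -> P a ->
  (forall t, a <= t < b -> P t -> exists2 d, 0 < d & forall s, t <= s < t + d -> P s) ->
  (forall t, a < t <= b -> (forall s, a <= s < t -> P s) -> P t) ->
  forall t, a <= t <= b -> P t.
Proof.
move=> ab Pa Pright Pleft.
pose S := [set t | a <= t <= b /\ forall s, a <= s <= t -> P s].
have Sa : S a by split; [rewrite lexx|move=> s; rewrite -eq_le => /eqP <-].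
have ubS : has_ubound S by exists b => t [/andP[]].
have supS : has_sup S by split=> //; exists a.
set c := sup S.
have ac : a <= c by exact: ub_le_sup.
have cb : c <= b by apply: ge_sup => //; [exists a|move=> t [/andP[]]].
have Plt s : a <= s < c -> P s.
  move=> /andP[as_ sc]; have cs : 0 < c - s by rewrite subr_gt0.
  have [t [_ Ht]] := sup_adherent cs supS; rewrite subKr => st.
  by apply: Ht; rewrite as_ ltW.
have Pc : P c.
  have [<-//|ca] := eqVneq a c; apply: Pleft => [|s sc]; last exact: Plt.
  by rewrite cb lt_neqAle ca ac.
have Pcc s : a <= s <= c -> P s.
  move=> /andP[as_]; rewrite le_eqVlt => /predU1P[->//|sc].
  by apply: Plt; rewrite as_.
have cbE : c = b.
  apply/eqP; rewrite eq_le cb leNgt; apply/negP => cltb.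
  have [d d0 Hd] := Pright c (introT andP (conj ac cltb)) Pc.
  pose s := Num.min b (c + d / 2).
  have sb : s <= b by rewrite ge_min lexx.
  have sd : s <= c + d / 2 by rewrite ge_min lexx orbT.
  have cs : c < s by rewrite lt_min cltb ltrDl divr_gt0.
  suff : S s by move=> /(ub_le_sup ubS); rewrite leNgt cs.
  split; first by rewrite sb (le_trans ac) ?ltW.
  move=> r /andP[ar rs]; case: (leP r c) => rc; first by apply: Pcc; rewrite ar.
  by apply: Hd; rewrite ltW //=; lra.
by move=> t; rewrite -cbE; exact: Pcc.
Qed.

(** The bound near each single time is propagated by real induction, which plays the part of the
    compactness of [0, T]. *)
Lemma admissible_bounded_time g T : admissible g -> 0 <= T ->
  exists2 M, 0 <= M & forall t p, 0 <= t <= T -> `|g t p| <= M.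
Proof.
move=> ag T0; have [Cg Ug] := ag.
suff [M HM] : exists M, forall s p, 0 <= s <= T -> `|g s p| <= M.
  by exists M => //; apply: le_trans (HM 0 0 _); rewrite ?lexx ?normr_ge0.
have TT : 0 <= T <= T by rewrite T0 lexx.
have loc t : 0 <= t -> exists2 d, 0 < d & exists M, forall s p, 0 <= s -> `|s - t| < d -> `|g s p| <= M.
  move=> t0; have [d d0 H] := Ug t 1 t0 ltr01; have [M _ HM] := admissible_bounded ag t0.
  exists d => //; exists (M + 1) => s p s0 st.
  have -> : g s p = g t p + (g s p - g t p) by ring.
  by rewrite (le_trans (ler_normD _ _)) // lerD // H.
suff /(_ T TT) : forall t, 0 <= t <= T ->
    exists M, forall s p, 0 <= s <= t -> `|g s p| <= M by [].
apply: real_induction => //.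
- have [M _ HM] := admissible_bounded ag (lexx 0); exists M => s p.
  by rewrite -eq_le => /eqP <-.
- move=> t /andP[t0 _] [M HM]; have [d d0 [M' HM']] := loc t t0.
  exists d => // s /andP[ts sd]; exists (Num.max M M') => r p /andP[r0 rs].
  rewrite le_max; case: (leP r t) => rt; first by rewrite HM ?r0.
  by rewrite HM' ?orbT // ger0_norm ?subr_ge0 ?ltW //; lra.
- move=> t /andP[t0 _] H; have [d d0 [M' HM']] := loc t (ltW t0).
  pose s := Num.max 0 (t - d / 2).
  have s0 : 0 <= s by rewrite le_max lexx.
  have sd : t - d / 2 <= s by rewrite le_max lexx orbT.
  have st : s < t by rewrite gt_max t0; lra.
  have [M HM] := H s (introT andP (conj s0 st)).
  exists (Num.max M M') => r p /andP[r0 rt].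
  rewrite le_max; case: (leP r s) => rs; first by rewrite HM ?r0.
  rewrite HM' ?orbT // distrC ger0_norm ?subr_ge0 //; lra.
Qed.

(** Parametrising the segment by [0, 1] treats increments of either sign at once, and the derivative
    is required only near a, as it exists for positive times only. *)
Lemma mean_value_increment (F G : R -> R) (a d x : R) :
  (forall y, `|y - a| < d -> is_derive y (1 : R) F (G y)) -> `|x| < d ->
  exists2 c, `|c - a| <= `|x| & F (a + x) - F a = G c * x.
Proof.
move=> dF xd; have near01 (y : R) : 0 <= y <= 1 -> `|(a + y * x) - a| <= `|x|.
  by move=> /andP[y0 y1]; rewrite addrAC subrr add0r normrM ger0_norm // ler_piMl.
have dFx (y : R) : 0 <= y <= 1 ->
    is_derive y (1 : R) (fun y : R => F (a + y * x)) (G (a + y * x) * x).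
  move=> y01; have dFy := dF _ (le_lt_trans (near01 y y01) xd).
  have dl : is_derive y (1 : R) (fun y : R => a + y * x) x.
    by apply: is_derive_eq; rewrite /GRing.scale /=; ring.
  exact: (@is_derive1_comp _ F (fun y : R => a + y * x)).
have c01 : {within `[0, 1], continuous (fun y : R => F (a + y * x))}.
  apply: continuous_in_subspaceT => y; rewrite inE /= in_itv /= => /dFx.
  exact: is_derive_continuous.
have dFx' (y : R) : 0 < y < 1 ->
    is_derive y (1 : R) (fun y : R => F (a + y * x)) (G (a + y * x) * x).
  by move=> /andP[/ltW y0 /ltW y1]; apply: dFx; rewrite y0.
have [c /andP[/ltW c0 /ltW c1]] := mean_value ltr01 dFx' c01.
rewrite mul1r mul0r addr0 subr0 mulr1 => E.
by exists (a + c * x) => //; apply: near01; rewrite c0.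
Qed.

(* Uniformly in p, because the time derivative is continuous in time uniformly in p. *)
Lemma uniform_time_derivative g (b : R -> R * R -> R) t (e : R) :
  (forall s : R, 0 < s -> forall p, is_derive s (1 : R) (fun s => g s p) (b s p)) ->
  admissible b -> 0 < t -> 0 < e -> exists2 d, 0 < d <= t &
  forall h : R, `|h| < d -> forall p, `|g (t + h) p - g t p - h * b t p| <= e * `|h|.
Proof.
move=> dg [_ Ub] t0 e0; have [d d0 H] := Ub t e (ltW t0) e0.
exists (Num.min d t); first by rewrite lt_min d0 t0 ge_min lexx orbT.
move=> h hd p.
have pos s : `|s - t| < Num.min d t -> 0 < s.
  by rewrite lt_min => /andP[_]; rewrite ltr_norml => /andP[? _]; lra.
have [s sh ->] := @mean_value_increment (fun s => g s p) (fun s => b s p) t _ h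
  (fun s ts => dg s (pos s ts) p) hd.
have st := le_lt_trans sh hd.
have -> : b s p * h - h * b t p = (b s p - b t p) * h by ring.
rewrite normrM ler_wpM2r // H ?(ltW (pos s st)) //.
by move: st; rewrite lt_min => /andP[].
Qed.

Lemma Cn_timeP n g : (forall t, 0 <= t -> Cn n (g t)) ->
  (forall t e, 0 <= t -> 0 < e -> exists2 d, 0 < d &
    forall s, 0 <= s -> `|s - t| < d -> Cn_bound n e (fun p => g s p - g t p)) ->
  Cn_time n g.
Proof.
elim: n g => [|n IH] g Cg Bg.
  split=> //; split=> // t e t0 e0.
  by have [d d0 H] := Bg t e t0 e0; exists d => // s s0 st p; have [h _] := H s s0 st; exact: h.
split=> [|j].
  split=> [t t0|t e t0 e0]; first exact: Cn_le (leq0n _) (Cg t t0).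
  by have [d d0 H] := Bg t e t0 e0; exists d => // s s0 st p; have [h _] := H s s0 st; exact: h.
apply: IH => [t t0|t e t0 e0]; first exact: Cn_partial (Cg t t0).
have [d d0 H] := Bg t e t0 e0; exists d => // s s0 st.
by have [_ /(_ j)] := H s s0 st; rewrite (partialB j (Cg s s0) (Cg t t0)).
Qed.

Lemma Cn_time_admissible n g : Cn_time n g -> admissible g.
Proof. by case: n => [|n] []. Qed.

Lemma Cn_time_partial n g j : Cn_time n.+1 g -> Cn_time n (fun t => partial j (g t)).
Proof. by case=> _; apply. Qed.

Lemma continuous_sobolev_C3 (k : R) (u : R -> 'I_2 -> R * R -> R) (i : 'I_2) : 4 < k ->
  (forall T : R, 0 < T -> continuous_sobolev k T u) ->
  [/\ forall t, 0 <= t -> Cn 3 (u t i), Cn_time 3 (fun t => u t i) &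
    forall t (j l : 'I_2), 0 <= t ->
      partial j (partial l (u t i)) = partial l (partial j (u t i))].
Proof.
move=> k4 H.
have sob t : 0 <= t -> sobolev k (u t i).
  move=> t0; have t1 : 0 < t + 1 by lra.
  have tI : t \in `[0, t + 1] by rewrite in_itv /= t0 lerDl ler01.
  by have [] := H _ t1 t tI i.
have C3 t : 0 <= t -> Cn 3 (u t i) by move=> /sob; exact: sobolev_C3.
split; [exact: C3| |by move=> t j l t0; apply: sobolev_partialC k4 (sob t t0)].
apply: (Cn_timeP C3) => t e t0 e0.
have [d d0 Hd] := sobolev_small k4 e0.
have t1 : 0 < t + 1 by lra.
have tI : t \in `[0, t + 1] by rewrite in_itv /= t0 lerDl ler01.
have [_ cv] := H _ t1 t tI i.
have : \forall s \near within `[0, t + 1]%classic (nbhs t),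
    (sobolev_norm_sq k (fun p => (u s i p - u t i p)%R) < d%:E)%E.
  have N : nbhs (0%E : \bar R) (fun x => (x < d%:E)%E).
    by apply: open_ereal_lt'; rewrite lte_fin.
  exact: (cv _ N).
rewrite near_withinE => /nbhs_ballP[r /= r0 Hr].
(* The bound 1 keeps s inside [0, t + 1], the interval on which the continuity in H^k is applied. *)
exists (Num.min r 1); first by rewrite lt_min r0 ltr01.
move=> s s0; rewrite lt_min => /andP[sr s1].
have sI : s \in `[0, t + 1].
  by rewrite in_itv /= s0; move: s1; rewrite ltr_norml => /andP[_ ?]; lra.
have small := Hr s; rewrite /ball /= distrC in small.
have {}small := small sr sI; apply: Hd; last exact: ltW.
split.
- move=> p; have := Cn_periodic (C3 s s0) p; have := Cn_periodic (C3 t t0) p.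
  by move=> [? ?] [? ?]; split; congruence.
- by move=> p; apply: cvgB; [exact: Cn_continuous (C3 s s0) p|exact: Cn_continuous (C3 t t0) p].
- exact: lt_trans small (ltry _).
Qed.

Lemma Cn_bound_time n g T : Cn_time n g -> 0 <= T ->
  exists2 M, 0 <= M & forall t, 0 <= t <= T -> Cn_bound n M (g t).
Proof.
elim: n g => [|n IH] g [ag dg] T0.
  have [M M0 H] := admissible_bounded_time ag T0.
  by exists M => // t tT; split=> // p; exact: H.
have [M M0 H] := admissible_bounded_time ag T0.
have [M1 M10 H1] := IH _ (dg 0) T0; have [M2 M20 H2] := IH _ (dg 1) T0.
have mono m (a b : R) (f : R * R -> R) : a <= b -> Cn_bound m a f -> Cn_bound m b f.
  move=> ab; elim: m f => [|m IHm] f [h1 h2].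
    by split=> // p; exact: le_trans (h1 p) ab.
  by split=> [p|j]; [exact: le_trans (h1 p) ab|exact: IHm (h2 j)].
exists (M + M1 + M2); first by rewrite !addr_ge0.
move=> t tT; split=> [p|j]; first by apply: le_trans (H t p tT) _; lra.
have [->|->] : j = 0 \/ j = 1.
  by case: j => [[|[|//]]] ?; [left|right]; apply/val_inj.
- by apply: mono (H1 t tT); lra.
- by apply: mono (H2 t tT); lra.
Qed.

End TimeDependent.

(** * Energy *)

Section Energy.
Context {R : realType}.
Implicit Types (f g : R * R -> R) (v m phi z : 'I_2 -> R * R -> R) (p : R * R) (i j l : 'I_2).

Definition helmholtz f p : R := f p - \sum_(j < 2) partial j (partial j f) p.

Definition grad_dot f g p : R := f p * g p + \sum_(j < 2) partial j f p * partial j g p.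

(* (u . nabla) m + (nabla u)^T m + m div u *)
Definition transport v m i p : R :=
  \sum_(j < 2) v j p * partial j (m i) p + \sum_(j < 2) m j p * partial i (v j) p
  + m i p * \sum_(j < 2) partial j (v j) p.

(** The Lie bracket [phi, v] of vector fields; [transport] is the coadjoint action dual to it. *)
Definition bracket phi v i p : R :=
  \sum_(j < 2) (phi j p * partial j (v i) p - v j p * partial j (phi i) p).

Lemma partial_sum n (I : Type) (r : seq I) (F : I -> R * R -> R) j :
  (forall x, Cn n.+1 (F x)) ->
  partial j (fun p => \sum_(x <- r) F x p) = fun p => \sum_(x <- r) partial j (F x) p.
Proof.
move=> CF; elim: r => [|x r IH].
  under eq_fun do rewrite big_nil.
  by rewrite (proj2 (Cn_cst n.+1 0)); apply/funext => p; rewrite big_nil.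
have -> : (fun p => \sum_(y <- x :: r) F y p) = (fun p => F x p + \sum_(y <- r) F y p).
  by apply/funext => p; rewrite big_cons.
rewrite (partialD j (CF x) (Cn_sum r CF)) IH.
by apply/funext => p; rewrite big_cons.
Qed.

Lemma torus_integralB f g : continuous f -> continuous g ->
  torus_integral (fun p => f p - g p) = torus_integral f - torus_integral g.
Proof.
move=> cf cg.
have -> : (fun p => f p - g p) = (fun p => f p + -1 * g p).
  by apply/funext => p; rewrite mulN1r.
rewrite torus_integralD // ?torus_integralZ ?mulN1r //.
by apply: continuous_mul => // p; exact: cvg_cst.
Qed.

Lemma torus_integral_norm_le f (M : R) : continuous f -> (forall p, `|f p| <= M) ->
  `|torus_integral f| <= M.
Proof.
move=> cf fM; rewrite ler_norml -[M]torus_integral_cst -[X in X <= _](torus_integral_cst (- _)).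
have cc (a : R) : continuous (fun _ : R * R => a) by move=> p; exact: cvg_cst.
rewrite !torus_integral_cst -{1}[- M]torus_integral_cst -{2}[M]torus_integral_cst.
by apply/andP; split; apply: le_torus_integral => // p; have := fM p; rewrite ler_norml => /andP[].
Qed.

Lemma torus_integral_parts f g j : Cn 1 f -> Cn 1 g ->
  torus_integral (fun p => f p * partial j g p) = - torus_integral (fun p => g p * partial j f p).
Proof.
move=> Cf Cg; apply/eqP; rewrite -addr_eq0 -torus_integralD; first last.
- exact: continuous_mul (Cn_continuous Cg) (Cn_continuous (Cn_partial j Cf)).
- exact: continuous_mul (Cn_continuous Cf) (Cn_continuous (Cn_partial j Cg)).
by rewrite -(partialM j Cf Cg) torus_integral_partial //; exact: CnM.
Qed.

Lemma helmholtz_Cn n f : Cn n.+2 f -> Cn n (helmholtz f).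
Proof.
move=> Cf; apply: CnB; first exact: CnS (CnS Cf).
by apply: Cn_sum => j; do 2 apply: Cn_partial.
Qed.

Lemma helmholtzB n f g : Cn n.+2 f -> Cn n.+2 g ->
  helmholtz (fun p => f p - g p) = fun p => helmholtz f p - helmholtz g p.
Proof.
move=> Cf Cg; apply/funext => p; rewrite /helmholtz.
have E j : partial j (partial j (fun p => f p - g p)) p =
    partial j (partial j f) p - partial j (partial j g) p.
  by rewrite (partialB j Cf Cg) (partialB j (Cn_partial j Cf) (Cn_partial j Cg)).
by under eq_bigr do rewrite E; rewrite sumrB; ring.
Qed.

Lemma grad_dot_Cn n f g : Cn n.+1 f -> Cn n.+1 g -> Cn n (grad_dot f g).
Proof.
move=> Cf Cg; apply: CnD; first by apply: CnM; exact: CnS.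
by apply: Cn_sum => j; apply: CnM; exact: Cn_partial.
Qed.

Lemma helmholtz_dual f g : Cn 1 f -> Cn 2 g ->
  torus_integral (fun p => f p * helmholtz g p) = torus_integral (grad_dot f g).
Proof.
move=> Cf Cg.
have cf := Cn_continuous Cf; have cg := Cn_continuous Cg.
have cdd j : continuous (fun p => f p * partial j (partial j g) p).
  by apply: continuous_mul => //; exact: Cn_continuous (Cn_partial j (Cn_partial j Cg)).
have cd j : continuous (fun p => partial j f p * partial j g p).
  apply: continuous_mul; first exact: Cn_continuous (Cn_partial j Cf).
  exact: Cn_continuous (Cn_partial j Cg).
have -> : (fun p => f p * helmholtz g p) =
    (fun p => f p * g p - \sum_(j < 2) f p * partial j (partial j g) p).
  by apply/funext => p; rewrite /helmholtz mulrBr mulr_sumr.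
rewrite torus_integralB; [|exact: continuous_mul|exact: continuous_sum_seq].
rewrite torus_integral_sum // /grad_dot torus_integralD;
  [|exact: continuous_mul|exact: continuous_sum_seq].
rewrite torus_integral_sum // -sumrN; congr (_ + _); apply: eq_bigr => j _.
rewrite (torus_integral_parts j Cf (Cn_partial j Cg)) opprK.
by congr torus_integral; apply/funext => p; rewrite mulrC.
Qed.

Lemma helmholtz_sym f g : Cn 2 f -> Cn 2 g ->
  torus_integral (fun p => f p * helmholtz g p) =
  torus_integral (fun p => g p * helmholtz f p).
Proof.
move=> Cf Cg; rewrite (helmholtz_dual (CnS Cf) Cg) (helmholtz_dual (CnS Cg) Cf).
congr torus_integral; apply/funext => p; rewrite /grad_dot mulrC.
by congr (_ + _); apply: eq_bigr => j _; rewrite mulrC.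
Qed.

Lemma bracket_Cn n phi v i : (forall i, Cn n.+1 (phi i)) -> (forall i, Cn n.+1 (v i)) ->
  Cn n (bracket phi v i).
Proof.
move=> Cp Cv; apply: Cn_sum => j; apply: CnB; apply: CnM;
  by [exact: CnS|exact: Cn_partial].
Qed.

Lemma transport_C0 v m i : (forall i, Cn 1 (v i)) -> (forall i, Cn 1 (m i)) ->
  Cn 0 (transport v m i).
Proof.
move=> Cv Cm; have Cv0 j := CnS (Cv j); have Cm0 j := CnS (Cm j).
apply: CnD; first apply: CnD.
- by apply: Cn_sum => j; apply: CnM => //; exact: Cn_partial.
- by apply: Cn_sum => j; apply: CnM => //; exact: Cn_partial.
- by apply: CnM => //; apply: Cn_sum => j; exact: Cn_partial.
Qed.

(** The pointwise part of [transport_dual]: values and derivatives at a point become independent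
    variables, [dm j i] standing for the derivative along j of component i. *)
Lemma transport_algebra (f m v : 'I_2 -> R) (df dm dv : 'I_2 -> 'I_2 -> R) :
  \sum_(i < 2) f i * (\sum_(j < 2) v j * dm j i + \sum_(j < 2) m j * dv i j
    + m i * \sum_(j < 2) dv j j) =
  \sum_(i < 2) m i * (\sum_(j < 2) (f j * dv j i - v j * df j i)) +
  \sum_(j < 2) ((\sum_(i < 2) f i * m i) * dv j j
    + v j * \sum_(i < 2) (f i * dm j i + m i * df j i)).
Proof. by rewrite !big_ord_recl !big_ord0; ring. Qed.

(** Adding half the divergence of |grad z|^2 v to the H^1 pairing of the bracket with z cancels all
    second derivatives of z, written [ddz]. *)
Lemma energy_algebra (z v : 'I_2 -> R) (dz dv : 'I_2 -> 'I_2 -> R)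
    (ddz ddv : 'I_2 -> 'I_2 -> 'I_2 -> R) :
  \sum_(i < 2) ((\sum_(j < 2) (z j * dv j i - v j * dz j i)) * z i +
    \sum_(l < 2) (\sum_(j < 2) ((z j * ddv l j i + dv j i * dz l j)
       - (v j * ddz l j i + dz j i * dv l j))) * dz l i)
  + \sum_(j < 2) 2^-1 * (v j * (\sum_(i < 2) \sum_(l < 2) 2 * dz l i * ddz l j i)
      + (\sum_(i < 2) \sum_(l < 2) dz l i ^+ 2) * dv j j) =
  \sum_(i < 2) (z i * (\sum_(j < 2) (z j * dv j i - v j * dz j i)) +
    \sum_(l < 2) \sum_(j < 2) (dv j i * (dz l i * dz l j) + ddv l j i * (dz l i * z j)
     - dv l j * (dz l i * dz j i)))
  + 2^-1 * \sum_(j < 2) dv j j * (\sum_(i < 2) \sum_(l < 2) dz l i ^+ 2).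
Proof. by rewrite !big_ord_recl !big_ord0; field. Qed.

(* The two sides differ by the divergence of (phi . m) v. *)
Lemma transport_dual v m phi : (forall i, Cn 1 (v i)) -> (forall i, Cn 1 (m i)) ->
  (forall i, Cn 1 (phi i)) ->
  torus_integral (fun p => \sum_(i < 2) phi i p * transport v m i p) =
  torus_integral (fun p => \sum_(i < 2) m i p * bracket phi v i p).
Proof.
move=> Cv Cm Cp; pose S p := \sum_(i < 2) phi i p * m i p.
have CS : Cn 1 S by apply: Cn_sum => i; exact: CnM.
have CSv j : Cn 1 (fun p => S p * v j p) by exact: CnM.
have -> : (fun p => \sum_(i < 2) phi i p * transport v m i p) =
    (fun p => \sum_(i < 2) m i p * bracket phi v i p +
       \sum_(j < 2) partial j (fun p => S p * v j p) p).
  apply/funext => p.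
  have dSv j : partial j (fun p => S p * v j p) p = S p * partial j (v j) p +
      v j p * \sum_(i < 2) (phi i p * partial j (m i) p + m i p * partial j (phi i) p).
    rewrite (partialM j CS (Cv j)); congr (_ + _ * _).
    rewrite (partial_sum _ j (fun i => CnM (Cp i) (Cm i))); apply: eq_bigr => i _.
    by rewrite (partialM j (Cp i) (Cm i)).
  rewrite [X in _ = _ + X](eq_bigr _ (fun j _ => dSv j)).
  exact: (transport_algebra (phi^~ p) (m^~ p) (v^~ p) (fun j i => partial j (phi i) p)
    (fun j i => partial j (m i) p) (fun j i => partial j (v i) p)).
rewrite torus_integralD.
- rewrite [X in _ + X]torus_integral_sum => [|j]; last exact: Cn_continuous (Cn_partial j (CSv j)).
  by rewrite [X in _ + X]big1 ?addr0 // => j _; exact: torus_integral_partial.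
- apply: continuous_sum_seq => i; apply: continuous_mul; first exact: Cn_continuous (Cm i).
  exact: Cn_continuous (bracket_Cn i Cp Cv).
- by apply: continuous_sum_seq => j; exact: Cn_continuous (Cn_partial j (CSv j)).
Qed.

Lemma bracket_self v i p : bracket v v i p = 0.
Proof. by apply: big1 => j _; rewrite subrr. Qed.

Definition energy_density z p : R := \sum_(i < 2) grad_dot (z i) (z i) p.

Lemma energy_densityE z p : energy_density z p =
  \sum_(i < 2) (z i p ^+ 2 + \sum_(j < 2) partial j (z i) p ^+ 2).
Proof.
apply: eq_bigr => i _; rewrite /grad_dot -expr2; congr (_ + _).
Qed.

Lemma energy_density_ge z p : (forall i, z i p ^+ 2 <= energy_density z p) /\
  (forall i j, partial j (z i) p ^+ 2 <= energy_density z p).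
Proof.
rewrite energy_densityE.
have t0 i : 0 <= \sum_(j < 2) partial j (z i) p ^+ 2 by apply: sumr_ge0 => j _; exact: sqr_ge0.
have s0 i : 0 <= z i p ^+ 2 + \sum_(j < 2) partial j (z i) p ^+ 2 by rewrite addr_ge0 ?sqr_ge0.
split=> [i|i j]; rewrite (bigD1 i) //= -[leLHS]addr0 lerD ?sumr_ge0 //.
  by rewrite lerDl.
rewrite (bigD1 j) //= addrCA lerDl addr_ge0 ?sqr_ge0 // sumr_ge0 // => l _.
exact: sqr_ge0.
Qed.

Lemma norm_sum2_le (F : 'I_2 -> R) (B : R) : (forall i, `|F i| <= B) ->
  `|\sum_(i < 2) F i| <= 2 * B.
Proof.
move=> FB; apply: (le_trans (ler_norm_sum _ _ _)).
rewrite !big_ord_recl big_ord0 /= addr0.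
have := FB ord0; have := FB (lift ord0 ord0); lra.
Qed.

Lemma bilinear_le (x y c e M : R) : x ^+ 2 <= e -> y ^+ 2 <= e -> `|c| <= M ->
  `|c * (x * y)| <= M * e.
Proof.
move=> xe ye cM; rewrite normrM; apply: ler_pM => //.
rewrite ler_norml; apply/andP; split.
  by have := sqr_ge0 (x + y); nra.
by have := sqr_ge0 (x - y); nra.
Qed.

(** The bracket costs one derivative of z, but the top-order term is v . grad applied to |grad z|^2
    / 2, which an integration by parts moves onto v. What is left is quadratic in z and its first
    derivatives, with coefficients controlled by M. *)
Lemma energy_bound v z (M : R) : (forall i, Cn 3 (v i)) -> (forall i, Cn 3 (z i)) ->
  (forall i j l, partial j (partial l (z i)) = partial l (partial j (z i))) ->
  (forall i, Cn_bound 2 M (v i)) ->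
  `|torus_integral (fun p => \sum_(i < 2) helmholtz (z i) p * bracket z v i p)| <=
  34 * M * torus_integral (energy_density z).
Proof.
move=> Cv Cz zC vM.
have M0 : 0 <= M by have [/(_ 0) h _] := vM 0; exact: le_trans h.
have v1M i j p : `|partial j (v i) p| <= M by have [_ /(_ j)[h _]] := vM i; exact: h.
have v2M i j l p : `|partial l (partial j (v i)) p| <= M.
  by have [_ /(_ j)[_ /(_ l)[h _]]] := vM i; exact: h.
have Cv2 i : Cn 2 (v i) := CnS (Cv i).
have Cz2 i : Cn 2 (z i) := CnS (Cz i).
have CW i : Cn 2 (bracket z v i) by exact: bracket_Cn.
pose Q p := \sum_(i < 2) \sum_(l < 2) partial l (z i) p ^+ 2.
have CQ : Cn 2 Q.
  apply: Cn_sum => i; apply: Cn_sum => l.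
  have -> : (fun p => partial l (z i) p ^+ 2) = (fun p => partial l (z i) p * partial l (z i) p).
    by apply/funext => p; rewrite expr2.
  exact: (CnM (Cn_partial l (Cz i)) (Cn_partial l (Cz i))).
have CvQ j : Cn 2 (fun p => v j p * Q p) := CnM (Cv2 j) CQ.
pose rest p := \sum_(i < 2) (z i p * bracket z v i p + \sum_(l < 2) \sum_(j < 2)
    (partial j (v i) p * (partial l (z i) p * partial l (z j) p)
     + partial l (partial j (v i)) p * (partial l (z i) p * z j p)
     - partial l (v j) p * (partial l (z i) p * partial j (z i) p)))
  + 2^-1 * \sum_(j < 2) partial j (v j) p * Q p.
have dQ j p : partial j Q p =
    \sum_(i < 2) \sum_(l < 2) (2 * partial l (z i) p * partial l (partial j (z i)) p).
  have Cl i l : Cn 2 (partial l (z i)) := Cn_partial l (Cz i).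
  have Csq i l : Cn 2 (fun p => partial l (z i) p ^+ 2).
    have -> : (fun p => partial l (z i) p ^+ 2) = (fun p => partial l (z i) p * partial l (z i) p).
      by apply/funext => q; rewrite expr2.
    exact: (CnM (Cl i l) (Cl i l)).
  rewrite (@partial_sum 1 _ _ (fun i p => \sum_(l < 2) partial l (z i) p ^+ 2)); last first.
    by move=> i; exact: (Cn_sum _ (Csq i)).
  apply: eq_bigr => i _; rewrite (@partial_sum 1 _ _ (fun l p => partial l (z i) p ^+ 2));
    last exact: Csq.
  apply: eq_bigr => l _.
  have -> : (fun p => partial l (z i) p ^+ 2) = (fun p => partial l (z i) p * partial l (z i) p).
    by apply/funext => q; rewrite expr2.
  by rewrite (partialM j (Cl i l) (Cl i l)) zC; ring.
have dW i l p : partial l (bracket z v i) p = \sum_(j < 2)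
    ((z j p * partial l (partial j (v i)) p + partial j (v i) p * partial l (z j) p)
    - (v j p * partial l (partial j (z i)) p + partial j (z i) p * partial l (v j) p)).
  have C1 j : Cn 2 (fun p => z j p * partial j (v i) p) := CnM (Cz2 j) (Cn_partial j (Cv i)).
  have C2 j : Cn 2 (fun p => v j p * partial j (z i) p) := CnM (Cv2 j) (Cn_partial j (Cz i)).
  rewrite (@partial_sum 1 _ _ (fun j p => z j p * partial j (v i) p - v j p * partial j (z i) p));
    last by move=> j; exact: (CnB (C1 j) (C2 j)).
  apply: eq_bigr => j _; rewrite (partialB l (C1 j) (C2 j)).
  rewrite (partialM l (Cz2 j) (Cn_partial j (Cv i))).
  by rewrite (partialM l (Cv2 j) (Cn_partial j (Cz i))).
have E : torus_integral (fun p => \sum_(i < 2) helmholtz (z i) p * bracket z v i p) =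
    torus_integral rest.
  have chW i : continuous (fun p => helmholtz (z i) p * bracket z v i p).
    by apply: continuous_mul; [exact: Cn_continuous (helmholtz_Cn (Cz i))|exact: Cn_continuous (CW i)].
  have cgW i : continuous (grad_dot (bracket z v i) (z i)).
    exact: Cn_continuous (grad_dot_Cn (CW i) (Cz2 i)).
  have cdiv j : continuous (fun p => 2^-1 * partial j (fun p => v j p * Q p) p).
    apply: continuous_mul => [p|]; first exact: cvg_cst.
    exact: Cn_continuous (Cn_partial j (CvQ j)).
  rewrite torus_integral_sum //.
  transitivity (torus_integral (fun p => \sum_(i < 2) grad_dot (bracket z v i) (z i) p +
      \sum_(j < 2) 2^-1 * partial j (fun p => v j p * Q p) p)).
    rewrite torus_integralD; [|exact: continuous_sum_seq|exact: continuous_sum_seq].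
    rewrite !torus_integral_sum // [X in _ + X]big1 ?addr0 => [|j _]; last first.
      rewrite torus_integralZ; last exact: Cn_continuous (Cn_partial j (CvQ j)).
      by rewrite (torus_integral_partial j (CnS (CvQ j))) mulr0.
    apply: eq_bigr => i _; rewrite -(helmholtz_dual (CnS (CW i)) (Cz2 i)).
    by congr torus_integral; apply/funext => p; rewrite mulrC.
  congr torus_integral; apply/funext => p; rewrite /rest.
  have dvQ j : 2^-1 * partial j (fun p => v j p * Q p) p =
      2^-1 * (v j p * (\sum_(i < 2) \sum_(l < 2)
        2 * partial l (z i) p * partial l (partial j (z i)) p) + Q p * partial j (v j) p).
    by rewrite (partialM j (Cv2 j) CQ) dQ.
  rewrite (eq_bigr _ (fun j _ => dvQ j)).
  have dgW i : grad_dot (bracket z v i) (z i) p = bracket z v i p * z i p +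
    \sum_(l < 2) (\sum_(j < 2)
    ((z j p * partial l (partial j (v i)) p + partial j (v i) p * partial l (z j) p)
    - (v j p * partial l (partial j (z i)) p + partial j (z i) p * partial l (v j) p)))
    * partial l (z i) p.
    by rewrite /grad_dot; congr (_ + _); apply: eq_bigr => l _; rewrite dW.
  rewrite (eq_bigr _ (fun i _ => dgW i)).
  exact: (energy_algebra (z^~ p) (v^~ p) (fun j i => partial j (z i) p)
    (fun j i => partial j (v i) p) (fun l j i => partial l (partial j (z i)) p)
    (fun l j i => partial l (partial j (v i)) p)).
have z0 i : Cn 0 (z i) := CnS (CnS (Cz2 i)).
have W0 i : Cn 0 (bracket z v i) := CnS (CnS (CW i)).
have dz0 i l : Cn 0 (partial l (z i)) := CnS (Cn_partial l (Cz2 i)).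
have dv0 i l : Cn 0 (partial l (v i)) := CnS (Cn_partial l (Cv2 i)).
have ddv0 i j l : Cn 0 (partial l (partial j (v i))) := Cn_partial l (Cn_partial j (Cv2 i)).
have Q0 : Cn 0 Q := CnS (CnS CQ).
have Crest : Cn 0 rest.
  apply: CnD; last by apply: CnZ; apply: Cn_sum => j; exact: (CnM (dv0 j j) Q0).
  apply: Cn_sum => i; apply: CnD; first exact: (CnM (z0 i) (W0 i)).
  apply: Cn_sum => l; apply: Cn_sum => j; apply: CnB; last exact: (CnM (dv0 j l) (CnM (dz0 i l) (dz0 i j))).
  exact: (CnD (CnM (dv0 i j) (CnM (dz0 i l) (dz0 j l)))
    (CnM (ddv0 i j l) (CnM (dz0 i l) (z0 j)))).
have Ce : Cn 0 (energy_density z).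
  by apply: Cn_sum => i; exact: (grad_dot_Cn (CnS (Cz2 i)) (CnS (Cz2 i))).
have ce := Cn_continuous Ce.
have bound p : `|rest p| <= 34 * M * energy_density z p.
  have [ez ed] := energy_density_ge z p; set e := energy_density z p in ez ed *.
  have e0 : 0 <= e by rewrite (le_trans (sqr_ge0 (z 0 p))).
  have Qe : Q p <= e.
    rewrite /e energy_densityE; apply: ler_sum => i _.
    by rewrite lerDr sqr_ge0.
  have Q00 : 0 <= Q p.
    by apply: sumr_ge0 => i _; apply: sumr_ge0 => l _; exact: sqr_ge0.
  have T1 i : `|z i p * bracket z v i p| <= 4 * (M * e).
    rewrite /bracket mulr_sumr.
    apply: (@le_trans _ _ (2 * (2 * (M * e)))); last lra.
    apply: norm_sum2_le => j.
    have -> : z i p * (z j p * partial j (v i) p - v j p * partial j (z i) p) =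
      partial j (v i) p * (z i p * z j p) - v j p * (z i p * partial j (z i) p) by ring.
    apply: (le_trans (ler_normB _ _)).
    have := bilinear_le (ez i) (ez j) (v1M i j p).
    have : `|v j p * (z i p * partial j (z i) p)| <= M * e.
      by apply: bilinear_le => //; have [h _] := vM j; exact: h.
    lra.
  have T2 i l j : `|partial j (v i) p * (partial l (z i) p * partial l (z j) p)
     + partial l (partial j (v i)) p * (partial l (z i) p * z j p)
     - partial l (v j) p * (partial l (z i) p * partial j (z i) p)| <= 3 * (M * e).
    apply: (le_trans (ler_normB _ _)); have h1 := bilinear_le (ed i l) (ed j l) (v1M i j p).
    have h2 := bilinear_le (ed i l) (ez j) (v2M i j l p).
    have h3 := bilinear_le (ed i l) (ed i j) (v1M j l p).
    have := ler_normD (partial j (v i) p * (partial l (z i) p * partial l (z j) p))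
      (partial l (partial j (v i)) p * (partial l (z i) p * z j p)).
    lra.
  have T3 : `|\sum_(j < 2) partial j (v j) p * Q p| <= 2 * (M * e).
    apply: norm_sum2_le => j; rewrite normrM (ger0_norm Q00).
    by apply: ler_pM.
  rewrite /rest; apply: (le_trans (ler_normD _ _)).
  rewrite normrM (ger0_norm (_ : 0 <= 2^-1)) //.
  set X := \sum_(i < 2) _.
  (* The count is 2 (4 + 12) = 32 here and 1 from the divergence term, which fits into 34. *)
  have : `|X| <= 2 * (4 * (M * e) + 2 * (2 * (3 * (M * e)))).
    apply: norm_sum2_le => i; apply: (le_trans (ler_normD _ _)); apply: lerD; first exact: T1.
    by do 2 (apply: norm_sum2_le => ?); exact: T2.
  have Me0 : 0 <= M * e by rewrite mulr_ge0.
  lra.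
rewrite E -torus_integralZ // ler_norml -[- torus_integral _]mulN1r -torus_integralZ; last first.
  by apply: continuous_mul => // p; exact: cvg_cst.
have cMe : continuous (fun p => 34 * M * energy_density z p).
  by apply: continuous_mul => // p; exact: cvg_cst.
apply/andP; split; apply: le_torus_integral => //.
- by apply: continuous_mul => // p; exact: cvg_cst.
- exact: Cn_continuous Crest.
- by move=> p; have := bound p; rewrite ler_norml mulN1r => /andP[].
- exact: Cn_continuous Crest.
- by move=> p; have := bound p; rewrite ler_norml => /andP[].
Qed.

End Energy.

(** * Smooth solutions: conservation of energy and translation invariance *)

Section Solutions.
Context {R : realType}.
Implicit Types (u : R -> 'I_2 -> R * R -> R) (p q : R * R) (t s T C : R) (i j l : 'I_2).

(** This is what the argument retains of a global solution. The time derivative concerns the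
    momentum only, and positive times only. *)
Definition smooth_solution u := [/\
  forall t i, 0 <= t -> Cn 3 (u t i),
  forall i, Cn_time 3 (fun t => u t i),
  forall t i j l, 0 <= t -> partial j (partial l (u t i)) = partial l (partial j (u t i)) &
  forall t i p, 0 < t -> is_derive t (1 : R) (fun s => momentum (u s) i p)
    (- transport (u t) (momentum (u t)) i p)].

Lemma EP_smooth_solution (k : R) (u0 : 'I_2 -> R * R -> R) u : 4 < k ->
  (forall T, 0 < T -> EP_solution k u0 T u) -> smooth_solution u.
Proof.
move=> k4 H.
have cs T : 0 < T -> continuous_sobolev k T u by move=> /H[].
split.
- by move=> t i t0; have [h _ _] := continuous_sobolev_C3 i k4 cs; exact: h.
- by move=> i; have [_ h _] := continuous_sobolev_C3 i k4 cs; exact: h.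
- by move=> t i j l t0; have [_ _ h] := continuous_sobolev_C3 i k4 cs; exact: h.
move=> t i p t0; have t1 : 0 < t + 1 by lra.
have [_ _ /(_ t)] := H _ t1.
have tI : 0 < t < t + 1 by rewrite t0 ltrDl ltr01.
move=> /(_ tI i p)[dm eqm]; split=> //; rewrite -derive1E.
by apply/eqP; rewrite -addr_eq0 -[X in _ == X]eqm /transport !addrA.
Qed.

Lemma momentum_admissible u i : smooth_solution u ->
  admissible (fun t => momentum (u t) i).
Proof.
move=> [_ T _ _]; apply: (@admissibleB _ (fun t p => u t i p)
  (fun t p => \sum_(j < 2) partial j (partial j (u t i)) p)).
  exact: Cn_time_admissible (T i).
apply: admissible_sum => j.
exact: Cn_time_admissible (Cn_time_partial j (Cn_time_partial j (T i))).
Qed.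

Lemma momentum_partial_admissible u i l : smooth_solution u ->
  admissible (fun t => partial l (momentum (u t) i)).
Proof.
move=> [C T _ _].
apply: (@eq_admissible _ (fun t p => partial l (u t i) p -
    \sum_(j < 2) partial l (partial j (partial j (u t i))) p)) => [t t0|].
  have Cdd j : Cn 1 (partial j (partial j (u t i))) := Cn_partial j (Cn_partial j (C t i t0)).
  have Cu : Cn 1 (u t i) := CnS (CnS (C t i t0)).
  by rewrite (partialB l Cu (Cn_sum _ Cdd)) (partial_sum _ l Cdd).
apply: admissibleB; first exact: Cn_time_admissible (Cn_time_partial l (T i)).
apply: admissible_sum => j.
exact: Cn_time_admissible (Cn_time_partial l (Cn_time_partial j (Cn_time_partial j (T i)))).
Qed.

Lemma transport_admissible u i : smooth_solution u ->
  admissible (fun t => transport (u t) (momentum (u t)) i).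
Proof.
move=> su; have [_ T _ _] := su.
have au j := Cn_time_admissible (T j).
have du j l := Cn_time_admissible (Cn_time_partial l (T j)).
have am j := momentum_admissible j su.
have dm j l := momentum_partial_admissible j l su.
apply: (@admissibleD _ (fun t p => \sum_(j < 2) u t j p * partial j (momentum (u t) i) p +
  \sum_(j < 2) momentum (u t) j p * partial i (u t j) p)
  (fun t p => momentum (u t) i p * \sum_(j < 2) partial j (u t j) p)).
  apply: admissibleD.
    apply: (@admissible_sum _ _ _ (fun j t p => u t j p * partial j (momentum (u t) i) p)) => j.
    exact: (admissibleM (au j) (dm i j)).
  apply: (@admissible_sum _ _ _ (fun j t p => momentum (u t) j p * partial i (u t j) p)) => j.
  exact: (admissibleM (am j) (du j i)).
apply: (admissibleM (am i)).
apply: (@admissible_sum _ _ _ (fun j t p => partial j (u t j) p)) => j; exact: du.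
Qed.

Lemma partial_partial_shift n q (f : R * R -> R) j l : Cn n.+2 f ->
  partial j (partial l (fun p => f (p + q))) = fun p => partial j (partial l f) (p + q).
Proof. by move=> Cf; rewrite (partial_shift q l Cf) (partial_shift q j (Cn_partial l Cf)). Qed.

Lemma momentum_shift (v : 'I_2 -> R * R -> R) q i : (forall i, Cn 3 (v i)) ->
  momentum (fun i p => v i (p + q)) i = fun p => momentum v i (p + q).
Proof.
move=> Cv; apply/funext => p; rewrite /momentum.
have E : \sum_(j < 2) partial j (partial j (fun p => v i (p + q))) p =
    \sum_(j < 2) partial j (partial j (v i)) (p + q).
  by apply: eq_bigr => j _; exact: (congr1 (@^~ p) (partial_partial_shift q j j (Cv i))).
exact: (congr1 (fun s => v i (p + q) - s) E).
Qed.

Lemma eq_transport (v m v' m' : 'I_2 -> R * R -> R) i p p' :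
  (forall j, v' j p' = v j p) -> (forall j, m' j p' = m j p) ->
  (forall j, partial j (m' i) p' = partial j (m i) p) ->
  (forall j l, partial j (v' l) p' = partial j (v l) p) ->
  transport v' m' i p' = transport v m i p.
Proof.
move=> E1 E2 E3 E4; rewrite /transport.
have -> : \sum_(j < 2) v' j p' * partial j (m' i) p' = \sum_(j < 2) v j p * partial j (m i) p.
  by apply: eq_bigr => j _; rewrite E1 E3.
have -> : \sum_(j < 2) m' j p' * partial i (v' j) p' = \sum_(j < 2) m j p * partial i (v j) p.
  by apply: eq_bigr => j _; rewrite E2 E4.
have -> : \sum_(j < 2) partial j (v' j) p' = \sum_(j < 2) partial j (v j) p.
  by apply: eq_bigr => j _; rewrite E4.
by rewrite E2.
Qed.

Lemma transport_shift (v : 'I_2 -> R * R -> R) q i p : (forall i, Cn 3 (v i)) ->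
  transport (fun i p => v i (p + q)) (momentum (fun i p => v i (p + q))) i p =
  transport v (momentum v) i (p + q).
Proof.
move=> Cv; have Cm j : Cn 1 (momentum v j) := helmholtz_Cn (Cv j).
apply: eq_transport => [//|j|j|j l].
- exact: (congr1 (@^~ p) (momentum_shift q j Cv)).
- rewrite (momentum_shift q i Cv).
  exact: (congr1 (@^~ p) (partial_shift q j (Cm i))).
- exact: (congr1 (@^~ p) (partial_shift q j (Cv l))).
Qed.

Lemma torus_integral_time_continuous (g : R -> R * R -> R) t e : admissible g ->
  0 <= t -> 0 < e -> exists2 d, 0 < d &
  forall s, 0 <= s -> `|s - t| < d -> `|torus_integral (g s) - torus_integral (g t)| <= e.
Proof.
move=> ag t0 e0; have [_ Ug] := ag; have [d d0 H] := Ug t e t0 e0; exists d => // s s0 st.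
have cs := admissible_continuous ag s0; have ct := admissible_continuous ag t0.
rewrite -torus_integralB //; apply: torus_integral_norm_le; last exact: H.
by move=> p; apply: cvgB; [exact: cs|exact: ct].
Qed.

Lemma continuous_mulr_fun (a : R) (f : R * R -> R) : continuous f -> continuous (fun p => a * f p).
Proof. by move=> cf; apply: continuous_mul => // p; exact: cvg_cst. Qed.

Lemma continuous_sub (f g : R * R -> R) : continuous f -> continuous g ->
  continuous (fun p => f p - g p).
Proof. by move=> cf cg p; apply: cvgB; [exact: cf|exact: cg]. Qed.

Lemma continuous_add (f g : R * R -> R) : continuous f -> continuous g ->
  continuous (fun p => f p + g p).
Proof. by move=> cf cg p; apply: cvgD; [exact: cf|exact: cg]. Qed.

(** [r] is the remainder of the first-order expansion: for m1 near m0 + h b, its first product has a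
    small factor and a factor of order h, and the second contains the Taylor remainder of the
    momentum. *)
Lemma energy_increment (z0 z1 m0 m1 b : R * R -> R) (h : R) : continuous z0 ->
  continuous z1 -> continuous m0 -> continuous m1 -> continuous b ->
  torus_integral (fun p => z0 p * m1 p) = torus_integral (fun p => z1 p * m0 p) ->
  let r p := (z1 p - z0 p) * (m1 p - m0 p) + 2 * (z0 p * (m1 p - m0 p - h * b p)) in
  continuous r /\ torus_integral (fun p => z1 p * m1 p)
    - torus_integral (fun p => z0 p * m0 p)
    - h * (2 * torus_integral (fun p => z0 p * b p)) = torus_integral r.
Proof.
move=> c0 c1 cm0 cm1 cb S r.
have rE : r = fun p => (z1 p * m1 p - z0 p * m0 p) + (z0 p * m1 p - z1 p * m0 p) -
    (h * 2) * (z0 p * b p).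
  by apply/funext => p; rewrite /r; ring.
have a1 := continuous_sub (continuous_mul c1 cm1) (continuous_mul c0 cm0).
have a2 := continuous_sub (continuous_mul c0 cm1) (continuous_mul c1 cm0).
have a3 := @continuous_mulr_fun (h * 2) _ (continuous_mul c0 cb).
rewrite rE; split; first exact: continuous_sub (continuous_add a1 a2) a3.
rewrite (torus_integralB (continuous_add a1 a2) a3) (torus_integralD a1 a2).
rewrite (torus_integralB (continuous_mul c1 cm1) (continuous_mul c0 cm0)).
rewrite (torus_integralB (continuous_mul c0 cm1) (continuous_mul c1 cm0)).
by rewrite (torus_integralZ _ (continuous_mul c0 cb)) S; ring.
Qed.

(* The symmetry of 1 - Delta gives E(t + h) - E(t) = I((z(t + h) + z(t)) (m(t + h) - m(t))),
   so that no time derivative of z is needed. *)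
Lemma energy_derive (z b : R -> R * R -> R) t :
  (forall t, 0 <= t -> Cn 2 (z t)) -> admissible z ->
  admissible (fun t => helmholtz (z t)) -> admissible b ->
  (forall t, 0 < t -> forall p, is_derive t (1 : R) (fun s => helmholtz (z s) p) (b t p)) ->
  0 < t -> is_derive t (1 : R) (fun s => torus_integral (fun p => z s p * helmholtz (z s) p))
    (2 * torus_integral (fun p => z t p * b t p)).
Proof.
move=> Cz az am ab dm t0; apply/is_derive_epsP => e e0.
have [_ Uz] := az; have t0' := ltW t0.
have [Mz Mz0 HMz] := admissible_bounded az t0'.
have [Mb Mb0 HMb] := admissible_bounded ab t0'.
(* [e1] and [e2] make each of the two terms of the remainder at most e |h| / 2; the minimum with 1
   in [e2] bounds the increment of the momentum by (Mb + 1) |h|. *)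
pose e1 := e / (2 * (Mb + 1)).
have e10 : 0 < e1 by rewrite divr_gt0 // mulr_gt0 // ltr_wpDl.
pose e2 := Num.min 1 (e / (4 * (Mz + 1))).
have e20 : 0 < e2 by rewrite lt_min ltr01 divr_gt0 // mulr_gt0 // ltr_wpDl.
have [d1 d10 H1] := Uz t e1 t0' e10.
have [d2 /andP[d20 d2t] H2] := uniform_time_derivative dm ab t0 e20.
exists (Num.min d1 d2); first by rewrite lt_min d10.
move=> h; rewrite lt_min => /andP[h1 h2].
have th : 0 <= t + h by move: (lt_le_trans h2 d2t); rewrite ltr_norml => /andP[? _]; lra.
have st : `|t + h - t| < d1 by rewrite addrAC subrr add0r.
have {}H1 := H1 _ th st; have {}H2 := H2 h h2.
set z1 := z (t + h); set z0 := z t; set m1 := helmholtz z1; set m0 := helmholtz z0.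
have c1 : continuous z1 := admissible_continuous az th.
have c0 : continuous z0 := admissible_continuous az t0'.
have cm1 : continuous m1 := admissible_continuous am th.
have cm0 : continuous m0 := admissible_continuous am t0'.
have cb : continuous (b t) := admissible_continuous ab t0'.
have [cr ->] := energy_increment h c0 c1 cm0 cm1 cb (helmholtz_sym (Cz t t0') (Cz _ th)).
apply: (torus_integral_norm_le cr) => p.
have hm : `|m1 p - m0 p| <= `|h| * (Mb + 1).
  have -> : m1 p - m0 p = (m1 p - m0 p - h * b t p) + h * b t p by ring.
  apply: (le_trans (ler_normD _ _)); have := H2 p; rewrite -/m1 -/m0 normrM => k1.
  have k2 : `|h| * `|b t p| <= `|h| * Mb by rewrite ler_wpM2l.
  have k3 : e2 * `|h| <= 1 * `|h| by rewrite ler_wpM2r // ge_min lexx.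
  by apply: (le_trans (lerD k1 k2)); rewrite mulrDr mulr1; lra.
apply: (le_trans (ler_normD _ _)); rewrite !normrM (ger0_norm (_ : 0 <= 2)) //.
have k1 : `|z1 p - z0 p| * `|m1 p - m0 p| <= e1 * (`|h| * (Mb + 1)) by exact: ler_pM.
have k2 : `|z0 p| * `|m1 p - m0 p - h * b t p| <= (Mz + 1) * (e / (4 * (Mz + 1)) * `|h|).
  apply: ler_pM => //; first by rewrite (le_trans (HMz p)) // lerDl.
  by apply: (le_trans (H2 p)); rewrite ler_wpM2r // ge_min lexx orbT.
have E1 : e1 * (`|h| * (Mb + 1)) = e / 2 * `|h| by rewrite /e1; field; lra.
have E2 : (Mz + 1) * (e / (4 * (Mz + 1)) * `|h|) = e / 4 * `|h| by field; lra.
by move: k1 k2; rewrite E1 E2; lra.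
Qed.

(** The derivative is known for t > 0 only: exp (- C s) E s does not increase on ]0, T], and
    continuity of E at 0 from the right extends the comparison to s = 0. *)
Lemma gronwall0 (E E' : R -> R) C T : 0 <= T ->
  (forall t, 0 < t -> is_derive t (1 : R) E (E' t)) ->
  (forall e, 0 < e -> exists2 d, 0 < d & forall s, 0 <= s -> `|s| < d -> `|E s - E 0| <= e) ->
  (forall t, 0 < t <= T -> E' t <= C * E t) -> E T <= expR (C * T) * E 0.
Proof.
move=> T0 dE cE HE; move: T0; rewrite le_eqVlt => /predU1P[<-|T0].
  by rewrite mulr0 expR0 mul1r.
pose F s := expR (- C * s) * E s.
have dF s : 0 < s -> is_derive s (1 : R) F (expR (- C * s) * (E' s - C * E s)).
  move=> s0; have := dE s s0 => dEs.
  have dx : is_derive s (1 : R) (fun s => expR (- C * s)) (expR (- C * s) * (- C)).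
    apply: (@is_derive1_comp _ expR (fun s : R => - C * s)).
    by apply: is_derive_eq; rewrite /GRing.scale /=; ring.
  have -> : expR (- C * s) * (E' s - C * E s) =
      expR (- C * s) *: E' s + E s *: (expR (- C * s) * - C).
    by rewrite /GRing.scale /=; ring.
  exact: is_deriveM dx dEs.
have mono s : 0 < s -> s < T -> F T <= F s.
  move=> s0 sT.
  have cF : {within `[s, T], continuous F}.
    apply: continuous_in_subspaceT => y; rewrite inE /= in_itv /= => /andP[sy _].
    exact: is_derive_continuous (dF y (lt_le_trans s0 sy)).
  have dF' y : s < y < T -> is_derive y (1 : R) F (expR (- C * y) * (E' y - C * E y)).
    by move=> /andP[sy _]; apply: dF; exact: lt_trans sy.
  have [y /andP[sy yT] FE] := mean_value sT dF' cF.
  rewrite -subr_le0 FE mulr_le0_ge0 ?subr_ge0 ?(ltW sT) //.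
  rewrite mulr_ge0_le0 ?expR_ge0 // subr_le0 HE // (lt_trans s0 sy) /=.
  exact: ltW.
suff FT : F T <= E 0.
  have := ler_wpM2l (expR_ge0 (C * T)) FT.
  by rewrite /F mulrA -expRD mulNr subrr expR0 mul1r.
have cF0 : (fun s => expR (- C * s) * (E 0 + (E s - E 0))) @ 0^'+ --> expR (- C * 0) * (E 0 + 0).
  apply: cvgM.
    apply: cvg_at_right_filter; apply: continuous_comp; last exact: continuous_expR.
    by apply: cvgM; [exact: cvg_cst|exact: cvg_id].
  apply: cvgD; first exact: cvg_cst.
  apply/cvgrPdist_le => e e0; have [d d0 Hd] := cE e e0.
  near=> s; rewrite sub0r normrN; apply: Hd; first by apply: ltW.
  by rewrite ger0_norm.
rewrite mulr0 expR0 mul1r addr0 in cF0.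
rewrite -(cvg_lim _ cF0) //; apply: limr_ge; first by apply/cvg_ex; eexists; exact: cF0.
near=> s; rewrite addrC subrK; exact: mono.
Unshelve. all: by end_near. Qed.

Lemma sum_ord2 (F : 'I_2 -> R) : \sum_(i < 2) F i = F 0 + F 1.
Proof.
rewrite !big_ord_recl big_ord0 addr0.
by have -> : lift ord0 ord0 = 1 :> 'I_2 by exact/val_inj.
Qed.

Definition energy (v : 'I_2 -> R * R -> R) : R := torus_integral (energy_density v).

Lemma energyE (v : 'I_2 -> R * R -> R) : (forall i, Cn 2 (v i)) ->
  energy v = torus_integral (fun p => v 0 p * helmholtz (v 0) p)
    + torus_integral (fun p => v 1 p * helmholtz (v 1) p).
Proof.
move=> Cv; have C1 i : Cn 1 (v i) := CnS (Cv i).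
have cg i : continuous (grad_dot (v i) (v i)) := Cn_continuous (grad_dot_Cn (C1 i) (C1 i)).
rewrite /energy /energy_density (torus_integral_sum _ cg).
rewrite sum_ord2; apply/esym.
exact: (congr2 +%R (helmholtz_dual (C1 0) (Cv 0)) (helmholtz_dual (C1 1) (Cv 1))).
Qed.

Lemma energy_gronwall (z b : R -> 'I_2 -> R * R -> R) C T :
  (forall t i, 0 <= t -> Cn 2 (z t i)) -> (forall i, admissible (fun t => z t i)) ->
  (forall i, admissible (fun t => helmholtz (z t i))) ->
  (forall i, admissible (fun t => b t i)) ->
  (forall t i p, 0 < t -> is_derive t (1 : R) (fun s => helmholtz (z s i) p) (b t i p)) ->
  0 <= T ->
  (forall t, 0 < t <= T ->
    2 * torus_integral (fun p => \sum_(i < 2) z t i p * b t i p) <= C * energy (z t)) ->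
  energy (z T) <= expR (C * T) * energy (z 0).
Proof.
move=> Cz az am ab dm T0 HC.
pose E i t := torus_integral (fun p => z t i p * helmholtz (z t i) p).
pose D i t := 2 * torus_integral (fun p => z t i p * b t i p).
have EE t : 0 <= t -> energy (z t) = E 0 t + E 1 t.
  by move=> t0; exact: (energyE (fun i => Cz t i t0)).
have dE i t : 0 < t -> is_derive t (1 : R) (E i) (D i t).
  move=> t0; have dmi r (r0 : 0 < r) p := dm r i p r0.
  have Czi r (r0 : 0 <= r) := Cz r i r0.
  have H := energy_derive Czi (az i) (am i) (ab i) dmi t0; exact: H.
have cE i e : 0 < e -> exists2 d, 0 < d &
    forall s, 0 <= s -> `|s| < d -> `|E i s - E i 0| <= e.
  move=> e0; have [d d0 H] :=
    torus_integral_time_continuous (admissibleM (az i) (am i)) (lexx 0) e0.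
  by exists d => // s s0 sd; apply: H; rewrite ?subr0.
rewrite !EE //.
apply: (@gronwall0 (fun t => E 0 t + E 1 t) (fun t => D 0 t + D 1 t)) => //.
- by move=> t t0; exact: is_deriveD (dE 0 t t0) (dE 1 t t0).
- move=> e e0; have e2 : 0 < e / 2 by rewrite divr_gt0.
  have [d0 d00 H0] := cE 0 _ e2; have [d1 d10 H1] := cE 1 _ e2.
  exists (Num.min d0 d1); first by rewrite lt_min d00.
  move=> s s0; rewrite lt_min => /andP[/(H0 s s0) h0 /(H1 s s0) h1].
  move: h0 h1; generalize (E 0 s) (E 1 s) (E 0 0) (E 1 0) => x0 x1 y0 y1 h0 h1.
  have -> : x0 + x1 - (y0 + y1) = (x0 - y0) + (x1 - y1) by ring.
  by apply: (le_trans (ler_normD _ _)); lra.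
- move=> t /andP[t0 tT]; have t0' := ltW t0.
  have := HC t (introT andP (conj t0 tT)); rewrite EE //.
  have czb i : continuous (fun p => z t i p * b t i p).
    exact: continuous_mul (admissible_continuous (az i) t0') (admissible_continuous (ab i) t0').
  by rewrite (torus_integral_sum _ czb) sum_ord2 mulrDr.
Qed.

Lemma energy_ge0 (v : 'I_2 -> R * R -> R) : (forall i, Cn 2 (v i)) -> 0 <= energy v.
Proof.
move=> Cv; rewrite -[leLHS](torus_integral_cst (0 : R)); apply: le_torus_integral.
- by move=> p; exact: cvg_cst.
- apply: continuous_sum_seq => i.
  exact: Cn_continuous (grad_dot_Cn (CnS (Cv i)) (CnS (Cv i))).
- by move=> p; have [h _] := energy_density_ge v p; exact: le_trans (sqr_ge0 _) (h 0).
Qed.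

Lemma energy_eq0 (v : 'I_2 -> R * R -> R) i p : (forall i, Cn 2 (v i)) ->
  energy v <= 0 -> v i p = 0.
Proof.
move=> Cv e0.
have ce : continuous (energy_density v).
  apply: continuous_sum_seq => j.
  exact: Cn_continuous (grad_dot_Cn (CnS (Cv j)) (CnS (Cv j))).
have ge0 q : 0 <= energy_density v q.
  by have [h _] := energy_density_ge v q; exact: le_trans (sqr_ge0 _) (h 0).
have E0 : torus_integral (energy_density v) = 0.
  by apply/eqP; rewrite eq_le [X in _ && X](energy_ge0 Cv) andbT.
have [x [y [/andP[x0 /ltW x1] /andP[y0 /ltW y1] _ ->]]] := periodic_square (v i) p;
  last exact: Cn_periodic (Cv i).
have := torus_integral_eq0 ce ge0 E0 (introT andP (conj x0 x1)) (introT andP (conj y0 y1)).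
have [/(_ i) h _] := energy_density_ge v (x, y) => h0; rewrite h0 in h.
by apply/eqP; rewrite -sqrf_eq0 eq_le h sqr_ge0.
Qed.

(** The duality turns the energy production into the pairing of the momentum with the bracket of u
    with itself, which vanishes; Gronwall then applies with constant 0. *)
Lemma energy_le u T : smooth_solution u -> 0 <= T -> energy (u T) <= energy (u 0).
Proof.
move=> su T0; have [C3 T3 _ dm] := su.
have := @energy_gronwall u (fun t i p => - transport (u t) (momentum (u t)) i p) 0 T.
rewrite mul0r expR0 mul1r; apply.
- by move=> t i t0; exact: CnS (C3 t i t0).
- by move=> i; exact: Cn_time_admissible (T3 i).
- by move=> i; exact: (momentum_admissible i su).
- by move=> i; exact: admissibleN (transport_admissible i su).
- exact: T0.
move=> t /andP[t0 _]; have t0' := ltW t0; rewrite mul0r.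
have C1 i : Cn 1 (u t i) := CnS (CnS (C3 t i t0')).
have Cm i : Cn 1 (momentum (u t) i) := helmholtz_Cn (C3 t i t0').
have -> : (fun p => \sum_(i < 2) u t i p * - transport (u t) (momentum (u t)) i p) =
    (fun p => -1 * \sum_(i < 2) u t i p * transport (u t) (momentum (u t)) i p).
  by apply/funext => p; rewrite mulN1r -sumrN; apply: eq_bigr => i _; rewrite mulrN.
rewrite torus_integralZ; last first.
  apply: continuous_sum_seq => i; apply: continuous_mul; first exact: Cn_continuous (C1 i).
  exact: Cn_continuous (transport_C0 i C1 Cm).
rewrite (transport_dual C1 Cm C1).
have -> : (fun p => \sum_(i < 2) momentum (u t) i p * bracket (u t) (u t) i p) = fun=> 0.
  by apply/funext => p; apply: big1 => i _; rewrite bracket_self mulr0.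
by rewrite torus_integral_cst !mulr0.
Qed.

(* The terms which are quadratic in z = v - u cancel. *)
Lemma difference_energy (u v z : 'I_2 -> R * R -> R) (M : R) :
  (forall i, Cn 3 (u i)) -> (forall i, Cn 3 (v i)) ->
  (forall i, z i = fun p => v i p - u i p) ->
  (forall i j l, partial j (partial l (z i)) = partial l (partial j (z i))) ->
  (forall i, Cn_bound 2 M (u i)) ->
  `|torus_integral (fun p => \sum_(i < 2) z i p *
      (transport u (momentum u) i p - transport v (momentum v) i p))| <= 34 * M * energy z.
Proof.
move=> Cu3 Cv3 zE zC uM.
have Cz3 i : Cn 3 (z i) by rewrite zE; exact: CnB (Cv3 i) (Cu3 i).
have Cu i : Cn 1 (u i) := CnS (CnS (Cu3 i)).
have Cv i : Cn 1 (v i) := CnS (CnS (Cv3 i)).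
have Cz i : Cn 1 (z i) := CnS (CnS (Cz3 i)).
have Cmu i : Cn 1 (momentum u i) := helmholtz_Cn (Cu3 i).
have Cmv i : Cn 1 (momentum v i) := helmholtz_Cn (Cv3 i).
have Cmz i : Cn 1 (helmholtz (z i)) := helmholtz_Cn (Cz3 i).
have I1 := transport_dual Cu Cmu Cz; have I2 := transport_dual Cv Cmv Cz.
have cT (w m : 'I_2 -> R * R -> R) : (forall i, Cn 1 (w i)) -> (forall i, Cn 1 (m i)) ->
    continuous (fun p => \sum_(i < 2) z i p * transport w m i p).
  move=> Cw Cm; apply: continuous_sum_seq => i.
  exact: continuous_mul (Cn_continuous (Cz i)) (Cn_continuous (transport_C0 i Cw Cm)).
have cB (w m : 'I_2 -> R * R -> R) : (forall i, Cn 1 (w i)) -> (forall i, Cn 1 (m i)) ->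
    continuous (fun p => \sum_(i < 2) m i p * bracket z w i p).
  move=> Cw Cm; apply: continuous_sum_seq => i.
  exact: continuous_mul (Cn_continuous (Cm i)) (Cn_continuous (bracket_Cn i Cz Cw)).
have E1 : torus_integral (fun p => \sum_(i < 2) z i p *
      (transport u (momentum u) i p - transport v (momentum v) i p)) =
    torus_integral (fun p => \sum_(i < 2) z i p * transport u (momentum u) i p)
    - torus_integral (fun p => \sum_(i < 2) z i p * transport v (momentum v) i p).
  rewrite -(torus_integralB (cT _ _ Cu Cmu) (cT _ _ Cv Cmv)); congr torus_integral.
  apply/funext => p; rewrite -sumrB; apply: eq_bigr => i _; exact: mulrBr.
have zb i p : bracket z v i p = bracket z u i p.
  apply: eq_bigr => l _.
  have e1 : partial l (z i) p = partial l (v i) p - partial l (u i) p.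
    by rewrite zE (partialB l (Cv i) (Cu i)).
  have e2 : z l p = v l p - u l p by rewrite zE.
  move: e1 e2; move: (partial l (z i) p) (partial l (v i) p) (partial l (u i) p)
    (z l p) (v l p) (u l p) => a b c d e f -> ->; ring.
have zh i p : helmholtz (z i) p = momentum v i p - momentum u i p.
  by rewrite zE (helmholtzB (Cv3 i) (Cu3 i)).
have E2 : torus_integral (fun p => \sum_(i < 2) momentum u i p * bracket z u i p)
    - torus_integral (fun p => \sum_(i < 2) momentum v i p * bracket z v i p) =
    torus_integral (fun p => -1 * \sum_(i < 2) helmholtz (z i) p * bracket z u i p).
  rewrite -(torus_integralB (cB _ _ Cu Cmu) (cB _ _ Cv Cmv)); congr torus_integral.
  apply/funext => p; rewrite -sumrB mulN1r -sumrN; apply: eq_bigr => i _.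
  rewrite zb zh; move: (momentum u i p) (momentum v i p) (bracket z u i p) => a b c; ring.
have E := etrans E1 (etrans (congr2 (fun x y : R => x - y) I1 I2)
  (etrans E2 (torus_integralZ (-1) (cB _ _ Cu Cmz)))).
rewrite E mulN1r normrN; exact: energy_bound.
Qed.

(** The translate v solves the same equation, and the difference v - u has zero energy at time 0.
    The Gronwall constant involves derivatives of u on [0, t] alone. *)
Lemma translation_invariant u q t i p : smooth_solution u -> 0 <= t ->
  (forall i p, u 0 i (p + q) = u 0 i p) -> u t i (p + q) = u t i p.
Proof.
move=> su t0 inv; have [C3 T3 sch dm] := su.
pose v s i p := u s i (p + q); pose z s i p := v s i p - u s i p.
have Cv s j : 0 <= s -> Cn 3 (v s j) by move=> s0; exact: Cn_shift (C3 s j s0).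
have Cz s j : 0 <= s -> Cn 3 (z s j) by move=> s0; exact: CnB (Cv s j s0) (C3 s j s0).
have au j := Cn_time_admissible (T3 j).
have am j := momentum_admissible j su.
have at_ j := transport_admissible j su.
have vm s j : 0 <= s -> helmholtz (v s j) = fun p => momentum (u s) j (p + q).
  by move=> s0; exact: (momentum_shift q j (fun j => C3 s j s0)).
have zm s j : 0 <= s -> helmholtz (z s j) =
    fun p => momentum (u s) j (p + q) - momentum (u s) j p.
  by move=> s0; rewrite (helmholtzB (Cv s j s0) (C3 s j s0)) (vm s j s0).
have [M M0 HM] : exists2 M, 0 <= M & forall s j, 0 <= s <= t -> Cn_bound 2 M (u s j).
  have [M1 M10 H1] := Cn_bound_time (T3 0) t0; have [M2 M20 H2] := Cn_bound_time (T3 1) t0.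
  have mono n (a b : R) (f : R * R -> R) : a <= b -> Cn_bound n.+1 a f -> Cn_bound n b f.
    move=> ab; elim: n f => [|n IHn] f [h1 h2].
      by split=> // y; exact: le_trans (h1 y) ab.
    by split=> [y|j]; [exact: le_trans (h1 y) ab|exact: IHn (h2 j)].
  exists (M1 + M2); first by rewrite addr_ge0.
  move=> s j st; have [->|->] : j = 0 \/ j = 1.
    by case: j => [[|[|//]]] ?; [left|right]; apply/val_inj.
  - by apply: (mono _ _ _ _ _ (H1 s st)); lra.
  - by apply: (mono _ _ _ _ _ (H2 s st)); lra.
pose b s j p := - transport (u s) (momentum (u s)) j (p + q) + transport (u s) (momentum (u s)) j p.
suff : energy (z t) <= 0.
  by move=> /(energy_eq0 i p (fun j => CnS (Cz t j t0))) /eqP; rewrite subr_eq0 => /eqP.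
(* 68 is twice the constant 34 of [difference_energy]; the factor 2 comes from the derivative of a
   quadratic energy. *)
have -> : 0 = expR (68 * M * t) * energy (z 0).
  have -> : z 0 = fun _ _ => 0.
    by apply/funext => j; apply/funext => y; rewrite /z /v inv subrr.
  rewrite energyE; last by move=> _; exact: (proj1 (Cn_cst 2 0)).
  under eq_fun do rewrite mul0r.
  by rewrite torus_integral_cst addr0 mulr0.
apply: (@energy_gronwall z b).
- by move=> s j s0; exact: CnS (Cz s j s0).
- by move=> j; exact: admissibleB (admissible_shift q (au j)) (au j).
- move=> j; apply: eq_admissible (admissibleB (admissible_shift q (am j)) (am j)) => s s0.
  by rewrite (zm s j s0).
- by move=> j; exact: admissibleD (admissibleN (admissible_shift q (at_ j))) (at_ j).
- move=> s j y s0.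
  have dz := is_deriveB (dm s j (y + q) s0) (dm s j y s0).
  rewrite opprK in dz; apply: near_eq_is_derive dz.
  near=> r; have r0 : 0 <= r by apply: ltW; near: r; apply: (cvgr_gt s cvg_id).
  by rewrite (zm r j r0).
- exact: t0.
move=> s /andP[s0 st]; have s0' := ltW s0.
have tv j y : transport (u s) (momentum (u s)) j (y + q) = transport (v s) (momentum (v s)) j y.
  by rewrite -(transport_shift q j y (fun j => C3 s j s0')).
have zC j l k : partial l (partial k (z s j)) = partial k (partial l (z s j)).
  have C2u := CnS (C3 s j s0'); have C2v := CnS (Cv s j s0').
  have D a c : partial a (partial c (z s j)) =
      fun p => partial a (partial c (u s j)) (p + q) - partial a (partial c (u s j)) p.
    rewrite (partialB c C2v C2u) (partialB a (Cn_partial c C2v) (Cn_partial c C2u)).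
    by rewrite (partial_partial_shift q a c C2u).
  by rewrite !D (sch s j l k s0').
have H := difference_energy (fun j => C3 s j s0') (fun j => Cv s j s0')
  (fun j => erefl) zC (fun j => HM s j (introT andP (conj s0' st))).
have E : (fun y => \sum_(j < 2) z s j y * b s j y) = (fun y => \sum_(j < 2) z s j y *
    (transport (u s) (momentum (u s)) j y - transport (v s) (momentum (v s)) j y)).
  apply/funext => y; apply: eq_bigr => j _; congr (_ * _).
  by rewrite /b tv addrC.
rewrite E; move: H; rewrite ler_norml; move: (torus_integral _) (energy _) => X Y /andP[_ h].
lra.
Unshelve. all: by end_near. Qed.

End Solutions.

(** * The equation on a line *)

Section Line.
Context {R : realType}.
Implicit Types (x y : R).

(** Here E and V stand for exp x and exp (- x), and a, b for the two exponentials in the kernel.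
    Since a + b lies between 2 and E + V, the bounds are sinh x <= 2 x from below and x coth x <= 1
    + x <= 3/2 from above. *)
Lemma green_bounds (x E V a b : R) : 0 < x -> x <= 1 / 2 -> E * V = 1 -> 1 + x <= E ->
  1 - x <= V -> 1 + 2 * x <= E ^+ 2 -> 0 < a -> 0 < b -> a * b = 1 -> a <= E -> b <= E ->
  1 / 2 <= x / (E - V) * (a + b) <= 3 / 2.
Proof.
move=> x0 x1 EV E1 V1 E2 a0 b0 ab aE bE.
have E0 : 0 < E by lra.
have VE : V < 1 by rewrite -(ltr_pM2l E0) EV; lra.
have S0 : 0 < E - V by lra.
have h2 : 2 <= a + b by have := sqr_ge0 (a - b); nra.
have hE : a + b <= E + V.
  rewrite -(ler_pM2l E0) -subr_ge0.
  have -> : E * (E + V) - E * (a + b) = (E - a) * (E - b) + (E * V - a * b) by ring.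
  by rewrite EV ab subrr addr0 mulr_ge0 // subr_ge0.
have SL : E - V <= 4 * x.
  have h : (1 - x) * E <= 1 by rewrite mulrC -[leRHS]EV ler_wpM2l // ltW.
  have x1' : 0 < 1 - x by lra.
  have : E <= 1 + 2 * x by rewrite -(ler_pM2l x1') (le_trans h) //; nra.
  by lra.
have ES : (E + V) * x <= (1 + x) * (E - V).
  rewrite -(ler_pM2l E0).
  have -> : E * ((E + V) * x) = (E ^+ 2 + E * V) * x by ring.
  have -> : E * ((1 + x) * (E - V)) = (1 + x) * (E ^+ 2 - E * V) by ring.
  by rewrite EV; nra.
rewrite mulrAC ler_pdivlMr // ler_pdivrMr //; apply/andP; split; first by nra.
have : x * (a + b) <= x * (E + V) by rewrite ler_pM2l.
by nra.
Qed.

(* Green function of 1 - L^-2 d^2/dy^2 on R/Z, with derivative K1. *)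
Lemma green_kernel (L : R) : 0 < L -> L <= 1 -> exists K K1 : R -> R,
  [/\ forall y, is_derive y (1 : R) K (K1 y),
      forall y, is_derive y (1 : R) K1 (L ^+ 2 * K y),
      K 1 = K 0 /\ K1 1 - K1 0 = L ^+ 2 &
      forall y, 0 <= y <= 1 -> 1 / 2 <= K y <= 3 / 2].
Proof.
move=> L0 L1; pose x := L / 2.
have x0 : 0 < x by rewrite divr_gt0.
have x1 : x <= 1 / 2 by rewrite /x; lra.
pose E := expR x; have E0 : 0 < E by exact: expR_gt0.
pose S := E - E^-1.
have E1 : 1 + x <= E by exact: expR_ge1Dx.
have EV0 : 0 < E^-1 by rewrite invr_gt0.
have EV : 1 - x <= E^-1 by rewrite /E -expRN; exact: expR_ge1Dx.
have EE : E * E^-1 = 1 by rewrite divff // gt_eqF.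
have E2 : 1 + 2 * x <= E ^+ 2.
  have -> : E ^+ 2 = expR (2 * x) by rewrite expr2 -expRD; congr expR; ring.
  exact: expR_ge1Dx.
have EV1 : E^-1 < 1 by rewrite invf_lt1 //; lra.
have S0 : 0 < S by rewrite /S; lra.
have Sn0 : S != 0 by rewrite gt_eqF.
pose e (y : R) := expR (L * (y - 1 / 2)); pose e' (y : R) := expR (- (L * (y - 1 / 2))).
have de y : is_derive y (1 : R) e (L * e y).
  have d1 : is_derive y (1 : R) (fun y : R => L * (y - 1 / 2)) L.
    by apply: is_derive_eq; rewrite /GRing.scale /=; ring.
  rewrite mulrC; exact: (@is_derive1_comp _ expR (fun y : R => L * (y - 1 / 2))).
have de' y : is_derive y (1 : R) e' (- L * e' y).
  have d1 : is_derive y (1 : R) (fun y : R => - (L * (y - 1 / 2))) (- L).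
    by apply: is_derive_eq; rewrite /GRing.scale /=; ring.
  rewrite mulrC; exact: (@is_derive1_comp _ expR (fun y : R => - (L * (y - 1 / 2)))).
(* The kernel is L cosh (L (y - 1/2)) / (2 sinh (L / 2)): symmetric about 1/2, so that its end
   values agree, and with [c] fixed by the jump of its derivative. *)
pose c := L / (2 * S); have c0 : 0 < c by rewrite divr_gt0 // mulr_gt0.
have cS : c * S = L / 2 by rewrite /c; field.
exists (fun y => c * (e y + e' y)), (fun y => c * L * (e y - e' y)).
have e1 : e 1 = E by rewrite /e /E /x; congr expR; lra.
have e0 : e 0 = E^-1 by rewrite /e /E /x -expRN; congr expR; lra.
have e'1 : e' 1 = E^-1 by rewrite /e' /E /x -expRN; congr expR; lra.
have e'0 : e' 0 = E by rewrite /e' /E /x; congr expR; lra.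
split.
- move=> y; have := is_deriveZ c (is_deriveD (de y) (de' y)).
  by congr is_derive; rewrite /GRing.scale /=; ring.
- move=> y; have := is_deriveZ (c * L) (is_deriveB (de y) (de' y)).
  by congr is_derive; rewrite /GRing.scale /=; ring.
- rewrite e0 e1 e'0 e'1; split; first by rewrite addrC.
  have -> : c * L * (E - E^-1) - c * L * (E^-1 - E) = 2 * L * (c * S) by rewrite /S; ring.
  by rewrite cS; field.
move=> y /andP[y0 y1].
have a0 : 0 < e y by exact: expR_gt0.
have ea : e' y = (e y)^-1 by rewrite /e' expRN.
have aV0 : 0 < (e y)^-1 by rewrite invr_gt0.
have aa : e y * (e y)^-1 = 1 by rewrite divff // gt_eqF.
have aE : e y <= E by rewrite /e /E ler_expR /x; nra.
have Ea : (e y)^-1 <= E.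
  by rewrite -ea /e' /E ler_expR /x; nra.
rewrite ea; move: a0 aV0 aa aE Ea; generalize (e y) (e y)^-1 => a b a0 b0 ab aE bE.
have -> : c = x / S by rewrite /c /x; field.
exact: (@green_bounds x E E^-1).
Qed.

Lemma is_derive_continuousT (F G : R -> R) : (forall y, is_derive y (1 : R) F (G y)) ->
  continuous F.
Proof. by move=> dF y; exact: is_derive_continuous (dF y). Qed.

Lemma continuousM1 (F G : R -> R) : continuous F -> continuous G ->
  continuous (fun y => F y * G y).
Proof. by move=> cF cG y; apply: cvgM; [exact: cF|exact: cG]. Qed.

Lemma continuousD1 (F G : R -> R) : continuous F -> continuous G ->
  continuous (fun y => F y + G y).
Proof. by move=> cF cG y; apply: cvgD; [exact: cF|exact: cG]. Qed.

Lemma continuousB1 (F G : R -> R) : continuous F -> continuous G ->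
  continuous (fun y => F y - G y).
Proof. by move=> cF cG y; apply: cvgB; [exact: cF|exact: cG]. Qed.

Lemma continuousZ1 (a : R) (F : R -> R) : continuous F -> continuous (fun y => a * F y).
Proof. by move=> cF; apply: continuousM1 => // y; exact: cvg_cst. Qed.

(* K V - a K1 V1 is an antiderivative. *)
Lemma line_representation (a b : R) (V V1 V2 K K1 : R -> R) : a * b = 1 ->
  (forall y, is_derive y (1 : R) V (V1 y)) -> (forall y, is_derive y (1 : R) V1 (V2 y)) ->
  continuous V2 -> V 1 = V 0 -> V1 1 = V1 0 ->
  (forall y, is_derive y (1 : R) K (K1 y)) ->
  (forall y, is_derive y (1 : R) K1 (b * K y)) -> K 1 = K 0 -> K1 1 - K1 0 = b ->
  int01 (fun y => K1 y * (V y - a * V2 y)) = - V1 0.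
Proof.
move=> ab dV dV1 cV2 pV pV1 dK dK1 pK jK1.
have cK1 := is_derive_continuousT dK1; have cV := is_derive_continuousT dV.
have dPhi y : is_derive y (1 : R) (fun y => K y * V y - a * (K1 y * V1 y))
    (K1 y * (V y - a * V2 y)).
  have := is_deriveB (is_deriveM (dK y) (dV y)) (is_deriveZ a (is_deriveM (dK1 y) (dV1 y))).
  congr is_derive; rewrite /GRing.scale /=.
  have -> : a * (K1 y * V2 y + V1 y * (b * K y)) = a * K1 y * V2 y + a * b * K y * V1 y by ring.
  by rewrite ab; ring.
have cg := continuousM1 cK1 (continuousB1 cV (@continuousZ1 a _ cV2)).
rewrite (int01_derive cg (fun y _ => dPhi y)) pK pV pV1 -[RHS]mulN1r -[in RHS]ab -jK1; ring.
Qed.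

(** f^2 is integrated by parts against the weight y - 1/2, whose end values - 1/2 and 1/2 produce
    f(0)^2 by periodicity. Young's inequality with parameter c treats the cross term, as |2 y - 1|
    <= 1. *)
Lemma sqr0_le_int01 (c : R) (f f1 : R -> R) : 0 < c ->
  (forall y, is_derive y (1 : R) f (f1 y)) -> continuous f1 -> f 1 = f 0 ->
  f 0 ^+ 2 <= int01 (fun y => (1 + c / 2) * f y ^+ 2 + (2 * c)^-1 * f1 y ^+ 2).
Proof.
move=> c0 df cf1 pf.
have cf := is_derive_continuousT df.
have dg y : is_derive y (1 : R) (fun y => (y - 1 / 2) * f y ^+ 2)
    (f y ^+ 2 + (y - 1 / 2) * (2 * f y * f1 y)).
  by apply: is_derive_eq; rewrite /GRing.scale /=; ring.
have csq (g : R -> R) : continuous g -> continuous (fun y => g y ^+ 2).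
  by move=> cg y; exact: (continuousM1 cg cg).
have cg : continuous (fun y => f y ^+ 2 + (y - 1 / 2) * (2 * f y * f1 y)).
  apply: continuousD1; first exact: csq.
  apply: continuousM1; last exact: continuousM1 (continuousZ1 cf) cf1.
  by move=> y; apply: cvgB; [exact: cvg_id|exact: cvg_cst].
have := int01_derive cg (fun y _ => dg y); rewrite pf.
have -> : (1 - 1 / 2) * f 0 ^+ 2 - (0 - 1 / 2) * f 0 ^+ 2 = f 0 ^+ 2 by field.
move=> <-; apply: le_int01 => [//||y /andP[y0 y1]].
  by apply: continuousD1; apply: continuousZ1; exact: csq.
have : (y - 1 / 2) * (2 * f y * f1 y) <= `|f y| * `|f1 y|.
  rewrite -normrM; have -> : (y - 1 / 2) * (2 * f y * f1 y) = (2 * y - 1) * (f y * f1 y) by field.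
  apply: (le_trans (ler_norm _)); rewrite (normrM (2 * y - 1)).
  move: (f y * f1 y) => z; apply: ler_piMl => //.
  by rewrite ler_norml; apply/andP; split; lra.
have : `|f y| * `|f1 y| <= c / 2 * f y ^+ 2 + (2 * c)^-1 * f1 y ^+ 2.
  rewrite -(real_normK (num_real (f y))) -(real_normK (num_real (f1 y))) -subr_ge0.
  have -> : c / 2 * `|f y| ^+ 2 + (2 * c)^-1 * `|f1 y| ^+ 2 - `|f y| * `|f1 y| =
    (c * `|f y| - `|f1 y|) ^+ 2 / (2 * c) by field; rewrite gt_eqF.
  by rewrite divr_ge0 ?sqr_ge0 // mulr_ge0 // ltW.
by move=> h1 h2; rewrite mulrDl mul1r; lra.
Qed.

(** The left-hand weights come from [sqr0_le_int01] with c = 1 for V and c = 2 for U, the latter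
    halved as in F. The bound k >= 1/2 accounts for 3/2 v = v + v / 2, and k <= 3/2 leaves 1/8 + 3/4
    a <= a in front of w. *)
Lemma riccati_integrand (a k v v1 u w : R) : 1 <= a -> 1 / 2 <= k -> k <= 3 / 2 ->
  0 <= v -> 0 <= v1 -> 0 <= u -> 0 <= w ->
  (1 + 1 / 2) * v + (2 * 1)^-1 * v1 + 1 / 2 * ((1 + 2 / 2) * u + (2 * 2)^-1 * w) <=
  v + u + a * (v1 + w) + k * (v + a / 2 * v1 + u / 2 - a / 2 * w).
Proof.
move=> a1 k1 k2 v0 v10 u0 w0.
have q1 : 1 / 2 * v <= k * v by exact: ler_wpM2r v0 _ _ k1.
have k0 : 0 <= k by lra.
have a20 : 0 <= a / 2 by lra.
have q2 : 0 <= k * (a / 2 * v1) by exact: mulr_ge0 k0 (mulr_ge0 a20 v10).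
have q4 : k * (a / 2 * w) <= 3 / 2 * (a / 2 * w).
  exact: ler_wpM2r (mulr_ge0 a20 w0) _ _ k2.
have q3 : 0 <= k * (u / 2) by apply: mulr_ge0 => //; lra.
have q5 : v1 <= a * v1 by rewrite ler_peMl.
have q6 : w <= a * w by rewrite ler_peMl.
have -> : k * (v + a / 2 * v1 + u / 2 - a / 2 * w) =
  k * v + k * (a / 2 * v1) + k * (u / 2) - k * (a / 2 * w) by ring.
lra.
Qed.

Section LineTransport.
Variables (a b : R) (V V1 V2 V3 U U1 U2 K K1 : R -> R).
Hypotheses (ab : a * b = 1) (a1 : 1 <= a).
Hypotheses (dV : forall y, is_derive y (1 : R) V (V1 y))
  (dV1 : forall y, is_derive y (1 : R) V1 (V2 y))
  (dV2 : forall y, is_derive y (1 : R) V2 (V3 y)) (cV3 : continuous V3)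
  (pV : V 1 = V 0) (pV1 : V1 1 = V1 0) (pV2 : V2 1 = V2 0).
Hypotheses (dU : forall y, is_derive y (1 : R) U (U1 y))
  (dU1 : forall y, is_derive y (1 : R) U1 (U2 y)) (cU2 : continuous U2)
  (pU : U 1 = U 0) (pU1 : U1 1 = U1 0).
Hypotheses (dK : forall y, is_derive y (1 : R) K (K1 y))
  (dK1 : forall y, is_derive y (1 : R) K1 (b * K y)) (pK : K 1 = K 0)
  (jK1 : K1 1 - K1 0 = b) (K12 : forall y, 0 <= y <= 1 -> 1 / 2 <= K y <= 3 / 2).

(** In the application a is w_j^-2, and [V - a V2], [U - a U2] are the components of the momentum
    along w and n on the line. [N] is then K1 times the w-component of the transport term, without
    its factor w_j^-1. *)
Let N y := K1 y * (V y * (V1 y - a * V3 y) + 2 * (V y - a * V2 y) * V1 y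
  + (U y - a * U2 y) * U1 y).
Let F y := V y ^+ 2 + a / 2 * V1 y ^+ 2 + U y ^+ 2 / 2 - a / 2 * U1 y ^+ 2.
Let cK := is_derive_continuousT dK.
Let cK1 := is_derive_continuousT dK1.
Let cV := is_derive_continuousT dV.
Let cV1 := is_derive_continuousT dV1.
Let cV2 := is_derive_continuousT dV2.
Let cU := is_derive_continuousT dU.
Let cU1 := is_derive_continuousT dU1.

Lemma line_transport_continuous : continuous N.
Proof.
apply: continuousM1 cK1 _; apply: continuousD1; first apply: continuousD1.
- exact: continuousM1 cV (continuousB1 cV1 (@continuousZ1 a _ cV3)).
- exact: continuousM1 (@continuousZ1 2 _ (continuousB1 cV (@continuousZ1 a _ cV2))) cV1.
- exact: continuousM1 (continuousB1 cU (@continuousZ1 a _ cU2)) cU1.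
Qed.

(** The factor of K1 in [N] is (1 - a d^2/dy^2) (V V1) + F'. The first part is treated as in
    [line_representation]; in the second, K1 F is integrated by parts, and the jump of K1 yields the
    value of F at 0. *)
Lemma line_transport :
  int01 N = - (V1 0 ^+ 2 + V 0 * V2 0) + b * F 0 - b * int01 (fun y => K y * F y).
Proof.
have dF y : is_derive y (1 : R) F (2 * V y * V1 y + a * V1 y * V2 y + U y * U1 y - a * U1 y * U2 y).
  by rewrite /F; apply: is_derive_eq; rewrite /GRing.scale /=; field.
pose A1 y := V1 y ^+ 2 + V y * V2 y.
have dA y : is_derive y (1 : R) (fun y => V y * V1 y) (A1 y).
  by apply: is_derive_eq; rewrite /A1 /GRing.scale /=; ring.
have dA1 y : is_derive y (1 : R) A1 (3 * V1 y * V2 y + V y * V3 y).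
  by rewrite /A1; apply: is_derive_eq; rewrite /GRing.scale /=; ring.
have dPsi y : is_derive y (1 : R)
    (fun y => K y * (V y * V1 y) - a * (K1 y * A1 y) + K1 y * F y)
    (K1 y * (V y * (V1 y - a * V3 y) + 2 * (V y - a * V2 y) * V1 y
      + (U y - a * U2 y) * U1 y) + b * (K y * F y)).
  have := is_deriveD (is_deriveB (is_deriveM (dK y) (dA y))
    (is_deriveZ a (is_deriveM (dK1 y) (dA1 y)))) (is_deriveM (dK1 y) (dF y)).
  congr is_derive; rewrite /GRing.scale /=.
  have -> : a * (K1 y * (3 * V1 y * V2 y + V y * V3 y) + A1 y * (b * K y)) =
    a * K1 y * (3 * V1 y * V2 y + V y * V3 y) + a * b * K y * A1 y by ring.
  by rewrite ab /A1; ring.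
have cF := is_derive_continuousT dF.
have cN := line_transport_continuous.
have cbKF := @continuousZ1 b _ (continuousM1 cK cF).
have := int01_derive (continuousD1 cN cbKF) (fun y _ => dPsi y).
rewrite (int01D cN cbKF) (int01Z b (continuousM1 cK cF)).
have F10 : F 1 = F 0 by rewrite /F pV pV1 pU pU1.
have A10 : A1 1 = A1 0 by rewrite /A1 pV pV1 pV2.
rewrite F10 A10 pK pV pV1 -/(A1 0).
have -> : K 0 * (V 0 * V1 0) - a * (K1 1 * A1 0) + K1 1 * F 0 -
  (K 0 * (V 0 * V1 0) - a * (K1 0 * A1 0) + K1 0 * F 0) =
  - (a * (K1 1 - K1 0)) * A1 0 + (K1 1 - K1 0) * F 0 by ring.
rewrite jK1 ab mulN1r => H; rewrite -H; ring.
Qed.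

Lemma line_riccati : V2 0 = 0 -> a * int01 N <= - (a / 2 * V1 0 ^+ 2) +
  int01 (fun y => V y ^+ 2 + U y ^+ 2 + a * (V1 y ^+ 2 + U1 y ^+ 2)).
Proof.
move=> V20; rewrite line_transport V20 mulr0 addr0.
have csq1 (g : R -> R) : continuous g -> continuous (fun y => g y ^+ 2).
  by move=> cg y; exact: (continuousM1 cg cg).
have csq (g : R -> R) (c : R) : continuous g -> continuous (fun y => c * g y ^+ 2).
  by move=> cg; exact: continuousZ1 (csq1 _ cg).
have hV := sqr0_le_int01 ltr01 dV cV1 pV.
have two0 : 0 < 2 :> R by [].
have hU := sqr0_le_int01 two0 dU cU1 pU.
have -> : a * (- V1 0 ^+ 2 + b * F 0 - b * int01 (fun y => K y * F y)) =
    - (a * V1 0 ^+ 2) + (a * b) * F 0 - (a * b) * int01 (fun y => K y * F y) by ring.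
rewrite ab !mul1r {1}/F.
have a0 : 0 <= a / 2 * U1 0 ^+ 2.
  by rewrite mulr_ge0 ?sqr_ge0 // divr_ge0 // (le_trans ler01 a1).
pose gV y := (1 + 1 / 2) * V y ^+ 2 + (2 * 1)^-1 * V1 y ^+ 2.
pose gU y := (1 + 2 / 2) * U y ^+ 2 + (2 * 2)^-1 * U1 y ^+ 2.
pose ge y := V y ^+ 2 + U y ^+ 2 + a * (V1 y ^+ 2 + U1 y ^+ 2).
have cgV : continuous gV by apply: continuousD1; exact: csq.
have cgU : continuous gU by apply: continuousD1; exact: csq.
have cge : continuous ge.
  apply: continuousD1; first by apply: continuousD1; exact: csq1.
  by apply: continuousZ1; apply: continuousD1; exact: csq1.
have cF : continuous F.
  apply: continuousB1; last exact: csq.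
  apply: continuousD1; first by apply: continuousD1; [exact: csq1|exact: csq].
  by move=> y; apply: cvgM; [exact: csq1|exact: cvg_cst].
have cKF := continuousM1 cK cF.
have chU := @continuousZ1 (1 / 2) _ cgU.
have : int01 gV + 1 / 2 * int01 gU <= int01 ge + int01 (fun y => K y * F y).
  rewrite -(int01Z (1 / 2) cgU) -(int01D cgV chU) -(int01D cge cKF).
  apply: le_int01 => [||y /K12 /andP[k1 k2]].
  - exact: continuousD1.
  - exact: continuousD1.
  rewrite /gV /gU /ge /F.
  exact: riccati_integrand (sqr_ge0 _) (sqr_ge0 _) (sqr_ge0 _) (sqr_ge0 _).
move: hV hU; rewrite -/gV -/gU -/ge; lra.
Qed.

End LineTransport.

End Line.

(** * Reduction of torus integrals to a coordinate line *)

Section Reduction.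
Context {R : realType}.

Lemma antiderivative (h : R -> R) (a : R) : continuous h ->
  exists F : R -> R, forall x, a < x -> is_derive x (1 : R) F (h x).
Proof.
move=> ch; exists (fun x => \int[@lebesgue_measure R]_(t in [set` `[a, x]]) h t)%R => x ax.
have xu : x < x + 1 by rewrite ltrDl.
have ih : (@lebesgue_measure R).-integrable `[a, x + 1] (EFin \o h).
  by apply: continuous_compact_integrable; [exact: segment_compact|exact: continuous_subspaceT].
have [df <-] := continuous_FTC1_closed xu ih ax (ch x).
by rewrite derive1E; exact: DeriveDef.
Qed.

Lemma int01_shift (h : R -> R) (r : R) : continuous h -> (forall y, h (y + 1) = h y) ->
  int01 (fun y => h (y + r)) = int01 h.
Proof.
(* The antiderivative is available only to the right of a base point: a lies below both 0 and r,
   with room for b in between. *)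
move=> ch ph; pose a := - 1 - `|r|.
have a0 : a < 0 by rewrite /a; have := normr_ge0 r; lra.
have ar : a < r by rewrite /a; have := ler_norm (- r); rewrite normrN; lra.
have [F dF] := antiderivative a ch.
have cs : continuous (fun y => h (y + r)).
  move=> y; apply: (@continuous_comp _ _ _ (fun y => y + r) h); last exact: ch.
  by apply: cvgD; [exact: cvg_id|exact: cvg_cst].
have dFs (s x : R) : a < x + s -> is_derive x (1 : R) (fun y => F (y + s)) (h (x + s)).
  move=> ax; have d1 : is_derive x (1 : R) (fun y : R => y + s) 1.
    by apply: is_derive_eq; rewrite addr0.
  have := @is_derive1_comp _ F (fun y : R => y + s) x _ _ (dF _ ax) d1.
  by rewrite mulr1.
have dG x : a < x -> is_derive x (1 : R) (fun y => F (y + 1) - F y) 0.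
  move=> ax; have ax1 : a < x + 1 by lra.
  by have := is_deriveB (dFs 1 x ax1) (dF x ax); rewrite ph subrr.
pose b := - 1 / 2 - `|r|.
have Gb x : b < x -> F (x + 1) - F x = F (b + 1) - F b.
  move=> bx; have ab : a < b by rewrite /a /b; lra.
  have dG' z : b <= z <= x -> is_derive z (1 : R) (fun y => F (y + 1) - F y) 0.
    by move=> /andP[bz _]; apply: dG; lra.
  have [z /andP[bz zx]||c _] := @mean_value _ (fun y => F (y + 1) - F y) (fun=> 0) b x bx.
  - by apply: dG'; rewrite (ltW bz) (ltW zx).
  - apply: derivable_within_continuous => z; rewrite in_itv /= => /dG' h0.
    exact: ex_derive.
  - by rewrite mul0r => /eqP; rewrite subr_eq0 => /eqP.
have br : b < r by rewrite /b; have := ler_norm (- r); rewrite normrN; lra.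
have b0 : b < 0 by rewrite /b; have := normr_ge0 r; lra.
have d0 (y : R) : 0 <= y <= 1 -> is_derive y (1 : R) F (h y).
  by move=> /andP[y0 _]; apply: dF; lra.
have dr (y : R) : 0 <= y <= 1 -> is_derive y (1 : R) (fun y => F (y + r)) (h (y + r)).
  by move=> /andP[y0 _]; apply: dFs; lra.
by rewrite (int01_derive ch d0) (int01_derive cs dr) add0r (addrC 1 r) (Gb r br) -(Gb 0 b0) add0r.
Qed.

(* The two lines through p and q in direction e_j are exchanged by a translation along n
   followed by one along e_j. *)
Lemma int01_line (f : R * R -> R) (n p q : R * R) (j : 'I_2) : continuous f ->
  (forall p, f (p + basis2 R j) = f p) ->
  (forall r p, f (p + r *: n) = f p) -> (if j == 0 then n.2 else n.1) != 0 ->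
  int01 (fun y => f (p + y *: basis2 R j)) = int01 (fun y => f (q + y *: basis2 R j)).
Proof.
move=> cf pf nf n0.
have [r [s E]] : exists r s, p = q + r *: n + s *: basis2 R j.
  case: ifP n0 => j0 n0; rewrite /basis2 j0.
  - exists ((p.2 - q.2) / n.2), (p.1 - q.1 - (p.2 - q.2) / n.2 * n.1).
    case: p q n n0 {cf pf nf} => [p1 p2] [q1 q2] [n1 n2] /= n0.
    have E1 : p1 = q1 + (p2 - q2) / n2 * n1 + (p1 - q1 - (p2 - q2) / n2 * n1) * 1 by ring.
    have E2 : p2 = q2 + (p2 - q2) / n2 * n2 + (p1 - q1 - (p2 - q2) / n2 * n1) * 0 by field.
    by congr pair; [exact: E1|exact: E2].
  exists ((p.1 - q.1) / n.1), (p.2 - q.2 - (p.1 - q.1) / n.1 * n.2).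
  case: p q n n0 {cf pf nf} => [p1 p2] [q1 q2] [n1 n2] /= n0.
  have E1 : p1 = q1 + (p1 - q1) / n1 * n1 + (p2 - q2 - (p1 - q1) / n1 * n2) * 0 by field.
  have E2 : p2 = q2 + (p1 - q1) / n1 * n2 + (p2 - q2 - (p1 - q1) / n1 * n2) * 1 by ring.
  by congr pair; [exact: E1|exact: E2].
have cl : continuous (fun y : R => f (q + y *: basis2 R j)).
  move=> y; apply: (@continuous_comp _ _ _ (fun y : R => q + y *: basis2 R j) f); last exact: cf.
  by apply: cvgD; [exact: cvg_cst|apply: cvgZr_tmp; exact: cvg_id].
rewrite -(int01_shift s cl) => [|y].
  congr int01; apply/funext => y; rewrite E scalerDl.
  have -> : q + r *: n + s *: basis2 R j + y *: basis2 R j =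
    q + (y *: basis2 R j + s *: basis2 R j) + r *: n.
    by rewrite -!addrA; congr (_ + _); rewrite addrC -addrA addrC (addrC (s *: _)) -addrA.
  exact: nf.
by rewrite scalerDl scale1r addrA pf.
Qed.

Lemma periodic_basis2 (f : R * R -> R) j p : periodic2 f -> f (p + basis2 R j) = f p.
Proof.
move=> pf; case: p => x y; rewrite /basis2; case: ifP => _.
  by have [<- _] := pf (x, y); congr f; congr pair; rewrite /= addr0.
by have [_ <-] := pf (x, y); congr f; congr pair; rewrite /= addr0.
Qed.

(** All lines of direction e_j carry the same integral, so that Fubini leaves a single one, which
    may start at any q. *)
Lemma torus_integral_line (f : R * R -> R) (n q : R * R) (j : 'I_2) : continuous f ->
  periodic2 f -> (forall r p, f (p + r *: n) = f p) ->
  (if j == 0 then n.2 else n.1) != 0 ->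
  torus_integral f = int01 (fun y => f (q + y *: basis2 R j)).
Proof.
move=> cf pf nf n0.
have line p := int01_line p q cf (fun p => periodic_basis2 j p pf) nf n0.
rewrite -[RHS]int01_cst; case: (eqVneq j 0) => j0.
  rewrite torus_integral_iterC //; congr int01; apply/funext => y.
  rewrite -(line (0, y)); congr int01; apply/funext => x; congr f.
  by rewrite j0 /basis2 /=; congr pair; rewrite /= ?scaler0 ?[_%:A]mulr1 ?addr0 ?add0r.
rewrite torus_integral_iter //; congr int01; apply/funext => x.
rewrite -(line (x, 0)); congr int01; apply/funext => y; congr f.
by rewrite /basis2 (negbTE j0); congr pair; rewrite /= ?scaler0 ?[_%:A]mulr1 ?addr0 ?add0r.
Qed.

End Reduction.

(** * Functions which are constant in one direction *)

Section Direction.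
Context {R : realType}.
Variables (c s : R).
Hypothesis cs1 : c ^+ 2 + s ^+ 2 = 1.
Implicit Types (f : R * R -> R) (p q : R * R).

Definition invariant f := forall r p, f (p + r *: (c, s)) = f p.
Definition normal (i : 'I_2) : R := if i == 0 then - s else c.

Lemma invariantP f : Cn 1 f ->
  invariant f <-> (forall p, c * partial 0 f p + s * partial 1 f p = 0).
Proof.
move=> Cf; split=> [If p|If r p].
  have [_ E] := is_derive_dir p (c, s) Cf.
  have : is_derive p (c, s) f 0.
    apply: is_derive_pt; under eq_fun do rewrite If.
    exact: is_derive_cst.
  by move=> [_ E0]; rewrite E0 in E.
have d0 (y : R) : is_derive y (1 : R) (fun y : R => f (p + y *: (c, s))) 0.
  by apply: is_derive_line; have := is_derive_dir (p + y *: (c, s)) (c, s) Cf; rewrite /= If.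
have := @derive_lipschitz _ _ (fun=> 0) 0 d0.
move=> /(_ (fun _ => ltac:(by rewrite normr0)) r 0).
by rewrite mul0r normr_le0 subr_eq0 scale0r addr0 => /eqP.
Qed.

Lemma invariant_partial f i : Cn 1 f -> invariant f -> invariant (partial i f).
Proof.
move=> Cf If r p; rewrite -[LHS](congr1 (@^~ p) (partial_shift (r *: (c, s)) i Cf)).
by congr (partial i _ p); apply/funext => q; exact: If.
Qed.

(** The gradient of an invariant function is orthogonal to (c, s), hence a multiple of (- s, c): one
    partial derivative along an axis with nonzero component determines the other. *)
Lemma normal_partial f i j p : Cn 1 f -> invariant f -> normal j != 0 ->
  partial i f p = normal i / normal j * partial j f p.
Proof.
move=> Cf /(invariantP Cf) /(_ p) If j0; apply: (mulfI j0).
have E (x y z : R) : x != 0 -> x * (y / x * z) = y * z by move=> x0; field.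
rewrite (E _ _ _ j0).
have i2 : forall l : 'I_2, l = 0 \/ l = 1.
  by case=> [[|[|//]] l2]; [left|right]; apply/val_inj.
have n0 : normal 0 = - s by [].
have n1 : normal 1 = c by [].
move: If; case: (i2 i) => ->; case: (i2 j) => ->; rewrite ?n0 ?n1 //;
  generalize (partial 0 f p) (partial 1 f p) => x y; lra.
Qed.

Lemma normal_sqr : normal 0 ^+ 2 + normal 1 ^+ 2 = 1.
Proof. by rewrite /normal /= sqrrN addrC. Qed.

Lemma normal_partial2 f i j p : Cn 2 f -> invariant f -> normal j != 0 ->
  partial i (partial i f) p = (normal i / normal j) ^+ 2 * partial j (partial j f) p.
Proof.
move=> Cf If j0; have C1f := @CnS _ 1 f Cf.
have E : partial i f = fun p => normal i / normal j * partial j f p.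
  by apply/funext => q; exact: normal_partial.
rewrite {1}E (congr1 (@^~ p) (partialZ (normal i / normal j) i (Cn_partial j Cf))).
by rewrite (normal_partial i p (Cn_partial j Cf) (invariant_partial j C1f If) j0) mulrA -expr2.
Qed.

Lemma frame_mul (x y x' y' : R) : (c * x + s * y) * (c * x' + s * y') =
  x * x' + y * y' - (- s * x + c * y) * (- s * x' + c * y').
Proof.
have -> : x * x' + y * y' = (c ^+ 2 + s ^+ 2) * (x * x' + y * y') by rewrite cs1 mul1r.
ring.
Qed.

(** The algebra of [transport_normal]: x, y are the velocity components and z, w those of the
    momentum, primes are derivatives along e_j, and l is the component of (n0, n1) along e_j. *)
Lemma transport_frame (n0 n1 l x y z w x' y' z' w' : R) : l != 0 ->
  n0 * (x * (n0 / l * z') + y * (n1 / l * z') + (z * (n0 / l * x') + w * (n0 / l * y'))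
    + z * (n0 / l * x' + n1 / l * y')) +
  n1 * (x * (n0 / l * w') + y * (n1 / l * w') + (z * (n1 / l * x') + w * (n1 / l * y'))
    + w * (n0 / l * x' + n1 / l * y')) =
  l^-1 * ((n0 * x + n1 * y) * (n0 * z' + n1 * w') + 2 * (n0 * z + n1 * w) * (n0 * x' + n1 * y')
    + ((n0 ^+ 2 + n1 ^+ 2) * (z * x' + w * y') - (n0 * z + n1 * w) * (n0 * x' + n1 * y'))).
Proof. by move=> l0; field. Qed.

Section Field.
Variables (v : 'I_2 -> R * R -> R) (j : 'I_2).
Hypotheses (Cv : forall i, Cn 3 (v i)) (Iv : forall i, invariant (v i)) (j0 : normal j != 0).
Notation dj := (partial j).

Let C2 i : Cn 2 (v i). Proof. exact: CnS (Cv i). Qed.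
Let C1 i : Cn 1 (v i). Proof. exact: CnS (C2 i). Qed.

(** The two second derivatives carry the factors (w_i / w_j)^2, which add up to w_j^-2 because w is
    a unit vector. *)
Lemma momentum_normal i p : momentum v i p = v i p - (normal j ^+ 2)^-1 * dj (dj (v i)) p.
Proof.
rewrite /momentum sum_ord2 (normal_partial2 0 p (C2 i) (Iv i) j0).
rewrite (normal_partial2 1 p (C2 i) (Iv i) j0).
generalize (dj (dj (v i)) p) (v i p) => x y; have := normal_sqr.
have E (n0 n1 l : R) : l != 0 -> n0 ^+ 2 + n1 ^+ 2 = 1 ->
    y - ((n0 / l) ^+ 2 * x + (n1 / l) ^+ 2 * x) = y - (l ^+ 2)^-1 * x.
  move=> l0 n1E; have -> : (n0 / l) ^+ 2 * x + (n1 / l) ^+ 2 * x =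
    (l ^+ 2)^-1 * ((n0 ^+ 2 + n1 ^+ 2) * x) by field.
  by rewrite n1E mul1r.
exact: E.
Qed.

Lemma partial_momentum_normal i p : dj (momentum v i) p =
  dj (v i) p - (normal j ^+ 2)^-1 * dj (dj (dj (v i))) p.
Proof.
have -> : momentum v i = fun p => v i p - (normal j ^+ 2)^-1 * dj (dj (v i)) p.
  by apply/funext => q; exact: momentum_normal.
have C1d := Cn_partial j (Cn_partial j (Cv i)).
rewrite (congr1 (@^~ p) (partialB j (C1 i) (CnZ (normal j ^+ 2)^-1 C1d))).
by rewrite (congr1 (@^~ p) (partialZ (normal j ^+ 2)^-1 j C1d)).
Qed.

Lemma invariant_momentum i : invariant (momentum v i).
Proof.
move=> r p; rewrite !momentum_normal Iv.
have I1 := invariant_partial j (C1 i) (Iv i).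
by rewrite (invariant_partial j (Cn_partial j (C2 i)) I1).
Qed.

Lemma energy_density_normal p : energy_density v p =
  (normal 0 * v 0 p + normal 1 * v 1 p) ^+ 2 + (c * v 0 p + s * v 1 p) ^+ 2 +
  (normal j ^+ 2)^-1 * ((normal 0 * dj (v 0) p + normal 1 * dj (v 1) p) ^+ 2
    + (c * dj (v 0) p + s * dj (v 1) p) ^+ 2).
Proof.
have np i l := normal_partial i p (C1 l) (Iv l) j0.
rewrite energy_densityE !sum_ord2 (np 0 0) (np 0 1) (np 1 0) (np 1 1).
have E (x y : R) : (normal 0 * x + normal 1 * y) ^+ 2 + (c * x + s * y) ^+ 2 = x ^+ 2 + y ^+ 2.
  have -> : x ^+ 2 + y ^+ 2 = (c ^+ 2 + s ^+ 2) * (x ^+ 2 + y ^+ 2) by rewrite cs1 mul1r.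
  by rewrite /normal /=; ring.
rewrite !E; generalize (dj (v 0) p) (dj (v 1) p) (v 0 p) (v 1 p) => x y x' y'.
have : normal 0 ^+ 2 + normal 1 ^+ 2 = 1 := normal_sqr.
have F (n0 n1 l : R) : l != 0 -> n0 ^+ 2 + n1 ^+ 2 = 1 ->
    x' ^+ 2 + ((n0 / l * x) ^+ 2 + (n1 / l * x) ^+ 2) +
    (y' ^+ 2 + ((n0 / l * y) ^+ 2 + (n1 / l * y) ^+ 2)) =
    x' ^+ 2 + y' ^+ 2 + (l ^+ 2)^-1 * (x ^+ 2 + y ^+ 2).
  move=> l0 nE; rewrite -[x ^+ 2 + y ^+ 2]mul1r -nE; field.
  exact: l0.
exact: F.
Qed.

(** With M = w . m this is V M_w + 2 M V_w + (n . m) U_w. One term M V_w comes from the divergence,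
    which is V_w; the other comes with (n . m) U_w from splitting m . u_w in the frame (w, n). *)
Lemma transport_normal (m : 'I_2 -> R * R -> R) p : (forall i, Cn 1 (m i)) ->
  (forall i, invariant (m i)) ->
  normal 0 * transport v m 0 p + normal 1 * transport v m 1 p =
  (normal j)^-1 * ((normal 0 * v 0 p + normal 1 * v 1 p)
      * (normal 0 * dj (m 0) p + normal 1 * dj (m 1) p)
    + 2 * (normal 0 * m 0 p + normal 1 * m 1 p)
      * (normal 0 * dj (v 0) p + normal 1 * dj (v 1) p)
    + (c * m 0 p + s * m 1 p) * (c * dj (v 0) p + s * dj (v 1) p)).
Proof.
move=> C1m Im; rewrite /transport !sum_ord2.
have np i l := normal_partial i p (C1 l) (Iv l) j0.
have nm i l := normal_partial i p (C1m l) (Im l) j0.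
rewrite (np 0 0) (np 0 1) (np 1 0) (np 1 1) (nm 0 0) (nm 0 1) (nm 1 0) (nm 1 1).
rewrite frame_mul; move: (dj (v 0) p) (dj (v 1) p) (dj (m 0) p) (dj (m 1) p).
move: (v 0 p) (v 1 p) (m 0 p) (m 1 p) => x y z w x' y' z' w'.
have -> : z * x' + w * y' = (normal 0 ^+ 2 + normal 1 ^+ 2) * (z * x' + w * y').
  by rewrite normal_sqr mul1r.
exact: (transport_frame _ _ _ _ _ _ _ _ _ _ j0).
Qed.

End Field.

End Direction.

(** * The strain and the energy on a coordinate line *)

Section LineField.
Context {R : realType}.

Lemma line_continuous (f : R * R -> R) (q w : R * R) : continuous f ->
  continuous (fun y : R => f (q + y *: w)).
Proof.
move=> cf y; apply: (@continuous_comp _ _ _ (fun y : R => q + y *: w) f); last exact: cf.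
by apply: cvgD; [exact: cvg_cst|apply: cvgZr_tmp; exact: cvg_id].
Qed.

Lemma line_combination_derive (a b : R) (f g : R * R -> R) (q : R * R) j (y : R) :
  Cn 1 f -> Cn 1 g ->
  is_derive y (1 : R) (fun y : R => a * f (q + y *: basis2 R j) + b * g (q + y *: basis2 R j))
    (a * partial j f (q + y *: basis2 R j) + b * partial j g (q + y *: basis2 R j)).
Proof.
move=> Cf Cg.
have df := is_derive_line (Cn_derive j (q + y *: basis2 R j) Cf).
have dg := is_derive_line (Cn_derive j (q + y *: basis2 R j) Cg).
exact: (is_deriveD (is_deriveZ a df) (is_deriveZ b dg)).
Qed.

Lemma line_combination_continuous (a b : R) (f g : R * R -> R) (q w : R * R) :
  continuous f -> continuous g ->
  continuous (fun y : R => a * f (q + y *: w) + b * g (q + y *: w)).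
Proof.
move=> cf cg; apply: continuousD1; apply: continuousZ1; exact: line_continuous.
Qed.

Lemma line_periodic (f : R * R -> R) (q : R * R) j : periodic2 f ->
  f (q + (1 : R) *: basis2 R j) = f (q + (0 : R) *: basis2 R j).
Proof. by move=> pf; rewrite scale1r scale0r addr0 periodic_basis2. Qed.

Lemma derive_at_min (f : R -> R) (d : R) : is_derive (0 : R) (1 : R) f d ->
  (forall y, f 0 <= f y) -> d = 0.
Proof.
move=> /is_derive_epsP df fmin; apply/eqP/negPn/negP => d0.
have nd : 0 < `|d| / 2 by rewrite divr_gt0 // normr_gt0.
have [r r0 H] := df _ nd.
have sr : 0 < r / 2 by lra.
have hr : `|r / 2| < r by rewrite gtr0_norm //; lra.
have hr' : `|- (r / 2)| < r by rewrite normrN.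
have := H _ hr; have := H _ hr'; rewrite !add0r normrN (gtr0_norm sr).
rewrite !ler_norml => /andP[_ h1] /andP[_ h2].
have := fmin (r / 2); have := fmin (- (r / 2)) => h3 h4.
have h5 : - (r / 2 * d) <= `|d| / 2 * (r / 2) by lra.
have h6 : r / 2 * d <= `|d| / 2 * (r / 2) by lra.
case: (ltP 0 d) => d1.
  by rewrite (gtr0_norm d1) in h5 h6; nra.
by rewrite (ler0_norm d1) in h5 h6; have : d < 0; [rewrite lt_neqAle d0|nra].
Qed.

Variables (c s : R).
Hypothesis cs1 : c ^+ 2 + s ^+ 2 = 1.
Notation n := (normal c s).

(** The derivative along w = (- s, c) of the component w . u, which is the quantity in the blow-up
    condition. *)
Definition strain (v : 'I_2 -> R * R -> R) p := s ^+ 2 * partial 0 (v 0) p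
  - s * c * partial 1 (v 0) p - s * c * partial 0 (v 1) p + c ^+ 2 * partial 1 (v 1) p.

Variables (v : 'I_2 -> R * R -> R) (j : 'I_2).
Hypotheses (Cv : forall i, Cn 3 (v i)) (Iv : forall i, invariant c s (v i)).
Hypothesis (j0 : n j != 0).
Notation dj := (partial j).
Notation e := (basis2 R j).

Let C2 i : Cn 2 (v i). Proof. exact: CnS (Cv i). Qed.
Let C1 i : Cn 1 (v i). Proof. exact: CnS (C2 i). Qed.

Lemma strain_normal p :
  strain v p = (n j)^-1 * (n 0 * dj (v 0) p + n 1 * dj (v 1) p).
Proof.
have np i l := normal_partial i p (C1 l) (Iv l) j0.
rewrite /strain (np 0 0) (np 0 1) (np 1 0) (np 1 1) {np}.
move: j0; have -> : n 0 = - s by [].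
have -> : n 1 = c by [].
generalize (n j) (dj (v 0) p) (dj (v 1) p) => l x y l0.
have -> : l^-1 * (- s * x + c * y) = (c ^+ 2 + s ^+ 2) * (l^-1 * (- s * x + c * y)).
  by rewrite cs1 mul1r.
by field.
Qed.

Variables (q : R * R) (K K1 : R -> R).
Hypotheses (dK : forall y, is_derive y (1 : R) K (K1 y))
  (dK1 : forall y, is_derive y (1 : R) K1 (n j ^+ 2 * K y))
  (pK : K 1 = K 0) (jK1 : K1 1 - K1 0 = n j ^+ 2)
  (bK : forall y, 0 <= y <= 1 -> 1 / 2 <= K y <= 3 / 2).

Let a := (n j ^+ 2)^-1.
Let ab : a * n j ^+ 2 = 1. Proof. by rewrite /a mulVf // expf_neq0. Qed.
(** On the line through q this gives V for the weights (n 0, n 1) and U for the weights (c, s),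
    together with their derivatives along the line. *)
Let comb (x y : R) (g : 'I_2 -> R * R -> R) (r : R) :=
  x * g 0 (q + r *: e) + y * g 1 (q + r *: e).
Let dcomb x y g r : (forall i, Cn 1 (g i)) ->
  is_derive r (1 : R) (comb x y g) (comb x y (fun i => dj (g i)) r).
Proof. by move=> Cg; exact: line_combination_derive. Qed.
Let ccomb x y g : (forall i, Cn 0 (g i)) -> continuous (comb x y g).
Proof. by move=> Cg; apply: line_combination_continuous; apply: Cn_continuous; exact: Cg. Qed.
Let pcomb x y g : (forall i, Cn 0 (g i)) -> comb x y g 1 = comb x y g 0.
Proof. by move=> Cg; congr (_ * _ + _ * _); apply: line_periodic; apply: Cn_periodic; exact: Cg. Qed.

(** It expresses the strain through the momentum, whose time derivative is known. The line is
    parametrised from q, so that the jump of K1 sits at q. *)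
Lemma strain_representation : strain v q = - ((n j)^-1 *
  int01 (fun y => K1 y * (n 0 * momentum v 0 (q + y *: e)
    + n 1 * momentum v 1 (q + y *: e)))).
Proof.
have Cd i : Cn 2 (dj (v i)) := Cn_partial j (Cv i).
have Cdd i : Cn 1 (dj (dj (v i))) := Cn_partial j (Cd i).
have := @line_representation _ a (n j ^+ 2) (comb (n 0) (n 1) v)
  (comb (n 0) (n 1) (fun i => dj (v i)))
  (comb (n 0) (n 1) (fun i => dj (dj (v i)))) K K1 ab
  (fun y => @dcomb _ _ _ y C1) (fun y => @dcomb _ _ _ y (fun i => CnS (Cd i)))
  (@ccomb _ _ _ (fun i => CnS (Cdd i))) (@pcomb _ _ _ (fun i => CnS (C1 i)))
  (@pcomb _ _ _ (fun i => Cn_le (isT : (0 <= 2)%N) (Cd i))) dK dK1 pK jK1.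
move=> H; rewrite strain_normal -mulrN; congr (_ * _).
have -> : n 0 * dj (v 0) q + n 1 * dj (v 1) q =
    comb (n 0) (n 1) (fun i => dj (v i)) 0 by rewrite /comb scale0r addr0.
apply: oppr_inj; rewrite opprK -H.
congr int01; apply/funext => y; congr (_ * _).
rewrite !(momentum_normal cs1 Cv Iv j0) /comb -/a.
by ring.
Qed.

Lemma energy_line : energy v = int01 (fun y =>
  comb (n 0) (n 1) v y ^+ 2 + comb c s v y ^+ 2 +
  a * (comb (n 0) (n 1) (fun i => dj (v i)) y ^+ 2
    + comb c s (fun i => dj (v i)) y ^+ 2)).
Proof.
have C1e : Cn 0 (energy_density v).
  by apply: Cn_sum => i; exact: grad_dot_Cn.
have Ie r p : energy_density v (p + r *: (c, s)) = energy_density v p.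
  rewrite !(energy_density_normal cs1 Cv Iv j0) !Iv.
  have Id i : invariant c s (dj (v i)) := invariant_partial j (C1 i) (Iv i).
  by rewrite !Id.
have n0 : (if j == 0 then (c, s).2 else (c, s).1) != 0.
  by move: j0; rewrite /normal; case: ifP => // _; rewrite oppr_eq0.
rewrite /energy (torus_integral_line q (Cn_continuous C1e) (Cn_periodic C1e) Ie n0).
by congr int01; apply/funext => y; exact: (energy_density_normal cs1 Cv Iv j0).
Qed.

(** The left-hand side is the time derivative of the strain at q: the minus sign of the
    representation cancels the one in front of the transport term. *)
Lemma strain_riccati : (forall p, strain v q <= strain v p) ->
  (n j)^-1 * int01 (fun y => K1 y *
    (n 0 * transport v (momentum v) 0 (q + y *: e)
      + n 1 * transport v (momentum v) 1 (q + y *: e))) <=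
  - (strain v q ^+ 2 / 2) + energy v.
Proof.
move=> qmin.
have Cd i : Cn 2 (dj (v i)) := Cn_partial j (Cv i).
have Cdd i : Cn 1 (dj (dj (v i))) := Cn_partial j (Cd i).
have Cddd i : Cn 0 (dj (dj (dj (v i)))) := Cn_partial j (Cdd i).
have le02 : (0 <= 2)%N by [].
pose V := comb (n 0) (n 1) v; pose U := comb c s v.
pose V1 := comb (n 0) (n 1) (fun i => dj (v i)).
pose U1 := comb c s (fun i => dj (v i)).
pose V2 := comb (n 0) (n 1) (fun i => dj (dj (v i))).
pose U2 := comb c s (fun i => dj (dj (v i))).
pose V3 := comb (n 0) (n 1) (fun i => dj (dj (dj (v i)))).
have a1 : 1 <= a.
  rewrite /a invf_ge1 ?exprn_even_gt0 //.
  have := normal_sqr cs1; rewrite /normal /=.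
  by case: ifP => _; have := sqr_ge0 c; have := sqr_ge0 (- s); lra.
have sV y : strain v (q + y *: e) = (n j)^-1 * V1 y by rewrite strain_normal.
have dV1 y : is_derive y (1 : R) V1 (V2 y) := @dcomb _ _ _ y (fun i => CnS (Cd i)).
have V20 : V2 0 = 0.
  have : (n j)^-1 * V2 0 = 0.
    apply: (@derive_at_min (fun y => (n j)^-1 * V1 y)).
    by move=> y; rewrite -!sV scale0r addr0.
  by move=> /eqP; rewrite mulf_eq0 invr_eq0 (negbTE j0) => /eqP.
have := @line_riccati _ a (n j ^+ 2) V V1 V2 V3 U U1 U2 K K1 ab a1
  (fun y => @dcomb _ _ _ y C1) dV1 (fun y => @dcomb _ _ _ y Cdd) (@ccomb _ _ _ Cddd)
  (@pcomb _ _ _ (fun i => CnS (C1 i))) (@pcomb _ _ _ (fun i => Cn_le le02 (Cd i)))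
  (@pcomb _ _ _ (fun i => CnS (Cdd i)))
  (fun y => @dcomb _ _ _ y C1) (fun y => @dcomb _ _ _ y (fun i => CnS (Cd i)))
  (@ccomb _ _ _ (fun i => CnS (Cdd i)))
  (@pcomb _ _ _ (fun i => CnS (C1 i))) (@pcomb _ _ _ (fun i => Cn_le le02 (Cd i)))
  dK dK1 pK jK1 bK V20.
have -> : strain v q ^+ 2 / 2 = a / 2 * V1 0 ^+ 2.
  by rewrite -[q]addr0 -(scale0r e) sV exprMn exprVn -/a; field.
rewrite -energy_line; apply: le_trans; rewrite le_eqVlt; apply/orP; left; apply/eqP.
have C1m i : Cn 1 (momentum v i) by exact: helmholtz_Cn.
have Im i : invariant c s (momentum v i) := invariant_momentum cs1 Cv Iv j0 i.
have cN := @line_transport_continuous _ a (n j ^+ 2) V V1 V2 V3 U U1 U2 K K1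
  (fun y => @dcomb _ _ _ y C1) dV1 (fun y => @dcomb _ _ _ y Cdd) (@ccomb _ _ _ Cddd)
  (fun y => @dcomb _ _ _ y C1) (fun y => @dcomb _ _ _ y (fun i => CnS (Cd i)))
  (@ccomb _ _ _ (fun i => CnS (Cdd i))) dK1.
have aE : a = (n j)^-1 * (n j)^-1 by rewrite -expr2 exprVn.
rewrite {1}aE -mulrA; congr (_ * _); rewrite -(int01Z _ cN).
congr int01; apply/funext => y; rewrite mulrCA; congr (_ * _).
rewrite (transport_normal cs1 Cv Iv j0 _ C1m Im); congr (_ * _).
rewrite !(momentum_normal cs1 Cv Iv j0) !(partial_momentum_normal cs1 Cv Iv j0) -/a.
rewrite /V /V1 /V2 /V3 /U /U1 /U2 /comb.
generalize (dj (dj (dj (v 0))) (q + y *: e)) (dj (dj (dj (v 1))) (q + y *: e)).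
generalize (dj (dj (v 0)) (q + y *: e)) (dj (dj (v 1)) (q + y *: e)).
generalize (dj (v 0) (q + y *: e)) (dj (v 1) (q + y *: e)).
generalize (v 0 (q + y *: e)) (v 1 (q + y *: e)) a => v0 v1 b x y0 x' y' x'' y''.
ring.
Qed.

End LineField.

(** * Riccati inequality *)

Section Blowup.
Context {R : realType}.

Lemma eq_is_derive (F G : R -> R) (t d : R) : 0 < t -> (forall s, 0 < s -> F s = G s) ->
  is_derive t (1 : R) G d -> is_derive t (1 : R) F d.
Proof.
move=> t0 FG /is_derive_epsP dG; apply/is_derive_epsP => e e0.
have [r r0 H] := dG e e0; exists (Num.min r t); first by rewrite lt_min r0.
move=> h; rewrite lt_min => /andP[hr ht]; rewrite !FG ?H //.
by move: ht; rewrite ltr_norml => /andP[h1 _]; lra.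
Qed.

(** Differentiation under the integral: the expansion in time is uniform along the line, and the
    error is multiplied by the integral of |K1| at most. *)
Lemma kernel_time_derivative (K1 : R -> R) (g b : R -> R * R -> R) (q w : R * R) (t : R) :
  continuous K1 -> admissible g -> admissible b ->
  (forall s : R, 0 < s -> forall p, is_derive s (1 : R) (fun s => g s p) (b s p)) -> 0 < t ->
  is_derive t (1 : R) (fun s => int01 (fun y => K1 y * g s (q + y *: w)))
    (int01 (fun y => K1 y * b t (q + y *: w))).
Proof.
move=> cK ag ab dg t0; apply/is_derive_epsP => e e0.
have cN : continuous (fun y => `|K1 y|).
  by move=> y; apply: cvg_norm; exact: cK.
pose M := int01 (fun y => `|K1 y|).
have M0 : 0 <= M.
  rewrite /M -[X in X <= _](int01_cst (0 : R)); apply: le_int01 => //.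
  by move=> y; exact: cvg_cst.
have M1 : 0 < M + 1 by lra.
have [d /andP[d0 dt] H] := uniform_time_derivative dg ab t0 (divr_gt0 e0 M1).
exists d => // h hd.
have th : 0 <= t + h by move: hd; rewrite ltr_norml => /andP[h1 _]; lra.
have cl (f : R -> R * R -> R) s : admissible f -> 0 <= s ->
    continuous (fun y => K1 y * f s (q + y *: w)).
  move=> af s0; apply: continuousM1 => //; apply: line_continuous.
  exact: admissible_continuous af s0.
have c1 := cl _ _ ag th; have c2 := cl _ _ ag (ltW t0); have c3 := cl _ _ ab (ltW t0).
have Z (x : R) (f : R -> R) : continuous f -> x * int01 f = int01 (fun y => x * f y).
  by move=> cf; rewrite int01Z.
rewrite -[- int01 _]mulN1r -[- (h * _)]mulNr (Z (-1) _ c2) (Z (- h) _ c3).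
have c2' := @continuousZ1 _ (-1) _ c2; have c3' := @continuousZ1 _ (- h) _ c3.
rewrite -(int01D c1 c2') -(int01D (continuousD1 c1 c2') c3').
set r := fun y => _.
have cr : continuous r := continuousD1 (continuousD1 c1 c2') c3'.
have eM : e / (M + 1) * `|h| * M <= e * `|h|.
  have -> : e / (M + 1) * `|h| * M = e * `|h| * (M / (M + 1)).
    by field; rewrite gt_eqF.
  by rewrite ler_piMr ?mulr_ge0 ?(ltW e0) // ler_pdivrMr // mul1r; lra.
have rE y : `|r y| <= e / (M + 1) * `|h| * `|K1 y|.
  have -> : r y = K1 y * (g (t + h) (q + y *: w) - g t (q + y *: w) - h * b t (q + y *: w)).
    by rewrite /r; ring.
  rewrite normrM mulrC ler_wpM2r //; exact: H.
apply: le_trans eM; rewrite /M (Z _ _ cN) ler_norml; apply/andP; split.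
  rewrite lerNl -mulN1r (Z _ _ cr); apply: le_int01 => [||y _].
  - exact: continuousZ1.
  - exact: continuousZ1.
  - by rewrite mulN1r; apply: le_trans (rE y); rewrite -normrN ler_norm.
apply: le_int01 => // [|y _]; first exact: continuousZ1.
exact: le_trans (ler_norm _) (rE y).
Qed.

Lemma decreasing_right (F : R -> R) (t d : R) : is_derive t (1 : R) F d -> d < 0 ->
  exists2 r, 0 < r & forall s, t <= s < t + r -> F s <= F t.
Proof.
move=> /is_derive_epsP dF d0; have nd : 0 < - d by lra.
have [r r0 H] := dF _ nd; exists r => // s /andP[ts sr].
have st : `|s - t| < r by rewrite ger0_norm; lra.
have := H _ st; rewrite (_ : t + (s - t) = s); last by ring.
have s0 : 0 <= s - t by lra.
by rewrite (ger0_norm s0) ler_norml => /andP[_]; lra.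
Qed.

(** For a solution of y' = - del y^2 the function - 1 / y is affine in time. Hence the existence of
    a point with l t D <= -1, for an affine l that decreases from 1 / r0 to 0, is propagated on
    [t1, T]; at T it reads 0 <= -1. *)
Lemma riccati_blowup (D : R -> R * R -> R) (E0 : R) (p0 : R * R) : admissible D ->
  (forall (t : R) q, 0 < t -> (forall p, D t q <= D t p) ->
    exists2 d, is_derive t (1 : R) (fun s => D s q) d & d <= - (D t q ^+ 2 / 2) + E0) ->
  0 <= E0 -> ~ D 0 p0 < - Num.sqrt (2 * E0).
Proof.
move=> aD ric E00 D0.
pose S := Num.sqrt (2 * E0); have S0 : 0 <= S := sqrtr_ge0 _.
have SS : S ^+ 2 = 2 * E0 by rewrite sqr_sqrtr // mulr_ge0.
(* The midpoint leaves a margin on both sides: above S for the Riccati rate, below - D 0 p0 for a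
   small delay in time. *)
pose r0 := (- D 0 p0 + S) / 2.
have r0S : S < r0 by rewrite /r0; move: D0; rewrite -/S; lra.
have r0D : 0 < - D 0 p0 - r0 by rewrite /r0; move: D0; rewrite -/S; lra.
have r00 : 0 < r0 by lra.
have r0E : 2 * E0 < r0 ^+ 2 by rewrite -SS ltr_pXn2r // ?nnegrE // ltW.
(* The differential inequality is available for t > 0 only; by continuity the value at p0 is still
   at most - r0 at some t1 > 0. *)
have [t1 t10 Dt1] : exists2 t1, 0 < t1 & D t1 p0 <= - r0.
  have [d d0 H] := aD.2 0 _ (lexx 0) r0D.
  have d2 : 0 < d / 2 by rewrite divr_gt0.
  have dd : `|d / 2 - 0| < d by rewrite subr0 gtr0_norm //; lra.
  exists (d / 2) => //; have := H _ (ltW d2) dd p0.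
  by rewrite ler_norml => /andP[_]; lra.
(* At D = - r0 the inequality leaves the rate r0^2 / 2 - E0. [del] makes [del * r0 ^+ 2] half of it,
   and [gap] gives the strict inequality for all larger values as well. *)
pose del := (r0 ^+ 2 - 2 * E0) / (4 * r0 ^+ 2).
have r20 : 0 < r0 ^+ 2 by rewrite exprn_gt0.
have delr : del * r0 ^+ 2 = (r0 ^+ 2 - 2 * E0) / 4 by rewrite /del; field; rewrite gt_eqF.
have del0 : 0 < del.
  have h : 0 < r0 ^+ 2 - 2 * E0 by rewrite subr_gt0.
  by rewrite /del divr_gt0 // mulr_gt0.
have del2 : del < 1 / 2.
  by rewrite -(ltr_pM2r r20) delr; lra.
have gap x : r0 <= x -> del * x ^+ 2 < x ^+ 2 / 2 - E0.
  move=> rx; have x2 : r0 ^+ 2 <= x ^+ 2 by rewrite ler_pXn2r // ?nnegrE //; lra.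
  have : (1 / 2 - del) * r0 ^+ 2 <= (1 / 2 - del) * x ^+ 2 by rewrite ler_wpM2l // subr_ge0 ltW.
  by rewrite !mulrBl delr; lra.
pose l t := r0^-1 - del * (t - t1).
pose T := t1 + r0^-1 / del.
have ri0 : 0 < r0^-1 by rewrite invr_gt0.
have t1T : t1 <= T by rewrite /T lerDl divr_ge0 // ltW.
have lT : l T = 0 by rewrite /l /T; field; rewrite !gt_eqF.
have dl (t : R) : is_derive t (1 : R) l (- del).
  by apply: is_derive_eq; rewrite /GRing.scale /=; ring.
have al : admissible (fun t _ => l t).
  split; first by move=> t _; have [] := @Cn_cst R 0 (l t).
  move=> t e _ e0; exists (e / del); first by rewrite divr_gt0.
  move=> s _ st _; rewrite (_ : l s - l t = - (del * (s - t))); last by rewrite /l; ring.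
  by rewrite normrN normrM (gtr0_norm del0) mulrC -ler_pdivlMr // ltW.
have aG := admissibleM al aD.
have [p] : exists p, l T * D T p <= -1.
  apply: (@real_induction _ (fun t => exists p, l t * D t p <= -1) t1 T t1T) => [|||].
  - exists p0; rewrite /l subrr mulr0 subr0.
    by rewrite mulrC ler_pdivrMr // mulN1r.
  - move=> t /andP[t1t tT] [p Pp].
    have t0 : 0 < t by lra.
    have lt0 : 0 < l t.
      rewrite -lT /l ltrD2l ltrN2 ltr_pM2l //; lra.
    have lr : l t <= r0^-1 by rewrite /l gerBl mulr_ge0 ?(ltW del0) // subr_ge0.
    have [q qmin] := periodic_min (admissible_periodic aD (ltW t0)) (admissible_continuous aD (ltW t0)).
    have Pq : l t * D t q <= -1 by apply: le_trans Pp; rewrite ler_pM2l.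
    have Dq : D t q < 0 by rewrite -(ltr_pM2l lt0) mulr0; lra.
    have rD : r0 <= - D t q.
      have : l t * - D t q <= r0^-1 * - D t q by rewrite ler_wpM2r //; lra.
      rewrite mulrN => h; have h1 : 1 <= r0^-1 * - D t q by lra.
      by move: h1; rewrite mulrC ler_pdivlMr // mul1r.
    have [d dD dle] := ric t q t0 qmin.
    have dG := is_deriveM (dl t) dD.
    (* With x = - D t q >= r0, [gap] puts the derivative of l D strictly below del x (1 - l x),
       which is at most 0 because l x >= 1. The point q thus remains a witness for a short time. *)
    have neg : l t *: d + D t q *: - del < 0.
      rewrite /GRing.scale /=; have := gap _ rD; rewrite sqrrN => gp.
      have h1 : l t * d < l t * - (del * D t q ^+ 2) by rewrite ltr_pM2l //; lra.
      have h2 : del * - D t q * (1 + l t * D t q) <= 0.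
        have Dq0 : 0 <= - D t q by lra.
        have h3 : 1 + l t * D t q <= 0 by lra.
        exact: mulr_ge0_le0 (mulr_ge0 (ltW del0) Dq0) h3.
      have E : l t * - (del * D t q ^+ 2) + D t q * - del = del * - D t q * (1 + l t * D t q) by ring.
      lra.
    have [r rr H] := decreasing_right dG neg.
    by exists r => // s /H Hs; exists q; exact: le_trans Hs Pq.
  - move=> t /andP[t1t tT] Ps.
    have t0 : 0 <= t by lra.
    (* If l D were above -1 at its minimum at time t, continuity in time, uniform in space, would
       keep it above -1 at every point just before t. *)
    have [q qmin] := periodic_min (admissible_periodic aG t0) (admissible_continuous aG t0).
    have [Pq|Nq] := leP (l t * D t q) (-1); first by exists q.
    have n0 : 0 < (l t * D t q + 1) / 2 by lra.
    have [d d0 H] := aG.2 t _ t0 n0.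
    pose s := Num.max t1 (t - d / 2).
    have t1s : t1 <= s by rewrite le_max lexx.
    have st : s < t by rewrite gt_max t1t /=; lra.
    have ds : t - d / 2 <= s by rewrite le_max lexx orbT.
    have [|p Pp] := Ps s; first by rewrite t1s.
    have s0 : 0 <= s by lra.
    have sd : `|s - t| < d by rewrite ltr_norml; apply/andP; split; lra.
    have := H s s0 sd p.
    have := qmin p => /= qp.
    by rewrite ler_norml => /andP[h _]; lra.
  - by rewrite t1T lexx.
by rewrite lT mul0r; lra.
Qed.

End Blowup.

(** * The Riccati inequality for the strain of a solution *)

Section StrainEvolution.
Context {R : realType}.
Variables (c s : R) (u : R -> 'I_2 -> R * R -> R) (j : 'I_2).
Hypothesis cs1 : c ^+ 2 + s ^+ 2 = 1.
Hypothesis su : smooth_solution u.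
Hypothesis Iu0 : forall i, invariant c s (u 0 i).
Hypothesis j0 : normal c s j != 0.
Notation n := (normal c s).
Notation e := (basis2 R j).

Let Cu t i : 0 <= t -> Cn 3 (u t i). Proof. by case: su => H _ _ _; exact: H. Qed.

Lemma invariant_solution t i : 0 <= t -> invariant c s (u t i).
Proof.
by move=> t0 r p; apply: translation_invariant su t0 _ => l q; exact: Iu0.
Qed.

Lemma strain_admissible : admissible (fun t => strain c s (u t)).
Proof.
have ap i l : admissible (fun t => partial l (u t i)).
  by case: su => _ H _ _; exact: Cn_time_admissible (Cn_time_partial l (H i)).
apply: admissibleD; last exact: admissibleZ.
by apply: admissibleB; last exact: admissibleZ; apply: admissibleB; exact: admissibleZ.
Qed.

Lemma strain_derivative (t : R) q : 0 < t ->
  (forall p, strain c s (u t) q <= strain c s (u t) p) ->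
  exists2 d, is_derive t (1 : R) (fun t => strain c s (u t) q) d &
    d <= - (strain c s (u t) q ^+ 2 / 2) + energy (u 0).
Proof.
move=> t0 qmin.
have L0 : 0 < `|n j| by rewrite normr_gt0.
have L1 : `|n j| <= 1.
  rewrite -(@expr_le1 _ 2) // real_normK ?num_real //.
  have := normal_sqr cs1; rewrite /normal /=.
  by case: ifP => _; have := sqr_ge0 c; have := sqr_ge0 (- s); lra.
have [K [K1 []]] := green_kernel L0 L1.
rewrite real_normK ?num_real // => dK dK1 [pK jK1] bK.
pose T t p := n 0 * transport (u t) (momentum (u t)) 0 p
  + n 1 * transport (u t) (momentum (u t)) 1 p.
pose m t p := n 0 * momentum (u t) 0 p + n 1 * momentum (u t) 1 p.
have aT : admissible (fun t p => - T t p).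
  by apply: admissibleN; apply: admissibleD; apply: admissibleZ; exact: transport_admissible.
have am : admissible m.
  by apply: admissibleD; apply: admissibleZ; exact: momentum_admissible.
have dm (r : R) : 0 < r -> forall p, is_derive r (1 : R) (fun r => m r p) (- T r p).
  move=> r0 p; case: su => _ _ _ dmu.
  have := is_deriveD (is_deriveZ (n 0) (dmu r 0 p r0)) (is_deriveZ (n 1) (dmu r 1 p r0)).
  by congr is_derive; rewrite /T /GRing.scale /=; ring.
have dI := kernel_time_derivative q e (is_derive_continuousT dK1) am aT dm t0.
have cT : continuous (fun y : R => K1 y * T t (q + y *: e)).
  apply: continuousM1; first exact: is_derive_continuousT dK1.
  apply: line_continuous.
  have := admissible_continuous (admissibleN aT) (ltW t0).
  by under eq_fun do rewrite opprK.
exists ((n j)^-1 * int01 (fun y => K1 y * T t (q + y *: e))); last first.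
  apply: le_trans (strain_riccati cs1 (fun i => Cu i (ltW t0))
    (fun i => invariant_solution i (ltW t0)) j0 dK dK1 pK jK1 bK qmin) _.
  by rewrite lerD2l; exact: energy_le su (ltW t0).
(* The representation holds at every positive time with the same kernel and the same q, so the
   strain may be replaced by it before differentiating. *)
apply: (@eq_is_derive _ _ (fun r => - ((n j)^-1 * int01 (fun y => K1 y * m r (q + y *: e))))) => //.
  move=> r r0; exact: (strain_representation cs1 (fun i => Cu i (ltW r0))
    (fun i => invariant_solution i (ltW r0)) j0 q dK dK1 pK jK1).
have := is_deriveN (is_deriveZ (n j)^-1 dI).
congr is_derive; rewrite /GRing.scale /= -mulrN; congr (_ * _).
rewrite -mulN1r -int01Z; last first.
  by move=> y; under eq_fun do rewrite mulrN; apply: cvgN; exact: cT.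
by congr int01; apply/funext => y; ring.
Qed.

End StrainEvolution.

Lemma H1_norm_energy (R : realType) (v : 'I_2 -> R * R -> R) : H1_norm v = Num.sqrt (energy v).
Proof.
rewrite /H1_norm /energy; congr (Num.sqrt (torus_integral _)); apply/funext => p.
by rewrite energy_densityE big_split.
Qed.

Unset Implicit Arguments.

Theorem theorem3p1 (R : realType) (k : R) (u0 : 'I_2 -> R * R -> R)
    (Tmax : \bar R) (u : R -> 'I_2 -> R * R -> R) (theta : R) (p0 : R * R)
    (hk : 4 < k)
    (hu0 : forall i : 'I_2, sobolev k (u0 i))
    (hu : maximal_EP_solution k u0 Tmax u)
    (hn : forall (i : 'I_2) (p : R * R),
       cos theta * partial 0 (u0 i) p + sin theta * partial 1 (u0 i) p = 0)
    (hp0 : sin theta ^+ 2 * partial 0 (u0 0) p0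
           - sin theta * cos theta * partial 1 (u0 0) p0
           - sin theta * cos theta * partial 0 (u0 1) p0
           + cos theta ^+ 2 * partial 1 (u0 1) p0
           < - (Num.sqrt 2 * H1_norm u0)) :
  blows_up_in_finite_time Tmax.
Proof.
rewrite /blows_up_in_finite_time ltNge; apply/negP; rewrite leye_eq => /eqP TE.
case: hu => _ + _; rewrite TE => glob.
have EP T : 0 < T -> EP_solution k u0 T u by move=> T0; apply: glob; rewrite ?ltry.
have su := EP_smooth_solution hk EP.
have u00 : u 0 = u0.
  by apply/funext => i; apply/funext => p; have [_ -> _] := EP 1 ltr01.
have C1 i : Cn 1 (u0 i) by exact: CnS (CnS (sobolev_C3 hk (hu0 i))).
have Iu i : invariant (cos theta) (sin theta) (u 0 i).
  by rewrite u00; apply/(invariantP _ _ (C1 i)) => p; exact: hn.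
have cs1 := cos2Dsin2 theta.
(* The unit vector w has a nonzero component, which selects the axis of the one-dimensional
   reduction. *)
have [j j0] : exists j, normal (cos theta) (sin theta) j != 0.
  have [s0|s0] := eqVneq (sin theta) 0; last by exists 0; rewrite /normal /= oppr_eq0.
  exists 1; rewrite /normal /=; apply: contra_eq_neq cs1 => ->.
  by rewrite s0 expr0n /= addr0 eq_sym oner_eq0.
apply: (riccati_blowup (p0 := p0) (strain_admissible (cos theta) (sin theta) su)
  (fun t q t0 => strain_derivative cs1 su Iu j0 t0)).
  by apply: energy_ge0 => i; case: su => + _ _ _; move=> /(_ 0 i (lexx 0)); exact: CnS.
rewrite u00; rewrite sqrtrM // -H1_norm_energy; exact: hp0.
Qed.
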